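(* Assume that (A1) for every $t>0$ the operator $P^{\tau_{\mathcal O}}_t h(x)=\mathbb{E}^x\{1_{\{t<\tau_{\mathcal O}\}}h(X(t))\}$ maps the space of continuous bounded functions $E\to\mathbb{R}$ into itself, and (A3) $(X(t))$ is strongly Feller, i.e. $x\mapsto\mathbb{E}^x\{h(X(t))\}$ is continuous for every measurable bounded $h:E\to\mathbb{R}$ and every $t>0$. Then, as $\beta\to\infty$, the functions $w^\beta$ converge to $w$, and this convergence is uniform on compact subsets of $[0,\infty)\times\mathcal O$.
   Context: Setting. $E$ is a locally compact separable space with a metric $\rho$ for which every closed ball is compact. $(X(t))_{t\ge0}$ is a standard Markov process on $E$ (strong Markov, càdlàg, quasi-left-continuous, with complete right-continuous filtration) with laws $\mathbb{P}^x$ and expectations $\mathbb{E}^x$, $x\in E$. It is weakly Feller: $P_t\mathcal C_0\subseteq\mathcal C_0$, where $P_th(x)=\mathbb{E}^x\{h(X(t))\}$ and $\mathcal C_0$ is the space of continuous bounded functions $E\to\mathbb{R}$ vanishing at infinity. $\mathcal O\subset E$ is an open set and $\tau_{\mathcal O}=\inf\{t\ge0: X(t)\notin\mathcal O\}$. $\alpha>0$. The functions $f,F:[0,\infty)\times E\to\mathbb{R}$ are measurable, bounded, and continuous in $s$ uniformly in $x$ from compact sets (for every $s$ and compact $K\subseteq E$, $\sup_{x\in K}|F(s',x)-F(s,x)|\to0$ as $s'\to s$, and likewise for $f$), and $F$ is continuous on $[0,\infty)\times\mathcal O$. For $(s,x)\in[0,\infty)\times E$ and a stopping time $\tau$ (possibly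 infinite, with discounted terminal payoffs at an infinite time read as $0$), $$J(s,x,\tau)=\mathbb{E}^x\Big\{\int_0^{\tau\wedge\tau_{\mathcal O}}e^{-\alpha u}f(s+u,X(u))\,du+e^{-\alpha(\tau\wedge\tau_{\mathcal O})}F\big(s+(\tau\wedge\tau_{\mathcal O}),X(\tau\wedge\tau_{\mathcal O})\big)\Big\},$$ and $w(s,x)=\sup_\tau J(s,x,\tau)$ over all stopping times. For $\beta>0$, $w^\beta$ denotes the unique bounded measurable solution on $[0,\infty)\times E$ of $$w^\beta(s,x)=\mathbb{E}^x\Big\{\int_0^{\tau_{\mathcal O}}e^{-\alpha u}\big[f+\beta(F-w^\beta)^+\big](s+u,X(u))\,du+e^{-\alpha\tau_{\mathcal O}}F(s+\tau_{\mathcal O},X(\tau_{\mathcal O}))\Big\}.$$ *)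

(* Defs.v *)
From HB Require Import structures.
From mathcomp Require Import all_boot all_order all_algebra.
From mathcomp Require Import all_classical all_reals all_analysis.
From mathcomp Require Import measurable_realfun.

Set Implicit Arguments.
Unset Strict Implicit.
Unset Printing Implicit Defensive.

Import Order.TTheory GRing.Theory Num.Theory.
Import numFieldNormedType.Exports.

Local Open Scope classical_set_scope.
Local Open Scope ring_scope.

(* Pointedness (i.e. nonemptiness, automatic for a state space) is what the
   library requires in order to put a sigma-algebra on a type. *)
#[short(type="pmetricType")]
HB.structure Definition PointedMetric (K : numDomainType) :=
  {T of Metric K T & Pointed T}.

Definition Borel (T : ptopologicalType) := g_sigma_algebraType (@open T).

Section state_space.
Context {R : realType} {E : pmetricType R}.

(* The library's [closed_ball] is the closure of the open ball, which in a
   general metric space can be smaller than this set. *)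
Definition metric_closed_ball (x : E) (r : R) : set E :=
  [set y | mdist x y <= r].

Definition separable_space := exists D : set E, countable D /\ dense D.

Definition admissible_state_space :=
  [/\ locally_compact [set: E], separable_space &
      forall x r, compact (metric_closed_ball x r)].

Definition bounded_real (T : Type) (h : T -> R) :=
  exists M : R, forall x, `|h x| <= M.

Definition bounded_continuous (h : E -> R) := bounded_real h /\ continuous h.

Definition vanishing_at_infinity (h : E -> R) :=
  forall e : R, 0 < e ->
    exists2 K : set E, compact K & forall x, ~ K x -> `|h x| < e.

Definition C0 (h : E -> R) := bounded_continuous h /\ vanishing_at_infinity h.

End state_space.
Arguments admissible_state_space {R} E.

(* Time is indexed by R; all conditions concern nonnegative times only. *)
Section process.
Context {R : realType} {E : pmetricType R} {d : measure_display}
  {Omega : measurableType d}.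
Variables (P : E -> probability Omega R) (Ft : R -> set (set Omega))
  (X : R -> Omega -> E).

Definition filtration :=
  [/\ forall t, 0 <= t -> sigma_algebra setT (Ft t),
      forall t, 0 <= t -> Ft t `<=` measurable &
      forall s t, 0 <= s -> s <= t -> Ft s `<=` Ft t].

Definition right_continuous_filtration :=
  forall t A, 0 <= t -> (forall s, t < s -> Ft s A) -> Ft t A.

(* Completeness with respect to the whole family (P x)_x: the null sets are
   those that are null under every P x simultaneously. Completing with the
   null sets of one fixed P x would put every set into Ft 0, since
   P y (X 0 = x) = 0 for all y != x. *)
Definition complete_filtration :=
  forall t N A, 0 <= t -> measurable A -> (forall x, P x A = 0%E) ->
    N `<=` A -> Ft t N.

Definition adapted :=
  forall t (B : set (Borel E)), 0 <= t -> measurable B -> Ft t (X t @^-1` B).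

Definition cadlag := forall w t, 0 <= t ->
  (X^~ w @ t^'+ --> X t w) /\
  (0 < t -> exists l : E, X^~ w @ t^'- --> l).

Definition stopping_time (tau : Omega -> \bar R) :=
  (forall w, (0 <= tau w)%E) /\
  (forall t, 0 <= t -> Ft t [set w | (tau w <= t%:E)%E]).

Definition stopped_algebra (tau : Omega -> \bar R) (A : set Omega) :=
  measurable A /\
  (forall t, 0 <= t -> Ft t (A `&` [set w | (tau w <= t%:E)%E])).

(* The restarted law is expressed through the kernels of X, so no shift
   operators on Omega are needed. Here and below, [fine (tau w)] only matters
   where [tau w] is finite. *)
Definition strong_markov :=
  forall tau, stopping_time tau ->
  forall t (B : set (Borel E)) (A : set Omega) x,
    0 <= t -> measurable B -> stopped_algebra tau A ->
    P x (A `&` [set w | (tau w < +oo)%E /\ B (X (fine (tau w) + t) w)]) =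
    (\int[P x]_(w in A `&` [set w | tau w < +oo])
       P (X (fine (tau w)) w) (X t @^-1` B))%E.

Definition quasi_left_continuous :=
  forall (tau_ : nat -> Omega -> \bar R) (tau : Omega -> \bar R),
    (forall n, stopping_time (tau_ n)) ->
    (forall w, nondecreasing_seq (tau_ ^~ w)) ->
    (forall w, tau_ ^~ w @ \oo --> tau w) ->
    forall x, {ae P x, forall w, (tau w < +oo)%E ->
      (fun n => X (fine (tau_ n w)) w) @ \oo --> X (fine (tau w)) w}.

Record standard_markov_process : Prop := {
  smp_filtration : filtration ;
  smp_right_continuous : right_continuous_filtration ;
  smp_complete : complete_filtration ;
  smp_adapted : adapted ;
  smp_cadlag : cadlag ;
  smp_start : forall x, P x [set w | X 0 w = x] = 1%E ;
  smp_kernel : forall t (B : set (Borel E)), 0 <= t -> measurable B ->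
    measurable_fun [set: Borel E] (fun x => P x (X t @^-1` B)) ;
  smp_strong_markov : strong_markov ;
  smp_quasi_left_continuous : quasi_left_continuous }.

Definition semigroup (t : R) (h : E -> R) (x : E) : R :=
  \int[P x]_w h (X t w).

Definition weakly_feller := forall t h, 0 <= t -> C0 h -> C0 (semigroup t h).

Definition strongly_feller := forall t (h : E -> R), 0 < t ->
  bounded_real h -> measurable_fun [set: Borel E] h ->
  continuous (semigroup t h).

Definition exit_time (O : set E) (w : Omega) : \bar R :=
  ereal_inf [set t%:E | t in [set t : R | 0 <= t /\ ~ O (X t w)]].

Definition killed_semigroup (O : set E) (t : R) (h : E -> R) (x : E) : R :=
  \int[P x]_w (\1_[set w | (t%:E < exit_time O w)%E] w * h (X t w)).

Definition killed_feller (O : set E) := forall t h, 0 < t ->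
  bounded_continuous h -> bounded_continuous (killed_semigroup O t h).

Definition running_payoff (alpha : R) (g : R -> E -> R) (s : R)
    (T : \bar R) (w : Omega) : R :=
  \int[lebesgue_measure]_(u in [set u : R | 0 <= u /\ (u%:E <= T)%E])
    (expR (- (alpha * u)) * g (s + u) (X u w)).

Definition terminal_payoff (alpha : R) (G : R -> E -> R) (s : R)
    (T : \bar R) (w : Omega) : R :=
  if T is t%:E then expR (- (alpha * t)) * G (s + t) (X t w) else 0.

Definition expected_payoff (alpha : R) (g G : R -> E -> R) (s : R) (x : E)
    (T : Omega -> \bar R) : R :=
  \int[P x]_w (running_payoff alpha g s (T w) w
               + terminal_payoff alpha G s (T w) w).

Definition J (alpha : R) (f F : R -> E -> R) (O : set E) (s : R) (x : E)
    (tau : Omega -> \bar R) : R :=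
  expected_payoff alpha f F s x (fun w => mine (tau w) (exit_time O w)).

(* For bounded f, F and alpha > 0 this is the sup of a nonempty bounded set. *)
Definition value (alpha : R) (f F : R -> E -> R) (O : set E) (s : R) (x : E)
    : R :=
  sup [set J alpha f F O s x tau | tau in stopping_time].

End process.

Section payoff_functions.
Context {R : realType} {E : pmetricType R}.

Definition half_space (A : set E) : set (R * E) := `[0, +oo[ `*` A.

Definition bounded_on_half_space (g : R -> E -> R) :=
  exists M : R, forall (s : R) x, 0 <= s -> `|g s x| <= M.

Definition measurable_on_half_space (g : R -> E -> R) :=
  measurable_fun (half_space setT : set (R * Borel E)%type)
    (fun p : R * Borel E => g p.1 p.2).

Definition continuous_in_time_locally_uniformly (g : R -> E -> R) :=
  forall (s : R) (K : set E), 0 <= s -> compact K ->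
    {uniform K, g r @[r --> within `[0, +oo[ (nbhs s)] --> g s}.

Definition continuous_on_half_space (A : set E) (g : R -> E -> R) :=
  {within half_space A, continuous (fun p : R * E => g p.1 p.2)}.

Definition payoff_function (g : R -> E -> R) :=
  [/\ measurable_on_half_space g, bounded_on_half_space g &
      continuous_in_time_locally_uniformly g].

End payoff_functions.

(* For 0 < alpha and 0 < beta this equation has exactly one solution up to the
   (irrelevant) values at negative times. *)
Definition penalized_solution (R : realType) (E : pmetricType R)
    (d : measure_display) (Omega : measurableType d)
    (P : E -> probability Omega R) (X : R -> Omega -> E)
    (alpha : R) (f F : R -> E -> R) (O : set E) (beta : R)
    (v : R -> E -> R) : Prop :=
  [/\ measurable_on_half_space v, bounded_on_half_space v &
      forall (s : R) x, 0 <= s ->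
        v s x = expected_payoff P X alpha
          (fun r y => f r y + beta * Num.max (F r y - v r y) 0) F s x
          (exit_time X O)].

(* Main.v *)
Require Import Defs.
From HB Require Import structures.
From mathcomp Require Import all_boot all_order all_algebra.
From mathcomp Require Import all_classical all_reals all_analysis.
From mathcomp Require Import measurable_realfun.
From mathcomp Require Import ring lra.

Set Implicit Arguments.
Unset Strict Implicit.
Unset Printing Implicit Defensive.

Import Order.TTheory GRing.Theory Num.Theory.
Import numFieldNormedType.Exports.

Local Open Scope classical_set_scope.
Local Open Scope ring_scope.

(* Write v for the penalized solution and phi = (F - v)^+. By the strong Markov
   property, v is an expected payoff that can be restarted at any stopping time
   sigma, up to the nonnegative term beta E int_0^sigma phi.

   Upper bound: on short time steps that term is an average of the gains from
   stopping at deterministic times at which F > v. Choosing a good time in each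
   step gives a stopping time whose payoff dominates v, hence v <= w; the same
   stopping time compares two penalized solutions.

   Lower bound: started near (s, x) with x in O, either phi becomes small within
   a short time, where stopping costs almost nothing, or its accumulation is of
   order beta; as v is bounded independently of beta, phi is locally uniformly
   small for large beta. This uses that X does not leave a ball quickly,
   uniformly in the starting point. Dropping the penalty from the payoff of an
   almost optimal stopping time yields v -> w pointwise.

   Uniformity: up to a small error, w - v near (s, x) is at most the expectation
   of |w - v| at a slightly later time; the strong Feller property and Dini's
   theorem make this expectation uniformly small. *)

(** * Bounded measurable functions *)

(** The strong Markov hypothesis speaks of one-time marginals and [Omega] carries no shifts, whereas
    payoffs depend on whole paths; it is therefore lifted to functionals on a space of
    right-continuous paths. The obstacle there is the exit time, which is replaced by a measurable
    limit of hitting times of open sets, equal to it outside a set that quasi-left-continuity makes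
    null under every [P x]. The usual reading of the penalization as randomised stopping is
    discretised: time slices have length h with beta h <= 1/2, a bound that forces each slice to
    contain a date worth stopping at. Exit estimates must be uniform in the starting point, while
    right-continuity gives small-time limits only pointwise; a finite sum of time averages serves as
    a Lyapunov function. For uniformity in time as well as in space, all starting points are
    compared at one common later date, so that only functions of x remain. Tail suprema over a
    sequence of parameters supply the monotonicity that Dini's theorem asks for. *)

Section functional_monotone_class.
Import HBNNSimple.
Context {R : realType} d (T : measurableType d).
Variables (G : set (set T)) (V : set (T -> R)).
Hypothesis mG : @measurable d T = <<s G >>.
Hypothesis GI : setI_closed G.
Hypothesis VT : V (fun=> 1).
Hypothesis VG : forall A, G A -> V (fun x => \1_A x).
Hypothesis Vlin : forall a f g, V f -> V g -> V (fun x => a * f x + g x).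
Hypothesis Vlim : forall (f_ : nat -> T -> R) (f : T -> R) (M : R), (forall n, V (f_ n)) ->
  (forall n x, `|f_ n x| <= M) -> (forall x, f_ n x @[n --> \oo] --> f x) -> V f.

Lemma fmc_indic A : measurable A -> V (fun x => \1_A x).
Proof.
rewrite mG; move: A; apply: (@lambda_system_subset _ _ GI setT) => //.
split => //=.
- by rewrite (_ : (fun x => _) = fun=> 1)//; apply/funext => x; rewrite indicT.
- move=> A B BA VA VB.
  rewrite (_ : (fun x => _) = fun x => -1 * \1_B x + \1_A x).
    exact: Vlin.
  apply/funext => x; rewrite !indicE.
  have [xB|xB] := boolP (x \in B).
    have xA : x \in A by move: xB; rewrite !inE; exact: BA.
    rewrite xA (_ : x \in A `\` B = false) ?mulr1n ?mulr0n; first by ring.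
    by apply/negbTE; rewrite notin_setE => -[_]; apply; rewrite inE in xB.
  rewrite (_ : x \in A `\` B = (x \in A)) ?mulr0 ?mulr0n ?mulr0 ?add0r//.
  apply/idP/idP; rewrite !inE; first by case.
  by move=> ?; split => //; rewrite notin_setE in xB.
- move=> F ndF VF; apply: (@Vlim (fun n x => \1_(F n) x) _ 1) => //.
    by move=> n x; rewrite indicE; case: (_ \in _); rewrite ?normr1 ?normr0.
  move=> x; apply: cvg_near_cst.
  have [[N _ FN]|nF] := pselect ((\bigcup_k F k) x).
    exists N => // n /= Nn; apply/eqP; rewrite !indicE !mem_set//.
      by exists N.
    by move/subsetPset : (ndF _ _ Nn); exact.
  exists 0%N => // n _; apply/eqP; rewrite !indicE !memNset//.
  by move=> Fn; apply: nF; exists n.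
Qed.

(** Simple functions lie in [V] by linearity and the pi-lambda theorem. The function [f + M] is
    nonnegative and the bounded limit of its simple approximations, so it lies in [V]; removing the
    constant gives [f]. *)
Lemma functional_monotone_class (f : T -> R) :
  measurable_fun setT f -> bounded_real f -> V f.
Proof.
move=> mf [M fM].
have V0 : V (fun=> 0).
  have -> : (fun=> 0) = (fun x : T => -1 * (fun=> 1) x + (fun=> 1) x) :> (T -> R).
    by apply/funext => x; ring.
  exact: Vlin.
have Vsum (I : eqType) (s : seq I) (a : I -> R) (A : I -> set T) :
    (forall i, measurable (A i)) ->
    V (fun x => \sum_(i <- s) a i * \1_(A i) x).
  move=> mA; elim: s => [|i s ih].
    by rewrite (_ : (fun _ => _) = fun=> 0)//; apply/funext => x; rewrite big_nil.
  rewrite (_ : (fun _ => _) =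
    fun x => a i * \1_(A i) x + (\sum_(j <- s) a j * \1_(A j) x)).
    by apply: (Vlin (a i) _ ih); exact: fmc_indic.
  by apply/funext => x; rewrite big_cons.
have Vn (h : {nnsfun T >-> R}) : V h.
  rewrite (_ : (h : T -> R) = fun x => \sum_(i <- finmap.enum_fset (fset_set (range h)))
      i * \1_(h @^-1` [set i]) x); first exact: Vsum.
  by apply/funext => x; rewrite [LHS]fimfunE fsbig_finite.
pose g := (EFin \o (fun x => f x + M)).
have mg : measurable_fun setT g.
  by apply/measurable_EFinP; apply: measurable_funD.
have g0 x : setT x -> (0%:E <= g x)%E.
  by move=> _; rewrite lee_fin -lerBlDr sub0r; move: (fM x); rewrite ler_norml => /andP[].
have Vg : V (fun x => f x + M).
{ apply: (@Vlim (fun n => nnsfun_approx measurableT mg n) _ (M + M)).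
  - by move=> n; exact: Vn.
  - move=> n x; rewrite ger0_norm ?nnsfun_approxE//; last first.
      by rewrite -nnsfun_approxE; exact: fun_ge0.
    have := @le_approx _ _ _ _ g n x g0 I.
    rewrite lee_fin => /le_trans; apply.
    by rewrite lerD2r (le_trans (ler_norm _)).
  - move=> x; have := @cvg_nnsfun_approx _ _ _ _ measurableT _ mg g0 x I.
    by move=> /fine_cvgP[_]. }
rewrite (_ : f = fun x => - M * (fun=> 1) x + (f x + M)); first exact: Vlin.
by apply/funext => x; ring.
Qed.

End functional_monotone_class.

Lemma cvg_norm_le {R : realType} (u : nat -> R) (l M : R) :
  (forall n, `|u n| <= M) -> u n @[n --> \oo] --> l -> `|l| <= M.
Proof.
move=> uM /(@cvgrPdist_lt _ R^o) ul; apply/ler_addgt0Pl => e /ul[N _ /(_ N)/=].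
move=> /(_ (leqnn N)) luN; rewrite -(subrK (u N) l) (le_trans (ler_normD _ _))//.
by rewrite lerD// ltW.
Qed.

Lemma cvg_seq_unique {R : realType} (u v : nat -> R) (l l' : R) :
  (forall n, u n = v n) -> u n @[n --> \oo] --> l -> v n @[n --> \oo] --> l' ->
  l = l'.
Proof. by move=> /funext -> ul vl; exact: (cvg_unique _ ul vl). Qed.

Section expectation.
Context {R : realType} d (T : measurableType d).
Variable mu : {finite_measure set T -> \bar R}.

Definition bmeas (f : T -> R) := measurable_fun setT f /\ bounded_real f.

Lemma bmeas_cst a : bmeas (fun=> a).
Proof. by split; [exact: measurable_cst|exists `|a|]. Qed.

Lemma bmeasD f g : bmeas f -> bmeas g -> bmeas (fun x => f x + g x).
Proof.
move=> [mf [M fM]] [mg [N gN]]; split; first exact: measurable_funD.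
by exists (M + N) => x; rewrite (le_trans (ler_normD _ _))// lerD.
Qed.

Lemma bmeasM f g : bmeas f -> bmeas g -> bmeas (fun x => f x * g x).
Proof.
move=> [mf [M fM]] [mg [N gN]]; split; first exact: measurable_funM.
by exists (M * N) => x; rewrite normrM ler_pM.
Qed.

Lemma bmeasZ a f : bmeas f -> bmeas (fun x => a * f x).
Proof. exact: (bmeasM (bmeas_cst a)). Qed.

Lemma bmeasN f : bmeas f -> bmeas (fun x => - f x).
Proof. by under [X in _ -> bmeas X]eq_fun do rewrite -mulN1r; exact: bmeasZ. Qed.

Lemma bmeasB f g : bmeas f -> bmeas g -> bmeas (fun x => f x - g x).
Proof. by move=> mf mg; apply: bmeasD => //; exact: bmeasN. Qed.

Lemma bmeas_norm f : bmeas f -> bmeas (fun x => `|f x|).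
Proof.
move=> [mf [M fM]]; split; first exact: measurableT_comp.
by exists M => x; rewrite normr_id.
Qed.

Lemma bmeas_indic (A : set T) : measurable A -> bmeas (fun x => \1_A x).
Proof.
move=> mA; split; first exact: measurable_indic.
by exists 1 => x; rewrite indicE; case: (_ \in _); rewrite ?normr1 ?normr0.
Qed.

Lemma bmeas_integrable f : bmeas f -> mu.-integrable setT (EFin \o f).
Proof.
move=> [mf [M fM]]; apply: measurable_bounded_integrable => //.
  exact: fin_num_fun_lty.
exists M; split; first exact: num_real.
by move=> x Mx t _ /=; rewrite (le_trans (fM t))// ltW.
Qed.

Local Notation E f := (\int[mu]_x f x).

Lemma E_D f g : bmeas f -> bmeas g -> E (fun x => f x + g x) = E f + E g.
Proof. by move=> ? ?; rewrite RintegralD//; exact: bmeas_integrable. Qed.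

Lemma E_B f g : bmeas f -> bmeas g -> E (fun x => f x - g x) = E f - E g.
Proof. by move=> ? ?; rewrite RintegralB//; exact: bmeas_integrable. Qed.

Lemma E_Z a f : bmeas f -> E (fun x => a * f x) = a * E f.
Proof. by move=> ?; rewrite RintegralZl//; exact: bmeas_integrable. Qed.

Lemma E_le f g : bmeas f -> bmeas g -> (forall x, f x <= g x) -> E f <= E g.
Proof. by move=> ? ? ?; rewrite le_Rintegral//; exact: bmeas_integrable. Qed.

Lemma E_ge0 f : (forall x, 0 <= f x) -> 0 <= E f.
Proof. by move=> f0; exact: Rintegral_ge0. Qed.

Lemma E_indic (A : set T) : measurable A -> E (fun x => \1_A x) = fine (mu A).
Proof. by move=> mA; rewrite /Rintegral integral_indic// setIT. Qed.

Lemma E_norm f : bmeas f -> `|E f| <= E (fun x => `|f x|).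
Proof. by move=> ?; apply: le_normr_Rintegral => //; exact: bmeas_integrable. Qed.

Lemma E_ae f g : bmeas f -> bmeas g -> {ae mu, forall x, f x = g x} -> E f = E g.
Proof.
move=> [mf _] [mg _] fg; rewrite /Rintegral; congr fine.
apply: ae_eq_integral => //; [exact/measurable_EFinP|exact/measurable_EFinP|].
by apply: filterS fg => x /= ->.
Qed.

Lemma E_dct (f_ : nat -> T -> R) (f : T -> R) (M : R) : (forall n, measurable_fun setT (f_ n)) ->
  (forall n x, `|f_ n x| <= M) -> (forall x, f_ n x @[n --> \oo] --> f x) ->
  bmeas f /\ (E (f_ n) @[n --> \oo] --> E f).
Proof.
move=> mf fM fcv.
have mlf : measurable_fun setT f.
  by apply: (measurable_fun_cvg mf) => x _; exact: fcv.
have bf : bmeas f.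
  split=> //; exists M => x; exact: (cvg_norm_le (fM ^~ x) (fcv x)).
split => //.
have [] := @dominated_convergence _ T R mu setT measurableT (fun n => EFin \o f_ n)
   (EFin \o f) (fun=> M%:E).
6: move=> _ _ h; apply: fine_cvg; rewrite /= fineK//.
6: exact: integrable_fin_num (bmeas_integrable bf).
- by move=> n; exact/measurable_EFinP.
- exact/measurable_EFinP.
- apply: aeW => x _ /=; apply: cvg_EFin; [exact: nearW|exact: fcv].
- by have := bmeas_integrable (bmeas_cst M).
- by apply: aeW => x n _; rewrite /= lee_fin.
Qed.

Lemma E_cvg (f_ : nat -> T -> R) (f : T -> R) (M : R) :
  (forall n, measurable_fun setT (f_ n)) -> (forall n x, `|f_ n x| <= M) ->
  (forall x, f_ n x @[n --> \oo] --> f x) -> E (f_ n) @[n --> \oo] --> E f.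
Proof. by move=> mf fM fcv; have [] := E_dct mf fM fcv. Qed.

End expectation.

Section time_integral.
Context {R : realType} d1 d2 (T1 : measurableType d1) (T2 : measurableType d2).

(** Tonelli's theorem gives measurability for the positive and the negative part separately, whether
    or not [h] is integrable. *)
Lemma measurable_Rintegral_param (m2 : {sigma_finite_measure set T2 -> \bar R})
    (h : T1 * T2 -> R) : measurable_fun setT h ->
  measurable_fun setT (fun x => \int[m2]_y h (x, y)).
Proof.
move=> mh; have mEh : measurable_fun setT (EFin \o h) by exact/measurable_EFinP.
apply: measurableT_comp => //.
rewrite (_ : (fun x => _) = (fun x => (\int[m2]_y (EFin \o h)^\+ (x, y))
   - (\int[m2]_y (EFin \o h)^\- (x, y)))%E); last first.
  apply/funext => x; rewrite [LHS]integralE; congr (_ - _)%E;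
    apply: eq_integral => y _; by rewrite ?funeposE ?funenegE.
apply: emeasurable_funB; apply: measurable_fun_fubini_tonelli_F => //.
- exact: measurable_funepos.
- exact: measurable_funeneg.
Qed.

Lemma E_fubini (m1 : {finite_measure set T1 -> \bar R})
    (m2 : {finite_measure set T2 -> \bar R}) (h : T1 * T2 -> R) : bmeas h ->
  \int[m1]_x (\int[m2]_y h (x, y)) = \int[m2]_y (\int[m1]_x h (x, y)).
Proof.
move=> [mh [M hM]].
have b1 x : bmeas (fun y => h (x, y)).
  by split; [exact: measurableT_comp|exists M].
have b2 y : bmeas (fun x => h (x, y)).
  by split; [exact: measurableT_comp|exists M].
have ih : (m1 \x m2)%E.-integrable setT (EFin \o h).
{ 
  apply/integrable12ltyP; first exact/measurable_EFinP.
  apply: (@le_lt_trans _ _ (\int[m1]_x (M * fine (m2 setT))%:E)%E).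
  - apply: ge0_le_integral => //.
    + by move=> x _; exact: integral_ge0.
    + apply: (@measurable_fun_fubini_tonelli_F _ _ _ _ _ m2 (fun xy => `|(EFin \o h) xy|%E)) => //.
      by apply: measurableT_comp => //; exact/measurable_EFinP.
    + move=> x _; rewrite EFinM fineK ?fin_num_measure//.
      rewrite -integral_cst//; apply: ge0_le_integral => //.
      * by apply: measurableT_comp => //; apply/measurable_EFinP; exact: (b1 x).1.
      * by move=> y _; rewrite lee_fin; exact: hM.
  - rewrite integral_cst// lte_mul_pinfty ?lee_fin//.
    by rewrite mulr_ge0// ?fine_ge0// (le_trans _ (hM point)).
  by rewrite -ge0_fin_numE ?fin_num_measure. }
rewrite /Rintegral; congr fine.
transitivity (\int[m1]_x \int[m2]_y (h (x, y))%:E)%E.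
  apply: eq_integral => x _; rewrite fineK//.
  exact: (integrable_fin_num _ (bmeas_integrable m2 (b1 x))).
rewrite (Fubini ih)//=; apply: eq_integral => y _; rewrite fineK//.
exact: (integrable_fin_num _ (bmeas_integrable m1 (b2 y))).
Qed.

End time_integral.
Arguments measurable_Rintegral_param {R d1 d2 T1 T2} m2 h.

Section probability_expectation.
Context {R : realType} d (T : measurableType d) (P : probability T R).

Lemma PE_cst (a : R) : \int[P]_x a = a.
Proof.
have h : fine (P setT) = 1 by rewrite probability_setT.
by rewrite Rintegral_cst// -[RHS]mulr1 -h.
Qed.

Lemma PE_bound (f : T -> R) (M : R) : bmeas f -> (forall x, `|f x| <= M) ->
  `|\int[P]_x f x| <= M.
Proof.
move=> bf fM; rewrite (le_trans (E_norm P bf))// -[leRHS]PE_cst.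
by apply: E_le => //; [exact: bmeas_norm|exact: bmeas_cst].
Qed.

Lemma PE_ge (f : T -> R) (a : R) : bmeas f -> (forall x, a <= f x) ->
  a <= \int[P]_x f x.
Proof.
move=> bf af; rewrite -[leLHS]PE_cst; apply: E_le => //; exact: bmeas_cst.
Qed.

Lemma PE_le (f : T -> R) (a : R) : bmeas f -> (forall x, f x <= a) ->
  \int[P]_x f x <= a.
Proof.
move=> bf af; rewrite -[leRHS]PE_cst; apply: E_le => //; exact: bmeas_cst.
Qed.

Lemma PE_indic (A : set T) : measurable A -> \int[P]_x (\1_A x) = fine (P A) :> R.
Proof. by move=> mA; rewrite /Rintegral integral_indic// setIT. Qed.

End probability_expectation.

Lemma bmeas_comp {R : realType} d1 d2 (T1 : measurableType d1)
    (T2 : measurableType d2) (f : T2 -> R) (g : T1 -> T2) :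
  bmeas f -> measurable_fun setT g -> bmeas (fun x => f (g x)).
Proof.
by move=> [mf [M fM]] mg; split; [exact: measurableT_comp|exists M => x; exact: fM].
Qed.

(** * The space of right-continuous paths *)

Section borel_metric.
Context {R : realType} {E : pmetricType R}.
Import metricType_numDomainType.

Lemma measurable_open (U : set E) : open U -> measurable (U : set (Borel E)).
Proof. by move=> oU; exact: sub_sigma_algebra. Qed.

Lemma measurable_closed (U : set E) : closed U -> measurable (U : set (Borel E)).
Proof.
move=> cU; rewrite -(setCK U); apply: (@measurableC _ (Borel E)).
by apply: measurable_open; exact: closed_openC.
Qed.

(** Closed inner approximations: they exhaust an open [U], which turns membership of a limit in [U]
    into countably many closed conditions. *)
Definition deep_inside (U : set E) (r : R) : set E :=
  [set y | forall z, mdist y z < r -> U z].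

Lemma closed_deep_inside U r : closed (deep_inside U r).
Proof.
rewrite -openC openE => y /existsNP[z /not_implyP[yz nUz]].
apply/nbhs_ballP; exists (r - mdist y z); first by rewrite /= subr_gt0.
move=> y'; rewrite ballEmdist/= => yy' /(_ z); apply: contra_not nUz; apply.
have := metric_triangle y' y z; rewrite (metric_sym y' y); lra.
Qed.

Lemma deep_insideP (U : set E) x : open U -> U x ->
  exists n : nat, deep_inside U n.+1%:R^-1 x.
Proof.
rewrite openE => oU /oU/nbhs_ballP[e /= e0]; rewrite ballEmdist => exU.
have [n ne] := ltr_add_invr (y := 0) (x := e) e0.
by exists n => z xz; apply: exU => /=; rewrite (lt_trans xz)// (le_lt_trans _ ne)// add0r.
Qed.

Lemma measurable_fun_cvg_metric d (T : measurableType d)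
    (f_ : nat -> T -> Borel E) (f : T -> Borel E) :
  (forall n, measurable_fun setT (f_ n)) ->
  (forall x, (f_ n x : E) @[n --> \oo] --> (f x : E)) -> measurable_fun setT f.
Proof.
move=> mf fcv; apply: (@measurability _ _ T (Borel E) setT f (@open E)) => // _ [U oU <-].
rewrite setTI (_ : f @^-1` U = \bigcup_k \bigcup_m
   \bigcap_(n in [set n | (m <= n)%N]) (f_ n @^-1` deep_inside U k.+1%:R^-1)).
  apply: bigcupT_measurable => k; apply: bigcupT_measurable => m.
  apply: bigcap_measurable => //; first by exists m => /=.
  move=> n _; rewrite -[X in measurable X]setTI; apply: mf => //.
  exact: (@measurable_closed _ (@closed_deep_inside U _)).
apply/seteqP; split => x /=.
- move=> /(deep_insideP oU)[n dn].
  have n0 : 0 < n.+1%:R^-1 :> R by rewrite invr_gt0.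
  (* The radius is halved: one half pays for the distance from the limit to [f_ k x], the other
     keeps [f_ k x] deep inside [U]. *)
  have nS : n.+1%:R^-1 = (n.*2.+1).+1%:R^-1 + (n.*2.+1).+1%:R^-1 :> R.
    have -> : (n.*2.+1).+1%:R = 2 * n.+1%:R :> R.
      by rewrite -natrM mul2n doubleS.
    by rewrite invfM; move: (n.+1%:R^-1) => a; lra.
  have n20 : 0 < (n.*2.+1).+1%:R^-1 :> R by rewrite invr_gt0.
  have /cvgrPdist_lt/(_ _ n20)[m _ mP] := fcv x.
  exists n.*2.+1 => //; exists m => // k /= mk z kz; apply: dn.
  by rewrite (le_lt_trans (metric_triangle _ (f_ k x) _))// nS ltrD//; exact: mP.
- move=> [k _ [m _ mP]].
  have k0 : 0 < k.+1%:R^-1 :> R by rewrite invr_gt0.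
  have /cvgrPdist_lt/(_ _ k0)[m' _ mP'] := fcv x.
  apply: (mP (maxn m m')); first by rewrite /= leq_maxl.
  by rewrite metric_sym; apply: mP'; rewrite /= leq_maxr.
Qed.

End borel_metric.

Section path_space.
Context {R : realType} {E : pmetricType R}.

Definition right_continuous_path (p : R -> E) :=
  forall t, 0 <= t -> p @ t^'+ --> p t.

(** Right-continuity makes evaluation jointly measurable in time and path, so that random times can
    be inserted into paths. Values at negative times are unconstrained. *)
Record rpath := RPath {
  rpath_fun :> R -> E ;
  rpathP : right_continuous_path rpath_fun }.

Arguments rpathP : clear implicits.

Lemma right_continuous_cst : right_continuous_path (fun=> point).
Proof. by move=> t _; exact: cvg_cst. Qed.

HB.instance Definition _ := gen_eqMixin rpath.
HB.instance Definition _ := gen_choiceMixin rpath.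
HB.instance Definition _ := isPointed.Build rpath (RPath right_continuous_cst).

Definition cylinder : set (set rpath) :=
  [set C | exists (s : seq R) (B : R -> set (Borel E)),
    [/\ forall t, t \in s -> 0 <= t, forall t, measurable (B t) &
        C = [set p : rpath | forall t, t \in s -> B t (p t)]]].

Lemma cylinderI : setI_closed cylinder.
Proof.
move=> _ _ [s [B [s0 mB ->]]] [s' [B' [s0' mB' ->]]].
(* Each family is reset to the full space off its own list of times; otherwise the constraints of
   one cylinder would leak to the times of the other. *)
pose S t := if t \in s then B t else setT.
pose S' t := if t \in s' then B' t else setT.
exists (s ++ s'), (fun t => S t `&` S' t); split.
- by move=> t; rewrite mem_cat => /orP[/s0|/s0'].
- by move=> t; apply: measurableI; rewrite /S /S'; case: ifP.
- apply/seteqP; split => p /=.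
    move=> [pB pB'] t _; split; rewrite /S /S'; case: ifPn => // ?;
      [exact: pB|exact: pB'].
  move=> pS; split => t ts.
    by have := pS t; rewrite mem_cat ts => /(_ isT)[]; rewrite /S ts.
  by have := pS t; rewrite mem_cat ts orbT => /(_ isT)[_]; rewrite /S' ts.
Qed.

Lemma cylinderT : cylinder setT.
Proof. by exists [::], (fun=> setT); split => //; apply/seteqP; split. Qed.

Definition Path := g_sigma_algebraType cylinder.

Lemma measurable_coord t : 0 <= t ->
  measurable_fun setT (fun p : Path => (p : rpath) t : Borel E).
Proof.
move=> t0 _ B mB; rewrite setTI; apply: sub_sigma_algebra.
exists [:: t], (fun=> B); split => //.
- by move=> u; rewrite inE => /eqP ->.
- by apply/seteqP; split => p /= => [pB u|/(_ t)]; rewrite inE ?eqxx; [move=> /eqP ->|exact].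
Qed.

Lemma measurable_to_path d (T : measurableType d) (phi : T -> Path) :
  (forall t, 0 <= t -> measurable_fun setT (fun x => (phi x : rpath) t : Borel E)) ->
  measurable_fun setT phi.
Proof.
move=> mphi; apply: (@measurability _ _ T Path setT phi cylinder) => //.
move=> _ [_ [s [B [s0 mB ->]]] <-]; rewrite setTI.
elim: s s0 => [|t s ih] s0.
  by rewrite (_ : _ @^-1` _ = setT)//; apply/seteqP; split.
rewrite (_ : _ @^-1` _ = (fun x => (phi x : rpath) t : Borel E) @^-1` B t `&`
   (phi @^-1` [set p | forall t, t \in s -> B t (p t)])).
  apply: measurableI; last by apply: ih => u us; apply: s0; rewrite inE us orbT.
  by rewrite -[X in measurable X]setTI; apply: mphi => //; apply: s0; rewrite mem_head.
apply/seteqP; split => x /=.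
- by move=> h; split=> [|u us]; apply: h; rewrite inE ?eqxx// us orbT.
- by move=> [h1 h2] u; rewrite inE => /orP[/eqP ->//|/h2].
Qed.

(** The [.+1] puts the grid point strictly to the right of [t], because right-continuity is stated
    along [t^'+], which excludes [t] itself. *)
Definition grid (n : nat) (t : R) : R :=
  (Num.truncn (n.+1%:R * Num.max t 0)).+1%:R / n.+1%:R.

Lemma grid_itv n t : 0 <= t -> t < grid n t <= t + n.+1%:R^-1.
Proof.
move=> t0; rewrite /grid (max_l t0).
have n0 : 0 < n.+1%:R :> R by rewrite ltr0n.
have nt0 : 0 <= n.+1%:R * t by rewrite mulr_ge0.
have /andP[h1 h2] := truncn_itv nt0.
apply/andP; split; first by rewrite ltr_pdivlMr// mulrC.
by rewrite ler_pdivrMr// mulrDl mulVf ?gt_eqF// [t * _]mulrC -natr1 lerD2r.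
Qed.

Lemma grid_cvg (p : rpath) t : 0 <= t -> p (grid n t) @[n --> \oo] --> p t.
Proof.
move=> t0; apply: (@cvg_comp _ _ _ (grid ^~ t) p _ _ _ _ (rpathP p t t0)).
move=> A [e /= e0 eA].
have [N Ne] := ltr_add_invr (y := 0) (x := e) e0.
exists N => // n /= Nn; have /andP[g1 g2] := grid_itv n t0.
apply: eA => //=; rewrite ltr0_norm ?subr_lt0// opprB ltrBlDl (le_lt_trans g2)//.
rewrite ltrD2l (le_lt_trans _ Ne)// add0r lef_pV2 ?posrE ?ltr0n// ler_nat.
exact: leq_trans Nn _.
Qed.

(** Evaluation at [grid n t] uses a single coordinate on each strip of times, hence is measurable;
    right-continuity gives the limit. *)
Lemma measurable_eval :
  measurable_fun setT (fun tp : R * Path => (tp.2 : rpath) (Num.max tp.1 0) : Borel E).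
Proof.
apply: (@measurable_fun_cvg_metric _ _ _ _
  (fun n (tp : R * Path) => (tp.2 : rpath) (grid n (Num.max tp.1 0)))); last first.
  by move=> [t p] /=; apply: grid_cvg; rewrite le_max lexx orbT.
move=> n _ B mB; rewrite setTI.
rewrite (_ : _ @^-1` _ = \bigcup_k
  ([set tp : R * Path | k%:R <= n.+1%:R * Num.max tp.1 0 < k.+1%:R] `&`
   (snd @^-1` ((fun p : Path => (p : rpath) (k.+1%:R / n.+1%:R)) @^-1` (B : set E))))).
{ apply: bigcupT_measurable => k; apply: measurableI.
  - rewrite -[X in measurable X]setTI.
    have mm : measurable_fun setT (fun tp : R * Path => n.+1%:R * Num.max tp.1 0).
      by apply: measurable_funM => //; apply: measurable_maxr.
    have := mm measurableT `[k%:R, k.+1%:R[%classic (measurable_itv _).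
    by rewrite (_ : _ @^-1` _ = [set tp : R * Path | k%:R <= n.+1%:R * Num.max tp.1 0 < k.+1%:R])//;
      apply/seteqP; split => x /=; rewrite in_itv.
  - rewrite -[X in measurable X]setTI; apply: measurable_snd => //.
    rewrite -[X in measurable X]setTI; apply: measurable_coord => //. }
have ntE (t : R) (k : nat) : k%:R <= n.+1%:R * Num.max t 0 < k.+1%:R ->
  Num.truncn (n.+1%:R * Num.max t 0) = k by exact: truncn_def.
apply/seteqP; split => [[t p]/= Bp|[t p]/= [k _ [/= /ntE kt]]].
- exists (Num.truncn (n.+1%:R * Num.max t 0)) => //; split => /=.
    by apply: truncn_itv; rewrite mulr_ge0// le_max lexx orbT.
  by move: Bp; rewrite /grid (_ : Num.max (Num.max t 0) 0 = Num.max t 0)//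
    max_l// le_max lexx orbT.
- rewrite /grid (_ : Num.max (Num.max t 0) 0 = Num.max t 0)// ?kt//.
  by rewrite max_l// le_max lexx orbT.
Qed.

Lemma measurable_eval_comp d (T : measurableType d) (a : T -> R) (b : T -> Path) :
  measurable_fun setT a -> measurable_fun setT b -> (forall x, 0 <= a x) ->
  measurable_fun setT (fun x => (b x : rpath) (a x) : Borel E).
Proof.
move=> ma mb a0.
have -> : (fun x => (b x : rpath) (a x) : Borel E) =
   (fun tp : R * Path => (tp.2 : rpath) (Num.max tp.1 0) : Borel E) \o (fun x => (a x, b x)).
  by apply/funext => x /=; rewrite max_l.
apply: measurableT_comp; first exact: measurable_eval.
exact: measurable_fun_pair.
Qed.

Lemma right_continuous_shift (t : R) (p : rpath) :
  right_continuous_path (fun u => p (Num.max t 0 + u)).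
Proof.
move=> u u0; have tu : 0 <= Num.max t 0 + u by rewrite addr_ge0// le_max lexx orbT.
apply: (@cvg_comp _ _ _ (fun u => Num.max t 0 + u) p); last exact: (rpathP p _ tu).
move=> A [e /= e0 eA]; exists e => //= v /= uv vu; apply: eA => /=.
  by rewrite opprD addrACA subrr add0r.
by rewrite ltrD2l.
Qed.

(** The clamp at 0 makes this a path for every real [t], so that measurable times can be inserted
    without a side condition. *)
Definition shift_path t (p : rpath) : rpath := RPath (@right_continuous_shift t p).

Lemma right_continuous_stop (t : R) (p : rpath) : 
  right_continuous_path (fun u => p (Num.min u (Num.max t 0))).
Proof.
move=> u u0; have [tu|ut] := leP (Num.max t 0) u.
  apply: cvg_near_cst; near=> v; apply/eqP; rewrite min_r//.
  by rewrite (le_trans tu)//; near: v; exact: nbhs_right_ge.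
apply: cvg_trans (rpathP p u u0).
apply: near_eq_cvg; near=> v; rewrite min_l//.
by near: v; apply: nbhs_right_le.
Unshelve. all: by end_near. Qed.

(** The sample path frozen at [t] is an [Ft t]-measurable map into path space; events up to a
    stopping time are tested on it. *)
Definition stop_path t (p : rpath) : rpath := RPath (@right_continuous_stop t p).

Lemma measurable_shift_path d (T : measurableType d) (a : T -> R) (b : T -> Path) :
  measurable_fun setT a -> measurable_fun setT b ->
  measurable_fun setT (fun x => shift_path (a x) (b x) : Path).
Proof.
move=> ma mb; apply: measurable_to_path => t t0 /=.
apply: measurable_eval_comp => //.
  by apply: measurable_funD => //; exact: measurable_maxr.
by move=> x; rewrite addr_ge0// le_max lexx orbT.
Qed.

Lemma measurable_half_space_comp d (T : measurableType d) (g : R -> E -> R)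
    (a : T -> R) (b : T -> Borel E) : measurable_on_half_space g ->
  measurable_fun setT a -> measurable_fun setT b -> (forall x, 0 <= a x) ->
  measurable_fun setT (fun x => g (a x) (b x)).
Proof.
move=> mg ma mb a0.
have mH : measurable (half_space setT : set (R * Borel E)).
  by apply: measurableX.
have /(measurable_restrictT _ mH) mg' := mg.
have -> : (fun x => g (a x) (b x)) =
  ((fun p : R * Borel E => g p.1 p.2) \_ (half_space setT)) \o (fun x => (a x, b x)).
  by apply/funext => x /=; rewrite patchE mem_set//; split => //=; rewrite in_itv/= a0.
by apply: measurableT_comp => //; exact: measurable_fun_pair.
Qed.

End path_space.
Arguments rpath {R} E.
Arguments rpathP {R E} p t t0 : rename.
Arguments Path {R} E.

(** * The strong Markov property on path space *)

Lemma rpath_eq {R : realType} {E : pmetricType R} (p q : rpath E) :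
  (forall t, p t = q t) -> p = q.
Proof.
case: p q => [p p0] [q q0] /= /funext pq; subst q.
by congr RPath; exact: Prop_irrelevance.
Qed.

(** Provides the generating pi-system for functionals of a time and a path: rectangles whose second
    side is a mere cylinder. [C2 setT] allows the two sides of a rectangle to be treated one at a
    time. *)
Lemma measurable_prod_generated d (T1 : measurableType d) (T2 : pointedType)
    (C2 : set (set T2)) : C2 setT ->
  @measurable _ (T1 * g_sigma_algebraType C2)%type =
  <<s [set A `*` B | A in measurable & B in C2] >>.
Proof.
move=> C2T; rewrite measurable_prod_measurableType; set G := [set _ | _ in _ & _ in C2].
have sG : sigma_algebra setT <<s G >> by exact: smallest_sigma_algebra.
have [s0 sC sU] := sG.
have sI A B : <<s G >> A -> <<s G >> B -> <<s G >> (A `&` B).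
  exact: (@measurableI _ (g_sigma_algebraType (G : set (set (T1 * T2)%type)))).
apply/seteqP; split; last first.
  apply: smallest_sub; first exact: smallest_sigma_algebra.
  move=> _ [A mA [B CB <-]]; apply: sub_sigma_algebra.
  by exists A => //; exists B => //; exact: sub_sigma_algebra.
apply: smallest_sub; first exact: smallest_sigma_algebra.
move=> _ [A mA [B mB <-]].
rewrite (_ : A `*` B = (A `*` setT) `&` (setT `*` B)); last first.
  by rewrite -setXI setIT setTI.
apply: sI; first by apply: sub_sigma_algebra; exists A => //; exists setT.
move: B mB; apply: (@smallest_sub _ _ C2 [set B | <<s G >> (setT `*` B)]); last first.
  by move=> B CB; apply: sub_sigma_algebra; exists setT => //; exists B.
split => /=.
- by rewrite setX0.
- move=> B /sC; rewrite !setTD (_ : ~` (setT `*` B) = setT `*` ~` B)//.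
  apply/seteqP; split=> -[a b] /=; last by move=> [_ nB] [].
  by move=> h; split => // Bb; apply: h.
- by move=> F /sU; rewrite setX_bigcupr.
Qed.

Section markov.
Context {R : realType} {E : pmetricType R} {d : measure_display}
  {Omega : measurableType d}.
Variables (P : E -> probability Omega R) (Ft : R -> set (set Omega))
  (X : R -> Omega -> E).
Hypothesis hX : standard_markov_process P Ft X.

Lemma rc_sample_path w : right_continuous_path (X ^~ w).
Proof. by move=> t t0; have [] := smp_cadlag hX w t0. Qed.

Definition sample_path w : Path E := RPath (@rc_sample_path w).

Lemma Ft_measurable t A : 0 <= t -> Ft t A -> measurable A.
Proof. by move=> t0; have [_ h _] := smp_filtration hX; exact: h. Qed.

Lemma Ft_sigma t : 0 <= t -> sigma_algebra setT (Ft t).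
Proof. by move=> t0; have [h _ _] := smp_filtration hX; exact: h. Qed.

Lemma Ft_sub s t : 0 <= s -> s <= t -> Ft s `<=` Ft t.
Proof. by move=> s0 st; have [_ _ h] := smp_filtration hX; exact: h. Qed.

Lemma measurable_X t : 0 <= t -> measurable_fun setT (X t : Omega -> Borel E).
Proof.
by move=> t0 _ B mB; rewrite setTI; apply: (Ft_measurable t0); exact: (smp_adapted hX).
Qed.

Lemma measurable_sample_path : measurable_fun setT sample_path.
Proof. by apply: measurable_to_path => t t0; exact: measurable_X. Qed.

(** Finite times are enough for the restart arguments, since the discount makes all that happens
    after a large horizon negligible. *)
Definition real_stopping_time (sigma : Omega -> R) :=
  (forall w, 0 <= sigma w) /\
  (forall t, 0 <= t -> Ft t [set w | sigma w <= t]).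

Lemma real_stopping_timeE sigma : real_stopping_time sigma ->
  stopping_time Ft (fun w => (sigma w)%:E).
Proof.
by move=> [s0 ms]; split => [w|t t0]; rewrite ?lee_fin//=; under eq_set do rewrite lee_fin; exact: ms.
Qed.

Lemma Ft0 t : 0 <= t -> Ft t set0. Proof. by move=> /Ft_sigma[]. Qed.
Lemma FtC t A : 0 <= t -> Ft t A -> Ft t (~` A).
Proof. by move=> /Ft_sigma[_ h _] /h; rewrite setTD. Qed.
Lemma FtT t : 0 <= t -> Ft t setT.
Proof. by move=> t0; rewrite -setC0; apply: FtC => //; exact: Ft0. Qed.
Lemma Ft_bigcup t (F : (set Omega)^nat) : 0 <= t -> (forall n, Ft t (F n)) ->
  Ft t (\bigcup_n F n).
Proof. by move=> /Ft_sigma[_ _ h]; exact: h. Qed.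
Lemma FtU t A B : 0 <= t -> Ft t A -> Ft t B -> Ft t (A `|` B).
Proof.
move=> t0 FA FB; rewrite -bigcup2E; apply: Ft_bigcup => // -[|[|n]] //=.
exact: Ft0.
Qed.
Lemma FtI t A B : 0 <= t -> Ft t A -> Ft t B -> Ft t (A `&` B).
Proof.
by move=> t0 FA FB; rewrite -(setCK (_ `&` _)) setCI; apply: FtC => //; apply: FtU => //; apply: FtC.
Qed.

Lemma real_stopping_time_cst t : 0 <= t -> real_stopping_time (fun=> t).
Proof.
move=> t0; split => // s s0; have [ts|st] := leP t s.
  by rewrite (_ : [set _ | _] = setT); [exact: FtT|apply/seteqP; split].
by rewrite (_ : [set _ | _] = set0); [exact: Ft0|apply/seteqP; split].
Qed.

Lemma real_stopping_timeD sigma t : real_stopping_time sigma -> 0 <= t ->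
  real_stopping_time (fun w => sigma w + t).
Proof.
move=> [s0 ms] t0; split=> [w|u u0]; first by rewrite addr_ge0.
under eq_set do rewrite -lerBrDr.
have [tu|ut] := leP t u.
  by apply: (@Ft_sub (u - t) u); rewrite ?subr_ge0// ?gerBl//; apply: ms; rewrite subr_ge0.
rewrite (_ : [set _ | _] = set0); first exact: Ft0.
apply/seteqP; split => // w /= h.
by have := le_trans (s0 w) h; rewrite subr_ge0 leNgt ut.
Qed.

Lemma measurable_fun_Iic_sigma (T : pointedType) (G : set (set T)) (f : T -> R) :
  (forall t, <<s G >> [set w | f w <= t]) ->
  measurable_fun setT (f : g_sigma_algebraType G -> R).
Proof.
move=> Gf; apply: (@measurability _ _ (g_sigma_algebraType G) R setT f _ (RGenOInfty.measurableE R)) => //.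
move=> _ [_ [x ->] <-]; rewrite setTI.
rewrite (_ : f @^-1` _ = ~` [set w | f w <= x]).
  by apply: (@measurableC _ (g_sigma_algebraType G)); exact: Gf.
by apply/seteqP; split => w /=; rewrite in_itv/= andbT ltNge => /negP.
Qed.

Lemma measurable_fun_Iic (f : Omega -> R) :
  (forall t, measurable [set w | f w <= t]) -> measurable_fun setT f.
Proof.
move=> Gf; apply: (@measurability _ _ Omega R setT f _ (RGenOInfty.measurableE R)) => //.
move=> _ [_ [x ->] <-]; rewrite setTI.
rewrite (_ : f @^-1` _ = ~` [set w | f w <= x]); first exact: measurableC.
by apply/seteqP; split => w /=; rewrite in_itv/= andbT ltNge => /negP.
Qed.

Lemma measurable_real_stopping_time sigma : real_stopping_time sigma ->
  measurable_fun setT sigma.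
Proof.
move=> [s0 ms]; apply: measurable_fun_Iic => t.
have [t0|t0] := leP 0 t; first exact: (Ft_measurable t0 (ms _ t0)).
rewrite (_ : [set _ | _] = set0)//; apply/seteqP; split => // w /= h.
by have := le_trans (s0 w) h; rewrite leNgt t0.
Qed.

Lemma measurable_X_stop sigma : real_stopping_time sigma ->
  measurable_fun setT (fun w => X (sigma w) w : Borel E).
Proof.
move=> hs; apply: (@measurable_eval_comp _ _ _ _ sigma sample_path).
- exact: measurable_real_stopping_time.
- exact: measurable_sample_path.
- exact: hs.1.
Qed.

Lemma Ft_stop_path t sigma (C : set (R * Path E)) : 0 <= t ->
  real_stopping_time sigma -> measurable C ->
  Ft t [set w | C (Num.min (sigma w) t, stop_path t (sample_path w))].
Proof.
move=> t0 hs mC.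
(* With [Ft t] as the sigma-algebra of a measurable type, [Ft t]-measurable maps can be paired and
   composed like any others. *)
pose O' := g_sigma_algebraType (Ft t).
have mO' : @measurable _ O' = Ft t by apply: measurable_g_measurableTypeE; exact: Ft_sigma.
have m1 : measurable_fun setT (fun w : O' => Num.min (sigma w) t).
  apply: measurable_fun_Iic_sigma => u; apply: sub_sigma_algebra.
  have [tu|ut] := leP t u.
    rewrite (_ : [set _ | _] = setT); first exact: FtT.
    by apply/seteqP; split => // w _ /=; rewrite ge_min tu orbT.
  rewrite (_ : [set _ | _] = [set w | sigma w <= u]); last first.
    by apply/seteqP; split => w /=; rewrite ge_min [_ <= u as X in _ || X]leNgt ut orbF.
  have [u0|u0] := leP 0 u; first by apply: (Ft_sub u0 (ltW ut)); exact: hs.2.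
  rewrite (_ : [set _ | _] = set0); first exact: Ft0.
  by apply/seteqP; split => // w /= /(le_trans (hs.1 w)); rewrite leNgt u0.
have m2 : measurable_fun setT (fun w : O' => stop_path t (sample_path w) : Path E).
  apply: measurable_to_path => u u0 /= _ B mB; rewrite setTI (max_l t0).
  have ut0 : 0 <= Num.min u t by rewrite le_min u0 t0.
  rewrite mO'; apply: (@Ft_sub (Num.min u t)) => //; first by rewrite ge_min lexx orbT.
  exact: (smp_adapted hX).
have := measurable_fun_pair m1 m2.
by move=> /(_ measurableT C mC); rewrite setTI mO'.
Qed.

(** Progressive measurability: where [sigma <= t], both [sigma] and the position at [sigma] can be
    read off [min sigma t] and the path frozen at [t]. *)
Lemma stopped_event sigma (C : set (R * Borel E)) : real_stopping_time sigma ->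
  measurable C ->
  stopped_algebra Ft (fun w => (sigma w)%:E) [set w | C (sigma w, X (sigma w) w)].
Proof.
move=> hs mC; split.
  have := measurable_fun_pair (measurable_real_stopping_time hs) (measurable_X_stop hs).
  by move=> /(_ measurableT C mC); rewrite setTI.
move=> t t0; under [X in _ `&` X]eq_set do rewrite lee_fin.
rewrite (_ : _ `&` _ = [set w | C (Num.min (sigma w) t,
   (stop_path t (sample_path w) : rpath E) (Num.max (Num.min (sigma w) t) 0))] `&`
   [set w | sigma w <= t]).
  apply: FtI => //; last exact: hs.2.
  have mf := measurable_fun_pair (@measurable_fst _ _ R (Path E)) (@measurable_eval R E).
  have := mf measurableT C mC; rewrite setTI => mC'.
  exact: (Ft_stop_path t0 hs mC').
by apply/seteqP; split => w /= [h st]; move: h;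
  rewrite !(min_l st) (max_l (hs.1 w)) (max_l t0) (min_l st).
Qed.

Lemma stopped_algebraI sigma A B : real_stopping_time sigma ->
  stopped_algebra Ft (fun w => (sigma w)%:E) A ->
  stopped_algebra Ft (fun w => (sigma w)%:E) B ->
  stopped_algebra Ft (fun w => (sigma w)%:E) (A `&` B).
Proof.
move=> hs [mA hA] [mB hB]; split; first exact: measurableI.
by move=> t t0; rewrite setIIl; apply: FtI => //; [exact: hA|exact: hB].
Qed.

Lemma stopped_algebra_le sigma tau A : real_stopping_time sigma ->
  real_stopping_time tau -> (forall w, sigma w <= tau w) ->
  stopped_algebra Ft (fun w => (sigma w)%:E) A ->
  stopped_algebra Ft (fun w => (tau w)%:E) A.
Proof.
move=> hs ht st [mA hA]; split => // t t0.
rewrite (_ : _ `&` _ = (A `&` [set w | (sigma w)%:E <= t%:E]%E) `&` [set w | tau w <= t]).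
  by apply: FtI => //; [exact: hA|exact: ht.2].
apply/seteqP; split => w /=; rewrite !lee_fin; first by move=> [Aw tw]; rewrite (le_trans (st w)).
by move=> [[]].
Qed.

Lemma stopped_algebraT sigma : real_stopping_time sigma ->
  stopped_algebra Ft (fun w => (sigma w)%:E) setT.
Proof.
move=> hs; split => // t t0; rewrite setTI.
by under eq_set do rewrite lee_fin; exact: hs.2.
Qed.

Lemma strong_markov_marginal t (h : Borel E -> R) : 0 <= t -> bmeas h ->
  measurable_fun setT (fun y : Borel E => \int[P y]_w h (X t w)) /\
  forall sigma A x, real_stopping_time sigma ->
    stopped_algebra Ft (fun w => (sigma w)%:E) A ->
    \int[P x]_w (\1_A w * h (X (sigma w + t) w)) =
    \int[P x]_w (\1_A w * \int[P (X (sigma w) w)]_w' h (X t w')).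
Proof.
move=> t0 bh.
(* Measurability of the kernel is carried along in the class: without it the right-hand expectation
   would be neither linear nor stable under limits. *)
pose V (h : Borel E -> R) := bmeas h /\
  measurable_fun setT (fun y : Borel E => \int[P y]_w h (X t w)) /\
  forall sigma A x, real_stopping_time sigma ->
    stopped_algebra Ft (fun w => (sigma w)%:E) A ->
    \int[P x]_w (\1_A w * h (X (sigma w + t) w)) =
    \int[P x]_w (\1_A w * \int[P (X (sigma w) w)]_w' h (X t w')).
suff : V h by case.
have bX (h' : Borel E -> R) (bh' : bmeas h') : bmeas (fun w => h' (X t w)) by exact: (bmeas_comp bh' (measurable_X t0)).
have bXs sigma A (h' : Borel E -> R) (hs : real_stopping_time sigma) (mA : measurable A)
    (bh' : bmeas h') : bmeas (fun w => \1_A w * h' (X (sigma w + t) w)).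
  apply: bmeasM; first exact: bmeas_indic.
  by apply: (bmeas_comp bh'); apply: measurable_X_stop; exact: real_stopping_timeD.
have bK sigma A (h' : Borel E -> R) (hs : real_stopping_time sigma) (mA : measurable A)
    (bh' : bmeas h') : measurable_fun setT (fun y : Borel E => \int[P y]_w h' (X t w)) ->
    bmeas (fun w => \1_A w * \int[P (X (sigma w) w)]_w' h' (X t w')).
  move=> mK; apply: bmeasM; first exact: bmeas_indic.
  split; first by apply: (measurableT_comp mK); exact: measurable_X_stop.
  have [M hM] := bh'.2; exists M => w; apply: PE_bound; first exact: bX.
  by move=> ?; exact: hM.
apply: (@functional_monotone_class _ _ (Borel E) measurable V); last 2 first.
- exact: bh.1.
- exact: bh.2.
- by rewrite sigma_algebra_id//; exact: sigma_algebra_measurable.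
- by move=> A B; exact: measurableI.
- split; first exact: bmeas_cst.
  split.
    rewrite (_ : (fun y => _) = fun=> 1)//; apply/funext => y.
    by rewrite PE_cst.
  move=> sigma A x hs hA; apply: eq_Rintegral => w _; congr (_ * _).
  by rewrite PE_cst.
- move=> B mB; split; first exact: bmeas_indic.
  have EB y : \int[P y]_w \1_B (X t w) = fine (P y (X t @^-1` B)).
    rewrite -E_indic; first by apply: eq_Rintegral.
    by rewrite -[X in measurable X]setTI; apply: (measurable_X t0).
  have mK : measurable_fun setT (fun y : Borel E => \int[P y]_w \1_B (X t w)).
    under eq_fun do rewrite EB.
    by apply: measurableT_comp => //; exact: (smp_kernel hX).
  split => // sigma A x hs hA.
  have mA := hA.1.
  have := smp_strong_markov hX (real_stopping_timeE hs) x t0 mB hA.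
  have -> : A `&` [set w | (sigma w)%:E < +oo]%E = A.
    by rewrite setIidl// => w _ /=; rewrite ltry.
  have -> : A `&` [set w | ((sigma w)%:E < +oo)%E /\ B (X (fine (sigma w)%:E + t) w)] =
      A `&` (fun w => X (sigma w + t) w) @^-1` B.
    by apply/seteqP; split => w /= []; [move=> Aw [_]|move=> Aw; split => //; rewrite ltry].
  move=> /(congr1 fine) hm.
  have mXB : measurable ((fun w => X (sigma w + t) w) @^-1` B).
    rewrite -[X in measurable X]setTI.
    by apply: (measurable_X_stop (real_stopping_timeD hs t0)).
  transitivity (fine (P x (A `&` (fun w => X (sigma w + t) w) @^-1` B))).
    rewrite -E_indic; last exact: measurableI.
    by apply: eq_Rintegral => w _; rewrite indicI.
  rewrite hm integral_mkcond; congr fine; apply: eq_integral => w _.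
  rewrite patchE indicE; case: ifPn => wA; last by rewrite mul0r.
  by rewrite mul1r EB fineK// fin_num_measure// -[X in measurable X]setTI; apply: (measurable_X t0).
- move=> a f g [bf [mf hf]] [bg [mg hg]].
  have bfg : bmeas (fun x => a * f x + g x) by apply: bmeasD => //; exact: bmeasZ.
  have Elin y : \int[P y]_w (a * f (X t w) + g (X t w)) =
      a * \int[P y]_w f (X t w) + \int[P y]_w g (X t w).
    by rewrite E_D ?E_Z//; [exact: bX|apply: bmeasZ; exact: bX|exact: bX].
  split; first exact: bfg.
  split.
    under eq_fun do rewrite Elin.
    by apply: measurable_funD => //; exact: measurable_funM.
  move=> sigma A x hs hA; have mA := hA.1.
  under [RHS]eq_Rintegral do rewrite Elin mulrDr mulrCA.
  rewrite [RHS]E_D; [|apply: bmeasZ; exact: bK|exact: bK].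
  rewrite E_Z; last exact: bK.
  rewrite -hf// -hg// -E_Z; last exact: bXs.
  rewrite -E_D; [|apply: bmeasZ; exact: bXs|exact: bXs].
  by apply: eq_Rintegral => w _; rewrite mulrDr mulrCA.
- move=> f_ f M Vf fM fcv.
  have mf_ n : measurable_fun setT (f_ n) by have [[]] := Vf n.
  have bf_ n : bmeas (f_ n) by have [] := Vf n.
  have mf : measurable_fun setT f by apply: (measurable_fun_cvg mf_) => x _; exact: fcv.
  have bf : bmeas f by split => //; exists M => x; exact: (cvg_norm_le (fM ^~ x) (fcv x)).
  have cvE y : \int[P y]_w f_ n (X t w) @[n --> \oo] --> \int[P y]_w f (X t w).
    apply: (E_cvg (M := M)) => //.
    by move=> n; exact: (bX _ (bf_ n)).1.
  have mK : measurable_fun setT (fun y : Borel E => \int[P y]_w f (X t w)).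
    by apply: (measurable_fun_cvg (h := fun n (y : Borel E) => \int[P y]_w f_ n (X t w)));
      [move=> n; have [_ []] := Vf n|move=> y _; exact: cvE].
  split; first exact: bf.
  split; first exact: mK.
  move=> sigma A x hs hA; have mA := hA.1.
  have c1 : \int[P x]_w (\1_A w * f_ n (X (sigma w + t) w)) @[n --> \oo] -->
      \int[P x]_w (\1_A w * f (X (sigma w + t) w)).
    { apply: (E_cvg (M := M)).
    + by move=> n; exact: (bXs _ _ _ hs mA (bf_ n)).1.
    + move=> n w; rewrite normrM indicE; case: (_ \in _); rewrite ?normr1 ?normr0 ?mul1r// mul0r.
      exact: le_trans (fM n (X 0 w)).
    + by move=> w; apply: cvgMr; exact: fcv. }
  have c2 : \int[P x]_w (\1_A w * \int[P (X (sigma w) w)]_w' f_ n (X t w')) @[n --> \oo] -->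
      \int[P x]_w (\1_A w * \int[P (X (sigma w) w)]_w' f (X t w')).
    { apply: (E_cvg (M := M)).
    + by move=> n; have [_ [mKn _]] := Vf n; exact: (bK _ _ _ hs mA (bf_ n) mKn).1.
    + move=> n w; rewrite normrM indicE; case: (_ \in _); rewrite ?normr1 ?normr0 ?mul1r ?mul0r.
        by apply: PE_bound => //; exact: bX.
      exact: le_trans (fM n (X 0 w)).
    + by move=> w; apply: cvgMr; exact: cvE. }
  apply: (cvg_seq_unique _ c1 c2) => n.
  by have [_ [_ ->]] := Vf n.
Qed.

(* A cylinder is encoded by the increments of its sorted times, so that the
   Markov property can be applied one increment at a time. *)
Fixpoint gap_event (l : seq (R * set (Borel E))) (p : rpath E) : Prop :=
  if l is (t, B) :: l' then B (p t) /\ gap_event l' (shift_path t p) else True.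

Fixpoint gap_wf (l : seq (R * set (Borel E))) : Prop :=
  if l is (t, B) :: l' then [/\ 0 <= t, measurable B & gap_wf l'] else True.

Definition gap_set l : set (Path E) := [set p | gap_event l p].

Lemma measurable_gap_set l : gap_wf l -> measurable (gap_set l).
Proof.
elim: l => [_|[t B] l ih /= [t0 mB /ih ml]].
  by rewrite (_ : gap_set _ = setT)//; apply/seteqP; split.
rewrite (_ : gap_set _ = (fun p : Path E => (p : rpath E) t : Borel E) @^-1` B `&`
  (fun p : Path E => shift_path t p : Path E) @^-1` gap_set l)//.
apply: measurableI; rewrite -[X in measurable X]setTI.
- exact: measurable_coord.
- by apply: measurable_shift_path.
Qed.

Lemma shift_shift_path s t (p : rpath E) : 0 <= s -> 0 <= t ->
  shift_path t (shift_path s p) = shift_path (s + t) p.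
Proof.
move=> s0 t0; apply: rpath_eq => u /=.
by rewrite !max_l ?addr_ge0// addrA.
Qed.

Lemma shift_path0 (p : rpath E) : shift_path 0 p = p.
Proof. by apply: rpath_eq => u /=; rewrite maxxx add0r. Qed.

(** Induction on the list: the tail event is replaced by its conditional probability [H] given the
    position at [sigma + t], and the one-time Markov property is then applied to the product of [H]
    and the indicator of [B]. *)
Lemma markov_gap l : gap_wf l ->
  measurable_fun setT (fun y : Borel E =>
    \int[P y]_w \1_(gap_set l) (sample_path w)) /\
  forall sigma A x, real_stopping_time sigma ->
    stopped_algebra Ft (fun w => (sigma w)%:E) A ->
    \int[P x]_w (\1_A w * \1_(gap_set l) (shift_path (sigma w) (sample_path w))) =
    \int[P x]_w (\1_A w * \int[P (X (sigma w) w)]_w' \1_(gap_set l) (sample_path w')).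
Proof.
elim: l => [_|[t B] l ih /= [t0 mB wfl]].
  have -> : gap_set [::] = setT by apply/seteqP; split.
  split; last by move=> sigma A x _ _; apply: eq_Rintegral => w _;
    under eq_Rintegral do rewrite indicT; rewrite PE_cst indicT.
  rewrite (_ : (fun y : Borel E => _) = fun=> 1 : R)//; apply: funext => y.
  by rewrite -[RHS](PE_cst (P y)); apply: eq_Rintegral => w _; rewrite indicT.
have [mK ihid] := ih wfl.
have ml := measurable_gap_set wfl.
pose H (y : Borel E) := \int[P y]_w \1_(gap_set l) (sample_path w).
have bl : bmeas (fun w => \1_(gap_set l) (sample_path w) : R).
  by apply: (bmeas_comp (bmeas_indic ml)); exact: measurable_sample_path.
have bH : bmeas H.
  split => //; exists 1 => y; apply: PE_bound => // w.
  by rewrite indicE; case: (_ \in _); rewrite ?normr1 ?normr0.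
have bBH : bmeas (fun y : Borel E => \1_B y * H y).
  by apply: bmeasM => //; exact: bmeas_indic.
have [mk1 id1] := strong_markov_marginal t0 bBH.
have step sigma A x : real_stopping_time sigma ->
    stopped_algebra Ft (fun w => (sigma w)%:E) A ->
    \int[P x]_w (\1_A w * \1_(gap_set ((t, B) :: l)) (shift_path (sigma w) (sample_path w))) =
    \int[P x]_w (\1_A w * (\1_B (X (sigma w + t) w) * H (X (sigma w + t) w))).
  move=> hs hA; have hst := real_stopping_timeD hs t0.
  pose A' := A `&` [set w | B (X (sigma w + t) w)].
  have hA' : stopped_algebra Ft (fun w => (sigma w + t)%:E) A'.
    apply: (stopped_algebraI hst).
      by apply: (stopped_algebra_le hs hst _ hA) => w; rewrite lerDl.
    apply: (@stopped_event _ [set ty | B ty.2] hst).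
    have := @measurable_snd _ _ R (Borel E) measurableT B mB.
    by rewrite setTI.
  have := ihid _ _ x hst hA'; rewrite /A' => e.
  transitivity (\int[P x]_w (\1_A' w * \1_(gap_set l) (shift_path (sigma w + t) (sample_path w)))).
    apply: eq_Rintegral => w _; rewrite /A' indicI /= -mulrA; congr (_ * _).
    rewrite -(shift_shift_path _ (hs.1 w) t0) !indicE -natrM mulnb; congr (_%:R); congr nat_of_bool.
    apply/idP/andP; rewrite !inE /gap_set /= (max_l (hs.1 w)); by [].
  by rewrite e; apply: eq_Rintegral => w _; rewrite indicI /= -mulrA.
(* The case [sigma = 0], [A = setT] of [step] identifies the kernel of the longer list. *)
have K y : \int[P y]_w \1_(gap_set ((t, B) :: l)) (sample_path w) =
    \int[P y]_w (\1_B (X t w) * H (X t w)).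
  have h0 := real_stopping_time_cst (lexx 0).
  have := step _ _ y h0 (stopped_algebraT h0).
  under eq_Rintegral do rewrite indicT mul1r shift_path0.
  by under [X in _ = X -> _]eq_Rintegral do rewrite indicT mul1r add0r.
split; first by under eq_fun do rewrite K.
move=> sigma A x hs hA; rewrite (step _ _ _ hs hA) (id1 _ _ _ hs hA).
by apply: eq_Rintegral => w _; rewrite K.
Qed.

Fixpoint gaps (B : R -> set (Borel E)) (u : R) (s : seq R) :=
  if s is t :: s' then (t - u, B t) :: gaps B t s' else [::].

Lemma gaps_wf B u s : (forall t, measurable (B t)) -> path <=%R u s ->
  gap_wf (gaps B u s).
Proof.
move=> mB; elim: s u => [//|t s ih] u /= /andP[ut ts].
by split; [rewrite subr_ge0|exact: mB|exact: ih].
Qed.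

Lemma gapsP B u s (p : rpath E) : 0 <= u -> path <=%R u s ->
  gap_event (gaps B u s) (shift_path u p) <-> (forall t, t \in s -> B t (p t)).
Proof.
move=> u0; elim: s u u0 => [|t s ih] u u0 /=; first by [].
move=> /andP[ut ts]; have t0 := le_trans u0 ut.
rewrite shift_shift_path ?subr_ge0// (max_l u0) (addrC u) subrK.
rewrite (ih _ t0 ts); split => [[Bt h] v|h].
  by rewrite inE => /orP[/eqP ->//|/h].
by split=> [|v vs]; apply: h; rewrite inE ?eqxx// vs orbT.
Qed.

Lemma cylinder_gap (C : set (Path E)) : cylinder C ->
  exists l, gap_wf l /\ C = gap_set l.
Proof.
move=> [s [B [s0 mB ->]]]; pose s' := sort <=%R s.
have ps : path <=%R 0 s'.
  rewrite path_min_sorted ?sort_le_sorted//.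
  by apply/allP => t; rewrite mem_sort => /s0.
exists (gaps B 0 s'); split; first exact: gaps_wf.
apply/seteqP; split => p /=.
  move=> h; rewrite /gap_set /= -(shift_path0 p); apply/gapsP => // t.
  by rewrite mem_sort; exact: h.
by rewrite /gap_set /= -{1}(shift_path0 p) => /gapsP h t ts; apply: h; rewrite ?mem_sort.
Qed.

(** The time argument of [H] lets the restarted functional depend on [sigma], which is frozen in the
    inner expectation; payoffs restarted at [sigma] see the shifted date [s + sigma]. *)
Theorem strong_markov_path (H : R * Path E -> R) : bmeas H ->
  measurable_fun setT (fun ty : R * Borel E =>
    \int[P ty.2]_w H (ty.1, sample_path w)) /\
  forall sigma A x, real_stopping_time sigma ->
    stopped_algebra Ft (fun w => (sigma w)%:E) A ->
    \int[P x]_w (\1_A w * H (sigma w, shift_path (sigma w) (sample_path w))) =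
    \int[P x]_w (\1_A w *
       \int[P (X (sigma w) w)]_w' H (sigma w, sample_path w')).
Proof.
move=> bH.
pose V (H : R * Path E -> R) := [/\ bmeas H,
  measurable_fun setT (fun ty : R * Borel E =>
    \int[P ty.2]_w H (ty.1, sample_path w)) &
  forall sigma A x, real_stopping_time sigma ->
    stopped_algebra Ft (fun w => (sigma w)%:E) A ->
    \int[P x]_w (\1_A w * H (sigma w, shift_path (sigma w) (sample_path w))) =
    \int[P x]_w (\1_A w *
       \int[P (X (sigma w) w)]_w' H (sigma w, sample_path w'))].
suff : V H by case.
have bX (H' : R * Path E -> R) t : bmeas H' -> bmeas (fun w => H' (t, sample_path w)).
  move=> bH'; apply: (bmeas_comp bH'); apply: measurable_fun_pair => //.
  exact: measurable_sample_path.
have bXs sigma A (H' : R * Path E -> R) : real_stopping_time sigma -> measurable A ->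
    bmeas H' -> bmeas (fun w => \1_A w * H' (sigma w, shift_path (sigma w) (sample_path w))).
  move=> hs mA bH'; apply: bmeasM; first exact: bmeas_indic.
  apply: (bmeas_comp bH'); apply: measurable_fun_pair.
    exact: measurable_real_stopping_time.
  apply: measurable_shift_path; first exact: measurable_real_stopping_time.
  exact: measurable_sample_path.
have bK sigma A (H' : R * Path E -> R) : real_stopping_time sigma -> measurable A ->
    bmeas H' -> measurable_fun setT (fun ty : R * Borel E =>
      \int[P ty.2]_w H' (ty.1, sample_path w)) ->
    bmeas (fun w => \1_A w * \int[P (X (sigma w) w)]_w' H' (sigma w, sample_path w')).
  move=> hs mA bH' mK; apply: bmeasM; first exact: bmeas_indic.
  split.
    have := measurable_fun_pair (measurable_real_stopping_time hs) (measurable_X_stop hs).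
    exact: (measurableT_comp mK).
  have [M hM] := bH'.2; exists M => w; apply: PE_bound; first exact: bX.
  by move=> ?; exact: hM.
have setTcyl : cylinder (setT : set (rpath E)) by exact: cylinderT.
apply: (@functional_monotone_class _ _ (R * Path E)%type
  [set A `*` B | A in measurable & B in cylinder] V); last 2 first.
- exact: bH.1.
- exact: bH.2.
- exact: measurable_prod_generated.
- move=> _ _ [A mA [B cB <-]] [A' mA' [B' cB' <-]].
  exists (A `&` A'); first exact: measurableI.
  by exists (B `&` B'); [exact: cylinderI|rewrite setXI].
- split; first exact: bmeas_cst.
    by rewrite (_ : (fun ty => _) = fun=> 1)//; apply/funext => ty; rewrite PE_cst.
  by move=> sigma A x hs hA; apply: eq_Rintegral => w _; rewrite PE_cst.
- move=> _ [A mA [C cC <-]].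
  have mC : measurable (C : set (Path E)) by exact: sub_sigma_algebra.
  have [l [wfl Cl]] := cylinder_gap cC.
  have [mK idK] := markov_gap wfl.
  have XE t p : \1_(A `*` C) (t, p) = \1_A t * \1_(gap_set l) p :> R.
    by rewrite -Cl !indicE in_setX -mulnb natrM.
  have bl : bmeas (fun w => \1_(gap_set l) (sample_path w) : R).
    apply: (bmeas_comp (bmeas_indic (measurable_gap_set wfl))).
    exact: measurable_sample_path.
  split.
  + by apply: bmeas_indic; exact: measurableX.
  + have -> : (fun ty : R * Borel E => \int[P ty.2]_w \1_(A `*` C) (ty.1, sample_path w)) =
      (fun ty => \1_A ty.1 * \int[P ty.2]_w \1_(gap_set l) (sample_path w)).
      by apply/funext => ty; under eq_Rintegral do rewrite XE; rewrite E_Z.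
    apply: measurable_funM.
      by apply: (@measurableT_comp _ _ _ _ _ _ (\1_A : R -> R)).
    exact: (measurableT_comp mK).
  + move=> sigma A' x hs hA'.
    (* The time side of the rectangle is an event known at [sigma], so it is absorbed into the
       conditioning event. *)
    pose A'' := A' `&` [set w | A (sigma w)].
    have hA'' : stopped_algebra Ft (fun w => (sigma w)%:E) A''.
      apply: (stopped_algebraI hs hA').
      apply: (@stopped_event _ [set ty | A ty.1] hs).
      have := @measurable_fst _ _ R (Borel E) measurableT A mA.
      by rewrite setTI.
    have AE w : \1_A'' w = \1_A' w * \1_A (sigma w) :> R by rewrite /A'' indicI.
    have := idK _ _ x hs hA''.
    under eq_Rintegral do rewrite AE -mulrA -XE.
    under [X in _ = X -> _]eq_Rintegral do rewrite AE -mulrA.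
    move=> ->; apply: eq_Rintegral => w _; congr (_ * _).
    by under [RHS]eq_Rintegral do rewrite XE; rewrite E_Z.
- move=> a f g [bf mf hf] [bg mg hg].
  have Elin t y : \int[P y]_w (a * f (t, sample_path w) + g (t, sample_path w)) =
      a * \int[P y]_w f (t, sample_path w) + \int[P y]_w g (t, sample_path w).
    by rewrite E_D ?E_Z//; [exact: bX|apply: bmeasZ; exact: bX|exact: bX].
  split; first by apply: bmeasD => //; exact: bmeasZ.
    under eq_fun do rewrite Elin.
    by apply: measurable_funD => //; exact: measurable_funM.
  move=> sigma A x hs hA; have mA := hA.1.
  under [RHS]eq_Rintegral do rewrite Elin mulrDr mulrCA.
  rewrite [RHS]E_D; [|apply: bmeasZ; exact: bK|exact: bK].
  rewrite E_Z; last exact: bK.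
  rewrite -hf// -hg// -E_Z; last exact: bXs.
  rewrite -E_D; [|apply: bmeasZ; exact: bXs|exact: bXs].
  by apply: eq_Rintegral => w _; rewrite mulrDr mulrCA.
- move=> f_ f M Vf fM fcv.
  have bf_ n : bmeas (f_ n) by have [] := Vf n.
  have mf : measurable_fun setT f.
    by apply: (measurable_fun_cvg (fun n => (bf_ n).1)) => x _; exact: fcv.
  have bf : bmeas f by split => //; exists M => x; exact: (cvg_norm_le (fM ^~ x) (fcv x)).
  have M0 : 0 <= M by exact: le_trans (fM 0%N point).
  have cvE t y : \int[P y]_w f_ n (t, sample_path w) @[n --> \oo] -->
      \int[P y]_w f (t, sample_path w).
    apply: (E_cvg (M := M)) => //.
    by move=> n; exact: (bX _ _ (bf_ n)).1.
  have iM A w (u : R) : `|u| <= M -> `|\1_A w * u| <= M.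
    move=> uM; rewrite normrM indicE; case: (_ \in _); rewrite ?normr1 ?normr0 ?mul1r ?mul0r//.
  split; first exact: bf.
    by apply: (measurable_fun_cvg (h := fun n (ty : R * Borel E) => \int[P ty.2]_w f_ n (ty.1, sample_path w)));
      [move=> n; have [] := Vf n|move=> y _; exact: cvE].
  move=> sigma A x hs hA; have mA := hA.1.
  have c1 : \int[P x]_w (\1_A w * f_ n (sigma w, shift_path (sigma w) (sample_path w))) @[n --> \oo] -->
      \int[P x]_w (\1_A w * f (sigma w, shift_path (sigma w) (sample_path w))).
    { apply: (E_cvg (M := M)).
    + by move=> n; exact: (bXs _ _ _ hs mA (bf_ n)).1.
    + by move=> n w; exact: iM.
    + by move=> w; apply: cvgMr; exact: fcv. }
  have c2 : \int[P x]_w (\1_A w * \int[P (X (sigma w) w)]_w' f_ n (sigma w, sample_path w')) @[n --> \oo] -->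
      \int[P x]_w (\1_A w * \int[P (X (sigma w) w)]_w' f (sigma w, sample_path w')).
    { apply: (E_cvg (M := M)).
    + by move=> n; have [_ mKn _] := Vf n; exact: (bK _ _ _ hs mA (bf_ n) mKn).1.
    + by move=> n w; apply: iM; apply: PE_bound => //; exact: bX.
    + by move=> w; apply: cvgMr; exact: cvE. }
  apply: (cvg_seq_unique _ c1 c2) => n.
  by have [_ _ ->] := Vf n.
Qed.

End markov.

(** * Exit times from open sets *)

Lemma lt_three_thirds {R : realType} (e a b c n x y : R) : x <= a + y ->
  y <= b + c -> a < e / 3 -> b < e / 3 -> c < n -> n < e / 3 -> x < e.
Proof. by move=> *; lra. Qed.

Section first_exit.
Context {R : realType} {E : pmetricType R}.
Import metricType_numDomainType.

(** The exit time as a functional of the path: [exit_time X O w] is, up to conversion, its value at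
    the path of [w]. *)
Definition first_exit (O : set E) (p : R -> E) : \bar R :=
  ereal_inf [set t%:E | t in [set t : R | 0 <= t /\ ~ O (p t)]].

Lemma first_exit_ge0 O p : (0 <= first_exit O p)%E.
Proof. by apply: le_ereal_inf_tmp => _ [t [t0 _] <-]; rewrite lee_fin. Qed.

Lemma first_exit_le O (p : R -> E) t : 0 <= t -> ~ O (p t) ->
  (first_exit O p <= t%:E)%E.
Proof. by move=> t0 nO; apply: ereal_inf_lbound; exists t. Qed.

Lemma first_exit_in O (p : R -> E) t : 0 <= t -> (t%:E < first_exit O p)%E ->
  O (p t).
Proof.
move=> t0 h; have [//|nO] := pselect (O (p t)).
by have := @first_exit_le O p t t0 nO; rewrite leNgt h.
Qed.

Lemma first_exit_lt O (p : R -> E) a : (first_exit O p < a%:E)%E ->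
  exists t, [/\ 0 <= t, t < a & ~ O (p t)].
Proof. by move=> /ereal_inf_lt[_ [t [t0 nO] <-]]; rewrite lte_fin => ta; exists t. Qed.

Lemma first_exit_sub O O' (p : R -> E) : O' `<=` O ->
  (first_exit O' p <= first_exit O p)%E.
Proof.
move=> OO'; apply: ereal_inf_le_tmp => _ [t [t0 nO] <-]; exists t => //.
by split => // /OO'.
Qed.

Lemma right_open (N : set E) (p : rpath E) t : open N -> 0 <= t -> N (p t) ->
  exists2 e, 0 < e & forall u, t < u < t + e -> N (p u).
Proof.
move=> oN t0 Nt; have := rpathP p t t0 => /(_ N (open_nbhs_nbhs (conj oN Nt))).
move=> [e /= e0 eN]; exists e => // u /andP[tu ute]; apply: eN => //=.
by rewrite ltr0_norm ?subr_lt0// opprB ltrBlDl.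
Qed.

(** If [p t] were in the open set [O], right-continuity would keep the path there for a while after
    [t], contradicting the infimum. *)
Lemma first_exit_openN O (p : rpath E) t : open O -> first_exit O p = t%:E ->
  ~ O (p t).
Proof.
move=> oO pt Ot.
have t0 : 0 <= t by rewrite -lee_fin -pt first_exit_ge0.
have [e e0 eN] := right_open oO t0 Ot.
have : (first_exit O p < (t + e)%:E)%E by rewrite pt lte_fin ltrDl.
move=> /first_exit_lt[u [u0 ute]]; apply.
have [ut|ut|ut] := ltgtP u t.
- have [//|nO] := pselect (O (p u)).
  by have := first_exit_le u0 nO; rewrite pt lee_fin leNgt ut.
- by apply: eN; rewrite ut.
- by rewrite ut.
Qed.

(** The hitting time of [N] is the exit time from its complement. A visit to an open set lasts for a
    short time to the right, so a rational time witnesses it and countably many coordinates decide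
    the event. *)
Lemma first_exit_open_ltP (N : set E) (p : rpath E) a : open N ->
  (first_exit (~` N) p < a%:E)%E <->
  exists q : rat, [/\ 0 <= ratr q :> R, ratr q < a & N (p (ratr q))].
Proof.
move=> oN; split.
  move=> /first_exit_lt[t [t0 ta]]; rewrite /setC/= => /contrapT Nt.
  have [e e0 eN] := right_open oN t0 Nt.
  have tm : t < Num.min (t + e) a by rewrite lt_min ta ltrDl e0.
  have [q] := rat_in_itvoo tm; rewrite in_itv/= lt_min => /and3P[tq qe qa].
  by exists q; split => //; [rewrite (le_trans t0)// ltW|apply: eN; rewrite tq].
move=> [q [q0 qa Nq]]; apply: (@le_lt_trans _ _ (ratr q)%:E); last by rewrite lte_fin.
by apply: first_exit_le => //=; apply.
Qed.

Lemma measurable_first_exit_open (N : set E) : open N ->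
  measurable_fun setT (fun p : Path E => first_exit (~` N) (p : rpath E)).
Proof.
move=> oN; apply: (@measurability _ _ (Path E) (\bar R) setT _ _ (ErealGenCInfty.measurableE R)) => //.
move=> _ [_ [a ->] <-]; rewrite setTI.
rewrite (_ : _ @^-1` _ = ~` \bigcup_(q in [set q : rat | 0 <= ratr q :> R /\ ratr q < a])
   ((fun p : Path E => (p : rpath E) (ratr q) : Borel E) @^-1` N)).
  apply: measurableC; rewrite bigcup_mkcond; apply: bigcupT_measurable_rat => q.
  case: ifPn => //; rewrite inE /= => -[q0 qa].
  rewrite -[X in measurable X]setTI; apply: measurable_coord => //.
  exact: (@measurable_open R E N oN).
apply/seteqP; split => p /=; rewrite in_itv/= andbT leNgt.
  move=> /negP h [q [q0 qa] Nq]; apply: h; apply/(first_exit_open_ltP _ _ oN).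
  by exists q.
move=> h; apply/negP => /(first_exit_open_ltP _ _ oN)[q [q0 qa Nq]].
by apply: h; exists q.
Qed.

(** The path need not be in [N] at the hitting time of an open set, but by right-continuity its
    position there is a limit of points of [N]. *)
Lemma first_exit_open_attained (N : set E) (p : rpath E) t e : open N -> 0 < e ->
  first_exit (~` N) p = t%:E -> exists2 z, N z & mdist (p t) z < e.
Proof.
move=> oN e0 pt.
have t0 : 0 <= t by rewrite -lee_fin -pt first_exit_ge0.
have := rpathP p t t0 => /cvgrPdist_lt/(_ e e0)[d /= d0 de].
have : (first_exit (~` N) p < (t + d)%:E)%E by rewrite pt lte_fin ltrDl.
move=> /first_exit_lt[u [u0 utd]]; rewrite /setC/= => /contrapT Nu.
exists (p u) => //.
have : (t%:E <= u%:E)%E by rewrite -pt; apply: first_exit_le => //=; apply.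
rewrite lee_fin le_eqVlt => /predU1P[<-|tu]; first by rewrite mdistxx.
by apply: de => //=; rewrite ltr0_norm ?subr_lt0// opprB ltrBlDl.
Qed.

Definition thickening (O : set E) (n : nat) : set E :=
  [set y | exists2 z, ~ O z & mdist y z < n.+1%:R^-1].

Lemma open_thickening O n : open (thickening O n).
Proof.
rewrite openE => y [z nO yz]; apply/nbhs_ballP.
exists (n.+1%:R^-1 - mdist y z); first by rewrite /= subr_gt0.
move=> y'; rewrite ballEmdist/= => yy'; exists z => //.
move: yy'; have := metric_triangle y' y z; rewrite (metric_sym y' y).
move: (n.+1%:R^-1) (mdist y y') (mdist y z) (mdist y' z) => *; lra.
Qed.

Lemma thickening_sub O n : ~` O `<=` thickening O n.
Proof. by move=> y nO; exists y => //; rewrite mdistxx invr_gt0 ltr0n. Qed.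

Lemma thickening_nonincr O m n : (m <= n)%N -> thickening O n `<=` thickening O m.
Proof.
move=> mn y [z nO yz]; exists z => //; rewrite (lt_le_trans yz)//.
by rewrite lef_pV2 ?posrE ?ltr0n// ler_nat ltnS.
Qed.

(* The exit time from an open set is not measurable for the coordinate
   sigma-algebra; this limit of hitting times of open sets is. *)
Definition approx_exit (O : set E) (p : R -> E) : \bar R :=
  ereal_sup (range (fun n => first_exit (~` thickening O n) p)).

Lemma first_exit_thickening_homo O (p : R -> E) :
  nondecreasing_seq (fun n => first_exit (~` thickening O n) p).
Proof. by move=> m n mn; apply: first_exit_sub; apply: subsetC; exact: thickening_nonincr. Qed.

Lemma approx_exit_cvg O (p : R -> E) :
  (fun n => first_exit (~` thickening O n) p) @ \oo --> approx_exit O p.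
Proof. exact: ereal_nondecreasing_cvgn (first_exit_thickening_homo O p). Qed.

Lemma measurable_approx_exit O :
  measurable_fun setT (fun p : Path E => approx_exit O (p : rpath E)).
Proof.
apply: (emeasurable_fun_cvg (fun n (p : Path E) => first_exit (~` thickening O n) (p : rpath E))).
  by move=> n; apply: measurable_first_exit_open; exact: open_thickening.
by move=> p _; exact: approx_exit_cvg.
Qed.

Lemma approx_exit_ge O (p : R -> E) n :
  (first_exit (~` thickening O n) p <= approx_exit O p)%E.
Proof. by apply: ereal_sup_ubound; exists n. Qed.

Lemma approx_exit_ge0 O (p : R -> E) : (0 <= approx_exit O p)%E.
Proof. by rewrite (le_trans _ (approx_exit_ge O p 0))// first_exit_ge0. Qed.

Lemma approx_exit_le O (p : R -> E) : (approx_exit O p <= first_exit O p)%E.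
Proof.
apply: ge_ereal_sup => _ [n _ <-]; apply: first_exit_sub => y /=.
by move=> h; apply: contrapT => nO; apply: h; exact: thickening_sub.
Qed.

(** Paths that come arbitrarily close to the complement of [O] before a finite time and yet are
    inside [O] at that time. Outside this set [approx_exit] and [first_exit] agree. *)
Definition bad_exit (O : set E) : set (Path E) :=
  [set p | (approx_exit O (p : rpath E) < +oo)%E /\
     O ((p : rpath E) (fine (approx_exit O (p : rpath E))))].

Lemma measurable_bad_exit O : open O -> measurable (bad_exit O).
Proof.
move=> oO; apply: measurableI.
  have := @measurable_lte _ (Path E) R setT measurableT _ (fun=> +oo%E)
    (measurable_approx_exit O) (measurable_cst _).
  by rewrite setTI.
rewrite -[X in measurable X]setTI.
have mf : measurable_fun setT (fun p : Path E => fine (approx_exit O (p : rpath E))).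
  by apply: measurableT_comp => //; exact: measurable_approx_exit.
apply: (measurable_eval_comp mf (@measurable_id _ _ _)) => //.
  by move=> p; rewrite fine_ge0// approx_exit_ge0.
exact: (@measurable_open R E O oO).
Qed.

Lemma approx_exitE O (p : Path E) : ~ bad_exit O p ->
  approx_exit O (p : rpath E) = first_exit O (p : rpath E).
Proof.
move=> nb; apply/eqP; rewrite eq_le approx_exit_le/=.
have [->|fT] := eqVneq (approx_exit O (p : rpath E)) +oo%E; first exact: leey.
have fin : approx_exit O (p : rpath E) \is a fin_num.
  by rewrite ge0_fin_numE ?approx_exit_ge0// lt_neqAle fT leey.
rewrite -(fineK fin); apply: first_exit_le; first by rewrite fine_ge0// approx_exit_ge0.
by move=> Op; apply: nb; split => //; rewrite lt_neqAle fT leey.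
Qed.

Lemma first_exit_shift O (p : rpath E) t : 0 <= t -> (t%:E < first_exit O p)%E ->
  first_exit O (shift_path t p) = (first_exit O p - t%:E)%E.
Proof.
move=> t0 tT; apply/eqP; rewrite eq_le; apply/andP; split.
  rewrite leeBrDr//; apply: le_ereal_inf_tmp => _ [u [u0 nO] <-].
  have tu : t <= u.
    rewrite leNgt; apply/negP => ut; apply: nO; apply: (first_exit_in u0).
    by apply: lt_trans tT; rewrite lte_fin.
  rewrite -leeBrDr// -EFinB; apply: first_exit_le; first by rewrite subr_ge0.
  by rewrite /= (max_l t0) addrC subrK.
apply: le_ereal_inf_tmp => _ [u [u0 nO] <-].
rewrite leeBlDr// -EFinD; apply: first_exit_le; first by rewrite addr_ge0.
by move: nO; rewrite /= (max_l t0) addrC.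
Qed.

End first_exit.

(** * Exit times as stopping times *)

Section exit_time.
Context {R : realType} {E : pmetricType R} {d : measure_display}
  {Omega : measurableType d}.
Variables (P : E -> probability Omega R) (Ft : R -> set (set Omega))
  (X : R -> Omega -> E) (O : set E).
Hypothesis hX : standard_markov_process P Ft X.
Hypothesis oO : open O.
Import metricType_numDomainType.

Local Notation path := (sample_path hX).
Local Notation T := (exit_time X O).

Lemma hitting_open_stopping_time (N : set E) : open N ->
  stopping_time Ft (fun w => first_exit (~` N) (path w : rpath E)).
Proof.
move=> oN; split => [w|t t0]; first exact: first_exit_ge0.
apply: (smp_right_continuous hX) => // s ts.
have s0 : 0 <= s by rewrite (le_trans t0)// ltW.
(* Levels decreasing to [t] and starting at [a 0 = s]: the event becomes a countable intersection of
   strict hitting events, all in [Ft s], and right-continuity of the filtration lets [s] decrease to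
   [t]. *)
pose a m := t + (s - t) / m.+1%:R.
have st : 0 < s - t by rewrite subr_gt0.
rewrite (_ : [set _ | _] = ~` \bigcup_m ~` \bigcup_k
  (if (unpickle k : option rat) is Some q then
     if (0 <= ratr q :> R) && (ratr q < a m) then [set w | N (X (ratr q) w)] else set0
   else set0)).
  apply: (FtC hX) => //; apply: (Ft_bigcup hX) => // m; apply: (FtC hX) => //.
  apply: (Ft_bigcup hX) => // k; case: (unpickle k) => [q|]; last exact: (Ft0 hX).
  case: ifPn => [/andP[q0 qa]|_]; last exact: (Ft0 hX).
  apply: (@Ft_sub _ _ _ _ _ _ _ hX (ratr q) s) => //.
    rewrite (le_trans (ltW qa))// /a -lerBrDl ler_pdivrMr ?ltr0n//.
    by rewrite ler_peMr ?(ltW st)// ler1n.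
  by apply: (smp_adapted hX) => //; exact: (@measurable_open R E N oN).
have aP m w : (first_exit (~` N) (path w : rpath E) < (a m)%:E)%E <->
    (\bigcup_k
  (if (unpickle k : option rat) is Some q then
     if (0 <= ratr q :> R) && (ratr q < a m) then [set w | N (X (ratr q) w)] else set0
   else set0)) w.
  rewrite (first_exit_open_ltP _ _ oN); split.
    move=> [q [q0 qa Nq]]; exists (pickle q); first exact: I.
    by rewrite pickleK q0 qa; exact: Nq.
  move=> [k _]; case: (unpickle k) => [q|//]; case: ifPn => [/andP[q0 qa] Nq|//].
  by exists q.
apply/seteqP; split => w /=.
  move=> ht [m _]; apply; apply/aP; rewrite (le_lt_trans ht)// lte_fin.
  by rewrite ltrDl divr_gt0.
move=> h; apply/lee_addgt0Pr => e e0.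
have [m ml] := ltr_add_invr (y := 0) (x := e / (s - t)) (divr_gt0 e0 st).
rewrite add0r in ml.
have : (first_exit (~` N) (path w : rpath E) < (a m)%:E)%E.
  by apply/aP; apply: contrapT => nh; apply: h; exists m.
move=> /ltW/le_trans; apply; rewrite -EFinD lee_fin lerD2l.
by move: ml; rewrite ltr_pdivlMr// mulrC => /ltW.
Qed.

Definition exit_null_set : set Omega := path @^-1` bad_exit O.

Lemma measurable_exit_null_set : measurable exit_null_set.
Proof.
rewrite -[X in measurable X]setTI; apply: (measurable_sample_path hX) => //.
exact: measurable_bad_exit.
Qed.

(** At the hitting times of the thickenings the process is close to the complement of [O]. By
    quasi-left-continuity these positions converge to the position at [approx_exit], which therefore
    cannot lie in the open set [O]. *)
Lemma exit_null x : P x exit_null_set = 0%E.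
Proof.
have := smp_quasi_left_continuous hX
  (fun n => hitting_open_stopping_time (open_thickening O n))
  (tau := fun w => approx_exit O (path w : rpath E))
  (fun w => @first_exit_thickening_homo _ _ O (path w : rpath E))
  (fun w => @approx_exit_cvg _ _ O (path w : rpath E)) x.
move=> [A [mA A0 sA]]; apply/eqP; rewrite eq_le measure_ge0 andbT -A0.
apply: le_measure; rewrite ?inE//; first exact: measurable_exit_null_set.
move=> w [/= fin Ow]; apply: sA => /= /(_ fin).
set t := fine (approx_exit O (path w : rpath E)) in Ow *.
move=> /cvgrPdist_lt cv.
move: oO; rewrite openE => /(_ _ Ow) /nbhs_ballP[e /= e0]; rewrite ballEmdist => eO.
have e30 : 0 < e / 3 by rewrite divr_gt0.
have [m ml] := ltr_add_invr (y := 0) (x := e / 3) e30; rewrite add0r in ml.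
have [k _ kP] := cv _ e30.
pose n := maxn k m.
have := kP n (leq_maxl _ _); rewrite /=.
set T_n := first_exit _ _ => d1.
have Tfin : T_n \is a fin_num.
  rewrite ge0_fin_numE ?first_exit_ge0//.
  by apply: le_lt_trans fin; exact: (approx_exit_ge O (path w : rpath E) n).
have TE : first_exit (~` thickening O n) (path w : rpath E) = (fine T_n)%:E by rewrite fineK.
have [z [y nOy zy] d2] := first_exit_open_attained (open_thickening O n) e30 TE.
apply: nOy; apply: eO => /=.
have n1 : n.+1%:R^-1 < e / 3.
  apply: le_lt_trans ml; rewrite lef_pV2 ?posrE ?ltr0n// ler_nat ltnS; exact: leq_maxr.
have h1 := metric_triangle (X t w) (X (fine T_n) w) y.
have h2 := metric_triangle (X (fine T_n) w) z y.
have d2' : mdist (X (fine T_n) w) z < e / 3 by exact: d2.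
have d1' : mdist (X t w) (X (fine T_n) w) < e / 3 by exact: d1.
exact: (lt_three_thirds h1 h2 d1' d2' zy n1).
Qed.

Lemma exit_approxE w : ~ exit_null_set w ->
  approx_exit O (path w : rpath E) = T w.
Proof. exact: approx_exitE. Qed.

(** Off [exit_null_set] the event says that every thickening is hit by time [t]. Its part inside
    [exit_null_set] is in [Ft t] by completeness, as that set is null under all the laws at once. *)
Lemma exit_stopping_time : stopping_time Ft T.
Proof.
split=> [w|t t0]; first exact: first_exit_ge0.
have mN := measurable_exit_null_set.
have compl N : N `<=` exit_null_set -> Ft t N.
  by apply: (smp_complete hX) => //; exact: exit_null.
rewrite (_ : [set _ | _] =
  ((~` \bigcup_n ~` [set w | (first_exit (~` thickening O n) (path w : rpath E) <= t%:E)%E])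
     `&` ~` exit_null_set) `|` ([set w | (T w <= t%:E)%E] `&` exit_null_set)).
  apply: (FtU hX) => //; last by apply: compl => w [].
  apply: (FtI hX) => //; last by apply: (FtC hX) => //; exact: compl.
  apply: (FtC hX) => //; apply: (Ft_bigcup hX) => // n; apply: (FtC hX) => //.
  by apply: (hitting_open_stopping_time (open_thickening O n)).2.
apply/seteqP; split => w /=.
  move=> Tt; have [wN|wN] := pselect (exit_null_set w); [by right|left; split => //].
  move=> [n _]; apply; apply: le_trans Tt; rewrite -exit_approxE//.
  exact: (approx_exit_ge O (path w : rpath E) n).
move=> [[h wN]|[]//]; rewrite -exit_approxE//; apply: ge_ereal_sup => _ [n _ <-].
by apply: contrapT => nh; apply: h; exists n.
Qed.

Lemma measurable_stopping_time tau : stopping_time Ft tau -> measurable_fun setT tau.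
Proof.
move=> [tau0 mtau].
apply: (@measurability _ _ Omega (\bar R) setT _ _ (ErealGenOInfty.measurableE R)) => //.
move=> _ [_ [a ->] <-]; rewrite setTI.
rewrite (_ : _ @^-1` _ = ~` [set w | (tau w <= a%:E)%E]); last first.
  by apply/seteqP; split => w /=; rewrite in_itv/= andbT ltNge => /negP.
apply: measurableC; have [a0|a0] := leP 0 a.
  exact: (Ft_measurable hX a0 (mtau _ a0)).
rewrite (_ : [set _ | _] = set0)//; apply/seteqP; split => // w /= h.
by have := le_trans (tau0 w) h; rewrite lee_fin leNgt a0.
Qed.

Lemma measurable_exit_time : measurable_fun setT T.
Proof. exact: measurable_stopping_time exit_stopping_time. Qed.

Lemma stopping_time_truncate tau r : stopping_time Ft tau -> 0 <= r ->
  real_stopping_time Ft (fun w => fine (mine (tau w) r%:E)).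
Proof.
move=> [tau0 mtau] r0.
have fin w : mine (tau w) r%:E \is a fin_num.
  rewrite ge0_fin_numE; last by rewrite le_min tau0 lee_fin.
  by rewrite gt_min ltry orbT.
split=> [w|t t0]; first by rewrite fine_ge0// le_min tau0 lee_fin.
rewrite (_ : [set _ | _] = [set w | (mine (tau w) r%:E <= t%:E)%E]); last first.
  by apply/seteqP; split => w /=; rewrite -lee_fin fineK.
have [rt|tr] := leP r t.
  rewrite (_ : [set _ | _] = setT); first exact: (FtT hX).
  by apply/seteqP; split => // w _ /=; rewrite ge_min lee_fin rt orbT.
rewrite (_ : [set _ | _] = [set w | (tau w <= t%:E)%E]); first exact: mtau.
by apply/seteqP; split => w /=; rewrite ge_min [X in _ || X]lee_fin [(r <= t)%R]leNgt tr orbF.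
Qed.

(** If the exit happens by time [t], a rational between [sigma] and the exit separates them;
    otherwise [t] itself does. *)
Lemma before_exit_stopped sigma : real_stopping_time Ft sigma ->
  stopped_algebra Ft (fun w => (sigma w)%:E) [set w | ((sigma w)%:E < T w)%E].
Proof.
move=> hs; have [T0 mT] := exit_stopping_time.
have Tgt t : 0 <= t -> Ft t [set w | (t%:E < T w)%E].
  move=> t0; rewrite (_ : [set _ | _] = ~` [set w | (T w <= t%:E)%E]).
    by apply: (FtC hX) => //; exact: mT.
  by apply/seteqP; split => w /=; rewrite ltNge => /negP.
split.
  have := @measurable_lte _ Omega R setT measurableT (fun w => (sigma w)%:E) T.
  rewrite setTI; apply; last exact: measurable_exit_time.
  by apply/measurable_EFinP; exact: (measurable_real_stopping_time hX hs).
move=> t t0; under [X in _ `&` X]eq_set do rewrite lee_fin.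
rewrite (_ : _ `&` _ = ([set w | sigma w <= t] `&` [set w | (t%:E < T w)%E]) `|`
  \bigcup_k (if (unpickle k : option rat) is Some q then
     if (0 <= ratr q :> R) && (ratr q <= t) then
       [set w | sigma w <= ratr q] `&` [set w | ((ratr q)%:E < T w)%E] else set0
     else set0)).
  apply: (FtU hX) => //; first by apply: (FtI hX) => //; [exact: hs.2|exact: Tgt].
  apply: (Ft_bigcup hX) => // k; case: (unpickle k) => [q|]; last exact: (Ft0 hX).
  case: ifPn => [/andP[q0 qa]|_]; last exact: (Ft0 hX).
  apply: (@Ft_sub _ _ _ _ _ _ _ hX (ratr q) t) => //.
  by apply: (FtI hX) => //; [exact: hs.2|exact: Tgt].
apply/seteqP; split => w /=.
- move=> [sT st]; have [tT|Tt] := ltP t%:E (T w); [by left|right].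
  have Tfin : T w \is a fin_num by rewrite ge0_fin_numE// (le_lt_trans Tt)// ltry.
  move: sT Tt; rewrite -(fineK Tfin) lte_fin lee_fin => sT Tt.
  have [q] := rat_in_itvoo sT; rewrite in_itv/= => /andP[sq qT].
  exists (pickle q); first exact: I.
  rewrite pickleK.
  rewrite (le_trans (hs.1 w) (ltW sq)) (le_trans (ltW qT) Tt)/=.
  by split => /=; [exact: ltW|rewrite -(fineK Tfin) lte_fin].
- move=> [[st tT]|[k _]].
    by split => //; apply: le_lt_trans tT; rewrite lee_fin.
  case: (unpickle k) => [q|//]; case: ifPn => [/andP[q0 qt] [/= sq qT]|//].
  by split; [apply: le_lt_trans qT; rewrite lee_fin|exact: le_trans sq qt].
Qed.

(** The strong Markov property for the indicator of [bad_exit O], together with [exit_null] from the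
    position at [sigma], shows that the restarted path is almost surely not bad. *)
Lemma exit_shift_ae sigma x : real_stopping_time Ft sigma ->
  {ae P x, forall w, ((sigma w)%:E < T w)%E ->
    approx_exit O (shift_path (sigma w) (path w)) = (T w - (sigma w)%:E)%E}.
Proof.
move=> hs; pose H (tp : R * Path E) : R := \1_(bad_exit O) tp.2.
have bH : bmeas H.
  exact: (bmeas_comp (bmeas_indic (measurable_bad_exit oO)) (@measurable_snd _ _ R (Path E))).
have [_ /(_ sigma setT x hs (stopped_algebraT hs))] := strong_markov_path hX bH.
rewrite /H /=; under [RHS]eq_Rintegral => w _.
  have -> : \int[P (X (sigma w) w)]_w' (\1_(bad_exit O) (path w')) = 0 :> R.
    transitivity (fine (P (X (sigma w) w) exit_null_set)); last by rewrite exit_null.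
    by rewrite -PE_indic//; exact: measurable_exit_null_set.
  rewrite mulr0; over.
rewrite PE_cst; under eq_Rintegral do rewrite indicT mul1r.
pose B := [set w | bad_exit O (shift_path (sigma w) (path w))].
have mB : measurable B.
  rewrite -[X in measurable X]setTI.
  apply: (measurable_shift_path (measurable_real_stopping_time hX hs) (measurable_sample_path hX)) => //.
  exact: measurable_bad_exit.
rewrite (_ : (fun w => _) = (fun w => \1_B w)); last by apply/funext.
rewrite E_indic// => PB.
exists B; split => //; first by rewrite -[LHS]fineK ?fin_num_measure// PB.
move=> w /= /not_implyP[sT h]; apply: contrapT => nB; apply: h.
exact: (etrans (approx_exitE nB) (first_exit_shift (hs.1 w) sT)).
Qed.

End exit_time.

(** * Running and terminal payoffs *)

Lemma lebesgue_measure_shift {R : realType} (t : R) (A : set R) : measurable A ->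
  pushforward lebesgue_measure (fun u : R => u + t : measurableTypeR R) A =
  lebesgue_measure A.
Proof.
move=> mA; have mphi : measurable_fun setT (fun u : R => u + t : measurableTypeR R).
  exact: measurable_funD.
apply/esym/lebesgue_measure_unique => //= _ [[a b]] _ <-.
rewrite /pushforward.
rewrite (_ : _ @^-1` _ = `]a - t, b - t]%classic).
  rewrite !lebesgue_measure_itv/= !lte_fin ltrD2r.
  by case: ifP => // _; rewrite -EFinB -EFinB; congr EFin; ring.
by apply/seteqP; split => u /=; rewrite !in_itv/= ltrBlDr lerBrDr.
Qed.

Section running.
Context {R : realType} {E : pmetricType R}.
Variable alpha : R.
Hypothesis alpha0 : 0 < alpha.

Definition time_window (T : \bar R) : set R := [set u : R | 0 <= u /\ (u%:E <= T)%E].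

Lemma time_window_fin (t : R) : time_window t%:E = `[0, t]%classic.
Proof.
by apply/seteqP; split=> u /=; rewrite /time_window /= in_itv/= lee_fin; [move=> [-> ->]|move=> /andP[]].
Qed.

Lemma time_window_pinfty : time_window +oo = `[0, +oo[%classic.
Proof.
by apply/seteqP; split=> u /=; rewrite /time_window /= in_itv/= andbT; [move=> []|move=> ->; rewrite leey].
Qed.

Lemma measurable_time_window T : measurable (time_window T).
Proof.
case: T => [t||]; rewrite ?time_window_fin ?time_window_pinfty//.
by rewrite (_ : time_window _ = set0)//; apply/seteqP; split => u //= [_].
Qed.

Lemma time_window_sub T : time_window T `<=` `[0, +oo[.
Proof. by move=> u [u0 _] /=; rewrite in_itv/= u0. Qed.

(** The canonical process. A payoff of [X] at [w] is convertible to the payoff of [eval_path] at the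
    sample path of [w], so payoff estimates are proved once, path by path. *)
Definition eval_path (t : R) (p : Path E) : E := (p : rpath E) t.

Definition payoff_rate (g : R -> E -> R) (s : R) (p : Path E) (u : R) : R :=
  expR (- (alpha * u)) * g (s + Num.max u 0) ((p : rpath E) (Num.max u 0)).

Lemma running_payoffE g s T (p : Path E) :
  running_payoff eval_path alpha g s T p =
  \int[lebesgue_measure]_(u in time_window T) payoff_rate g s p u.
Proof.
apply: eq_Rintegral => u; rewrite inE => -[u0 _].
by rewrite /payoff_rate /eval_path (max_l u0).
Qed.

Lemma measurable_expR_discount d (T : measurableType d) (h : T -> R) :
  measurable_fun setT h -> measurable_fun setT (fun x => expR (- (alpha * h x))).
Proof.
move=> mh; apply: measurableT_comp => //; apply: measurableT_comp => //.
exact: measurable_funM.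
Qed.

Lemma discount_le1 u : 0 <= u -> expR (- (alpha * u)) <= 1.
Proof. by move=> u0; rewrite -expR0 ler_expR oppr_le0 mulr_ge0// ltW. Qed.

Section bounded_payoff.
Variables (g : R -> E -> R) (M : R).
Hypothesis mg : measurable_on_half_space g.
Hypothesis gM : forall s x, 0 <= s -> `|g s x| <= M.

Lemma measurable_payoff_rate d (Y : measurableType d) (a : Y -> R) (b : Y -> Path E)
    (c : Y -> R) : measurable_fun setT a -> measurable_fun setT b ->
  measurable_fun setT c -> (forall y, 0 <= a y) ->
  measurable_fun setT (fun y => payoff_rate g (a y) (b y) (c y)).
Proof.
move=> ma mb mc a0; have mx : measurable_fun setT (fun y => Num.max (c y) 0).
  exact: measurable_maxr.
have m0 y : 0 <= Num.max (c y) 0 by rewrite le_max lexx orbT.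
apply: measurable_funM; first exact: measurable_expR_discount.
apply: (measurable_half_space_comp mg).
- exact: measurable_funD.
- exact: measurable_eval_comp.
- by move=> y; rewrite addr_ge0.
Qed.

Lemma payoff_rate_bound s p u : 0 <= s -> 0 <= u ->
  `|payoff_rate g s p u| <= M * expR (- (alpha * u)).
Proof.
move=> s0 u0; rewrite normrM ger0_norm ?expR_ge0// mulrC ler_wpM2r ?expR_ge0//.
by apply: gM; rewrite addr_ge0// le_max lexx orbT.
Qed.

Lemma M_ge0 : 0 <= M.
Proof. by apply: le_trans (gM point (lexx 0)). Qed.

Lemma integrable_discount :
  lebesgue_measure.-integrable `[0, +oo[ (fun u => (expR (- (alpha * u)))%:E).
Proof.
have h := integrable_exponential_pdf alpha0.
have m0 : measurable (`[0, +oo[ : set R) by exact: measurable_itv.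
have : lebesgue_measure.-integrable (`[0, +oo[ : set R) (EFin \o exponential_pdf alpha).
  exact: (@integrableS _ _ _ _ setT).
move=> h1; have := @integrableZl _ _ R lebesgue_measure _ m0 alpha^-1 _ h1.
apply: eq_integrable => //.
move=> u; rewrite inE /= in_itv/= andbT => u0.
by rewrite exponential_pdfE// -EFinM mulKf ?gt_eqF// mulNr.
Qed.

Lemma integral_discount :
  \int[lebesgue_measure]_(u in `[0, +oo[) expR (- (alpha * u)) = alpha^-1.
Proof.
transitivity (\int[lebesgue_measure]_(u in `[0, +oo[)
   (alpha^-1 * exponential_pdf alpha u)).
  apply: eq_Rintegral => u; rewrite inE /= in_itv/= andbT => u0.
  by rewrite exponential_pdfE// mulKf ?gt_eqF// mulNr.
rewrite RintegralZl//; last first.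
  by apply: (@integrableS _ _ _ _ setT) => //; exact: integrable_exponential_pdf.
rewrite [X in _ * X](_ : _ = 1) ?mulr1//.
have := integral_exponential_pdf alpha0; rewrite /Rintegral => h.
transitivity (fine (\int[lebesgue_measure]_x (exponential_pdf alpha x)%:E)%E); last by rewrite h.
congr fine; rewrite integral_mkcond; apply: eq_integral => u _; rewrite patchE.
case: ifPn => //; rewrite notin_setE /= in_itv/= andbT => /negP; rewrite -ltNge => u0.
by rewrite lt0_exponential_pdf.
Qed.

Lemma integrable_payoff_rate (s : R) (p : Path E) (D : set R) : 0 <= s -> measurable D -> D `<=` `[0, +oo[ ->
  lebesgue_measure.-integrable D (EFin \o payoff_rate g s p).
Proof.
move=> s0 mD D0; have m0 : measurable (`[0, +oo[ : set R) by exact: measurable_itv.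
apply: (@integrableS _ _ R lebesgue_measure `[0, +oo[) => //.
have := @integrableZl _ _ R lebesgue_measure _ m0 M _ integrable_discount.
apply: le_integrable => //.
  apply/measurable_EFinP; apply: measurable_funTS.
  by apply: (@measurable_payoff_rate _ R (cst s) (cst p) id).
move=> u /=; rewrite in_itv/= andbT => u0; rewrite lee_fin.
by rewrite (le_trans (payoff_rate_bound p s0 u0))// ler_norm.
Qed.

Lemma running_payoff_bound s T (p : Path E) : 0 <= s ->
  `|running_payoff eval_path alpha g s T p| <= M / alpha.
Proof.
move=> s0; rewrite running_payoffE.
have mT := measurable_time_window T.
have sT := @time_window_sub T.
rewrite (le_trans (le_normr_Rintegral _ (integrable_payoff_rate p s0 mT sT)))//.
rewrite -integral_discount -RintegralZl//; last exact: integrable_discount.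
rewrite Rintegral_mkcond [leRHS]Rintegral_mkcond.
have i1 : lebesgue_measure.-integrable `[0, +oo[
    (EFin \o (fun u => M * expR (- (alpha * u)))).
  have m0 : measurable (`[0, +oo[ : set R) by exact: measurable_itv.
  exact: (@integrableZl _ _ R lebesgue_measure _ m0 M _ integrable_discount).
apply: le_Rintegral => //.
- rewrite -restrict_EFin; apply: (iffLR (@integrable_mkcond _ _ R lebesgue_measure _ _ mT)).
  exact: (integrable_abse (integrable_payoff_rate p s0 mT sT)).
- rewrite -restrict_EFin; apply: (iffLR (integrable_mkcond _ _)) => //; exact: measurable_itv.
- move=> u _; rewrite !patchE; case: ifPn => [|_]; rewrite ?inE.
    move=> [u0 _]; rewrite mem_set/= ?in_itv/= ?u0//.
    exact: payoff_rate_bound.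
  by case: ifPn => // _; rewrite mulr_ge0 ?M_ge0 ?expR_ge0.
Qed.

Lemma measurable_running_payoff d (Y : measurableType d) (a : Y -> R)
    (T : Y -> \bar R) (b : Y -> Path E) : measurable_fun setT a ->
  measurable_fun setT T -> measurable_fun setT b -> (forall y, 0 <= a y) ->
  measurable_fun setT (fun y => running_payoff eval_path alpha g (a y) (T y) (b y)).
Proof.
move=> ma mT mb a0.
pose h (yu : Y * R) := if (0 <= yu.2) && (yu.2%:E <= T yu.1)%E then
  payoff_rate g (a yu.1) (b yu.1) yu.2 else 0.
have mh : measurable_fun setT h.
  apply: measurable_fun_ifT => //.
    apply: measurable_and; first exact: measurable_fun_ler.
    apply: measurable_fun_lee; first by apply/measurable_EFinP.
    exact: measurableT_comp.
  by apply: measurable_payoff_rate => //; exact: measurableT_comp.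
have := measurable_Rintegral_param lebesgue_measure h mh.
rewrite (_ : (fun x : Y => _) =
  (fun y => running_payoff eval_path alpha g (a y) (T y) (b y)))//.
apply/funext => y; rewrite running_payoffE [RHS]Rintegral_mkcond.
apply: eq_Rintegral => u _; rewrite patchE /h /=.
rewrite (_ : u \in time_window (T y) = (0 <= u) && (u%:E <= T y)%E)//.
by apply/idP/andP; rewrite inE.
Qed.

Lemma running_payoff_split s t T (p : Path E) : 0 <= s -> 0 <= t -> (t%:E <= T)%E ->
  running_payoff eval_path alpha g s T p = running_payoff eval_path alpha g s t%:E p +
  expR (- (alpha * t)) *
    running_payoff eval_path alpha g (s + t) (T - t%:E)%E (shift_path t p).
Proof.
move=> s0 t0 tT; rewrite !running_payoffE.
pose D := [set u : R | t < u /\ (u%:E <= T)%E].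
have DE : D = time_window T `\` `[0, t]%classic.
  apply/seteqP; split => u /=; rewrite in_itv/=.
    move=> [tu uT]; split; first by split => //; rewrite ltW// (le_lt_trans t0).
    by rewrite [u <= t]leNgt tu andbF.
  by move=> [[u0 uT]]; rewrite u0/= => /negP; rewrite -ltNge.
have mD : measurable D.
  by rewrite DE; apply: measurableD => //; exact: measurable_time_window.
have D0 : D `<=` `[0, +oo[.
  by rewrite DE => u [/time_window_sub].
have TD : time_window T = `[0, t]%classic `|` D.
  apply/seteqP; split => u /=.
    move=> [u0 uT]; have [ut|tu] := leP u t; [left|right] => //.
    by rewrite in_itv/= u0.
  rewrite in_itv/= => -[/andP[u0 ut]|[tu uT]].
    by split => //; apply: le_trans tT; rewrite lee_fin.
  by split => //; rewrite ltW// (le_lt_trans t0).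
have i1 := integrable_payoff_rate p s0 (measurable_time_window T) (@time_window_sub T).
rewrite TD in i1; rewrite TD Rintegral_setU//; last first.
  by apply/disj_setPS => u [/=]; rewrite in_itv/= => /andP[_ ut] [tu _]; move: tu; rewrite ltNge ut.
rewrite time_window_fin; congr (_ + _).
pose D' := [set v : R | 0 < v /\ ((v + t)%:E <= T)%E].
have D'E : (fun u : R => u + t : measurableTypeR R) @^-1` D = D'.
  by apply/seteqP; split => v /=; rewrite /D /D' /= ltrDr.
have mphi : measurable_fun setT (fun u : R => u + t : measurableTypeR R).
  exact: measurable_funD.
have mD' : measurable D' by rewrite -D'E -[X in measurable X]setTI; exact: mphi.
have D'0 : D' `<=` `[0, +oo[ by move=> v [v0 _] /=; rewrite in_itv/= (ltW v0).
have rateE v : 0 <= v -> payoff_rate g s p (v + t) =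
    expR (- (alpha * t)) * payoff_rate g (s + t) (shift_path t p) v.
  move=> v0; rewrite /payoff_rate /= !max_l ?addr_ge0// mulrA -expRD.
  congr (expR _ * g _ (p _)); [ring|ring|exact: addrC].
have st0 : 0 <= s + t by rewrite addr_ge0.
have mrate : measurable_fun setT (payoff_rate g s p).
  by apply: (@measurable_payoff_rate _ R (cst s) (cst p) id).
have iD' : lebesgue_measure.-integrable D' (EFin \o payoff_rate g (s + t) (shift_path t p)).
  exact: integrable_payoff_rate.
transitivity (\int[lebesgue_measure]_(v in D') (expR (- (alpha * t)) *
    payoff_rate g (s + t) (shift_path t p) v)).
{ rewrite /Rintegral; congr fine.
  rewrite (eq_measure_integral (pushforward lebesgue_measure
    (fun u : R => u + t : measurableTypeR R))); last first.
    by move=> A mA _; exact/esym/lebesgue_measure_shift.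
  rewrite integral_pushforward//.
  - rewrite D'E; apply: eq_integral => v; rewrite inE => -[v0 _] /=.
    by rewrite rateE// ltW.
  - exact/measurable_EFinP.
  - rewrite D'E.
    have := @integrableZl _ _ R lebesgue_measure _ mD' (expR (- (alpha * t))) _ iD'.
    apply: eq_integrable => // v; rewrite inE => -[v0 _] /=.
    by rewrite -EFinM rateE// ltW. }
rewrite RintegralZl//; congr (_ * _).
have i2 := integrable_payoff_rate (shift_path t p) st0 (measurable_time_window (T - t%:E)%E) (@time_window_sub _).
(* Translating the half-open window after [t] loses the endpoint 0 of the restarted window, a null
   set. *)
have TD' : time_window (T - t%:E)%E = [set 0] `|` D'.
  apply/seteqP; split => v /=.
    move=> [v0 vT]; have [v00|v00] := eqVneq v 0; [by left|right; split].
      by rewrite lt_neqAle eq_sym v00.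
    by rewrite EFinD -leeBrDr.
  move=> [->|[v0 vT]].
    by split => //; rewrite EFinN leeBrDr// add0e.
  by split; [exact: ltW|rewrite EFinN leeBrDr// -EFinD].
rewrite TD' in i2; rewrite TD' Rintegral_setU//.
  by rewrite Rintegral_set1 add0r.
by apply/disj_setPS => u [/= -> [+ _]]; rewrite ltxx.
Qed.

Lemma terminal_payoff_bound s T (p : Path E) : 0 <= s -> (0 <= T)%E ->
  `|terminal_payoff eval_path alpha g s T p| <= M.
Proof.
move=> s0; case: T => [t t0||] /=; rewrite ?normr0 ?M_ge0//.
rewrite lee_fin in t0.
rewrite normrM ger0_norm ?expR_ge0// -[leRHS]mul1r ler_pM ?expR_ge0//.
  exact: discount_le1.
by apply: gM; rewrite addr_ge0.
Qed.

Lemma measurable_terminal_payoff d (Y : measurableType d) (a : Y -> R)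
    (T : Y -> \bar R) (b : Y -> Path E) : measurable_fun setT a ->
  measurable_fun setT T -> measurable_fun setT b -> (forall y, 0 <= a y) ->
  (forall y, (0 <= T y)%E) ->
  measurable_fun setT (fun y => terminal_payoff eval_path alpha g (a y) (T y) (b y)).
Proof.
move=> ma mT mb a0 T0.
have -> : (fun y => terminal_payoff eval_path alpha g (a y) (T y) (b y)) =
   (fun y => if (T y < +oo)%E then payoff_rate g (a y) (b y) (fine (T y)) else 0).
  apply/funext => y; have := T0 y; case: (T y) => [t|//|//]; rewrite lee_fin => t0.
  by rewrite ltry /payoff_rate /= (max_l t0).
apply: measurable_fun_ifT => //; first exact: measurable_fun_lte.
apply: measurable_payoff_rate => //.
exact: measurableT_comp.
Qed.

Lemma terminal_payoff_split s t T (p : Path E) : 0 <= t -> (t%:E <= T)%E ->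
  terminal_payoff eval_path alpha g s T p = expR (- (alpha * t)) *
    terminal_payoff eval_path alpha g (s + t) (T - t%:E)%E (shift_path t p).
Proof.
move=> t0; case: T => [u||]//=; rewrite ?mulr0// lee_fin => tu.
rewrite mulrA -expRD /eval_path /= (max_l t0).
congr (expR _ * g _ (p _)); ring.
Qed.

Lemma running_payoff_short s T r (p : Path E) : 0 <= s -> 0 <= r -> (T <= r%:E)%E ->
  `|running_payoff eval_path alpha g s T p| <= M * r.
Proof.
move=> s0 r0 Tr; rewrite running_payoffE.
have mT := measurable_time_window T.
have sT := @time_window_sub T.
rewrite (le_trans (le_normr_Rintegral _ (integrable_payoff_rate p s0 mT sT)))//.
rewrite Rintegral_mkcond.
apply: (@le_trans _ _ (\int[lebesgue_measure]_(u in `[0, r]) M)).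
{ rewrite [leRHS]Rintegral_mkcond; apply: le_Rintegral => //.
  - rewrite -restrict_EFin; apply: (iffLR (@integrable_mkcond _ _ R lebesgue_measure _ _ mT)).
    exact: (integrable_abse (integrable_payoff_rate p s0 mT sT)).
  - have mr : measurable (`[0, r] : set R) by exact: measurable_itv.
    rewrite -restrict_EFin; apply: (iffLR (@integrable_mkcond _ _ R lebesgue_measure _ _ mr)).
    apply: measurable_bounded_integrable => //.
    + by rewrite [X in (X < _)%E]lebesgue_measure_itv /=; case: ifP; rewrite ltry.
    + by exists M; split; [exact: num_real|move=> x Mx t _ /=; rewrite ger0_norm ?M_ge0// ltW].
  - move=> u _; rewrite !patchE; case: ifPn => [|_]; rewrite ?inE.
      move=> [u0 uT]; rewrite mem_set/=; last first.
        by rewrite in_itv/= u0 -lee_fin (le_trans uT).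
      rewrite (le_trans (payoff_rate_bound _ s0 u0))// -[leRHS]mulr1.
      by rewrite ler_wpM2l ?M_ge0// discount_le1.
    by case: ifPn => // _; exact: M_ge0. }
rewrite Rintegral_cst//= [X in fine X]lebesgue_measure_itv/= lte_fin.
have [r00|r00] := ltP 0 r; first by rewrite -EFinB/= subr0.
by rewrite /= mulr0 mulr_ge0 ?M_ge0.
Qed.

End bounded_payoff.

Lemma running_payoffD (g h : R -> E -> R) (M N : R) s T (p : Path E) : 0 <= s ->
  measurable_on_half_space g -> measurable_on_half_space h ->
  (forall s x, 0 <= s -> `|g s x| <= M) -> (forall s x, 0 <= s -> `|h s x| <= N) ->
  running_payoff eval_path alpha (fun s x => g s x + h s x) s T p =
  running_payoff eval_path alpha g s T p + running_payoff eval_path alpha h s T p.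
Proof.
move=> s0 mg mh gM hN; rewrite !running_payoffE.
have mT := measurable_time_window T.
have sT := @time_window_sub T.
rewrite -RintegralD//; [|exact: (integrable_payoff_rate mg gM)|exact: (integrable_payoff_rate mh hN)].
by apply: eq_Rintegral => u _; rewrite /payoff_rate mulrDr.
Qed.

Lemma running_payoffZ (g : R -> E -> R) (M : R) a s T (p : Path E) : 0 <= s ->
  measurable_on_half_space g -> (forall s x, 0 <= s -> `|g s x| <= M) ->
  running_payoff eval_path alpha (fun s x => a * g s x) s T p =
  a * running_payoff eval_path alpha g s T p.
Proof.
move=> s0 mg gM; rewrite !running_payoffE.
rewrite -RintegralZl//.
- by apply: eq_Rintegral => u _; rewrite /payoff_rate mulrCA.
- exact: measurable_time_window.
- by apply: (integrable_payoff_rate mg gM) => //; [exact: measurable_time_window|exact: time_window_sub].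
Qed.

Lemma running_payoff_ge0 (g : R -> E -> R) s T (p : Path E) : 0 <= s ->
  (forall s x, 0 <= s -> 0 <= g s x) -> 0 <= running_payoff eval_path alpha g s T p.
Proof.
move=> s0 g0; rewrite running_payoffE; apply: Rintegral_ge0 => u _.
by rewrite mulr_ge0 ?expR_ge0// g0// addr_ge0// le_max lexx orbT.
Qed.

End running.

(** * Restarting an expected payoff at a stopping time *)

Section restart.
Context {R : realType} {E : pmetricType R} {d : measure_display}
  {Omega : measurableType d}.
Variables (P : E -> probability Omega R) (Ft : R -> set (set Omega))
  (X : R -> Omega -> E) (O : set E) (alpha : R).
Hypothesis hX : standard_markov_process P Ft X.
Hypothesis oO : open O.
Hypothesis alpha0 : 0 < alpha.

Local Notation path := (sample_path hX).
Local Notation T := (exit_time X O).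

Definition admissible_payoff (g : R -> E -> R) :=
  measurable_on_half_space g /\ bounded_on_half_space g.

Lemma bmeas_running d' (Y : measurableType d') g (a : Y -> R) (tau : Y -> \bar R)
    (b : Y -> Path E) : admissible_payoff g -> measurable_fun setT a ->
  measurable_fun setT tau -> measurable_fun setT b -> (forall y, 0 <= a y) ->
  bmeas (fun y => running_payoff eval_path alpha g (a y) (tau y) (b y)).
Proof.
move=> [mg [M gM]] ma mtau mb a0; split; first exact: measurable_running_payoff.
by exists (M / alpha) => y; exact: running_payoff_bound.
Qed.

Lemma bmeas_terminal d' (Y : measurableType d') g (a : Y -> R) (tau : Y -> \bar R)
    (b : Y -> Path E) : admissible_payoff g -> measurable_fun setT a ->
  measurable_fun setT tau -> measurable_fun setT b -> (forall y, 0 <= a y) ->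
  (forall y, 0 <= tau y)%E ->
  bmeas (fun y => terminal_payoff eval_path alpha g (a y) (tau y) (b y)).
Proof.
move=> [mg [M gM]] ma mtau mb a0 tau0; split; first exact: measurable_terminal_payoff.
by exists M => y; exact: terminal_payoff_bound.
Qed.

Lemma bmeas_running_sample g s tau : admissible_payoff g -> 0 <= s ->
  measurable_fun setT tau -> bmeas (fun w => running_payoff X alpha g s (tau w) w).
Proof.
move=> hg s0 mtau; apply: (@bmeas_running _ _ g (cst s) tau path) => //.
exact: measurable_sample_path.
Qed.

Lemma bmeas_terminal_sample g s tau : admissible_payoff g -> 0 <= s ->
  measurable_fun setT tau -> (forall w, (0 <= tau w)%E) ->
  bmeas (fun w => terminal_payoff X alpha g s (tau w) w).
Proof.
move=> hg s0 mtau tau0; apply: (@bmeas_terminal _ _ g (cst s) tau path) => //.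
exact: measurable_sample_path.
Qed.

Lemma bmeas_discount sigma : real_stopping_time Ft sigma ->
  bmeas (fun w => expR (- (alpha * sigma w))).
Proof.
move=> hs; split.
  by apply: measurable_expR_discount; exact: (measurable_real_stopping_time hX hs).
exists 1 => w; rewrite ger0_norm ?expR_ge0//; apply: discount_le1 => //.
exact: hs.1.
Qed.

Lemma bmeas_at_stop sigma g s : real_stopping_time Ft sigma -> admissible_payoff g ->
  0 <= s -> bmeas (fun w => g (s + sigma w) (X (sigma w) w)).
Proof.
move=> hs [mg [M gM]] s0; have sp w : 0 <= s + sigma w by rewrite addr_ge0// hs.1.
split; last by exists M => w; exact: gM.
apply: (measurable_half_space_comp mg) => //.
  by apply: measurable_funD => //; exact: (measurable_real_stopping_time hX hs).
exact: (measurable_X_stop hX hs).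
Qed.

Definition before_exit (sigma : Omega -> R) : set Omega :=
  [set w | ((sigma w)%:E < T w)%E].

Lemma measurable_before_exit sigma : real_stopping_time Ft sigma ->
  measurable (before_exit sigma).
Proof. by move=> hs; have [] := before_exit_stopped hX oO hs. Qed.

Lemma indic_setC (A : set Omega) w : \1_(~` A) w = 1 - \1_A w :> R.
Proof.
rewrite !indicE in_setC; case: (w \in A); first by rewrite subrr.
by rewrite subr0.
Qed.

Lemma before_exitP sigma w :
  ((sigma w)%:E < T w)%E /\ \1_(before_exit sigma) w = 1 :> R \/
  (T w <= (sigma w)%:E)%E /\ \1_(before_exit sigma) w = 0 :> R.
Proof.
have [Ts|sT] := leP (T w) (sigma w)%:E; [right|left]; split => //.
  by rewrite indicE memNset//= /before_exit /= ltNge Ts.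
by rewrite indicE mem_set.
Qed.

(** Before the exit the payoff splits at [sigma], and the second piece is a functional of the
    shifted path; after the exit it is already settled. The first conjunct makes the right-hand side
    meaningful, as no measurability of [v] is known in advance. *)
Theorem restart g G (s : R) (x : E) sigma :
  admissible_payoff g -> admissible_payoff G -> 0 <= s -> real_stopping_time Ft sigma ->
  let v := expected_payoff P X alpha g G in
  bmeas (fun w => \1_(before_exit sigma) w *
     (expR (- (alpha * sigma w)) * v (s + sigma w) (X (sigma w) w) T)) /\
  v s x T = \int[P x]_w (running_payoff X alpha g s (mine (sigma w)%:E (T w)) w +
     \1_(before_exit sigma) w *
       (expR (- (alpha * sigma w)) * v (s + sigma w) (X (sigma w) w) T) +
     \1_(~` before_exit sigma) w * terminal_payoff X alpha G s (T w) w).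
Proof.
move=> hg hG s0 hs v.
have msig := measurable_real_stopping_time hX hs.
have mT := measurable_exit_time hX oO.
have T0 w : (0 <= T w)%E by exact: first_exit_ge0.
have mA := measurable_before_exit hs.
pose pay s' tau p := running_payoff eval_path alpha g s' tau p +
  terminal_payoff eval_path alpha G s' tau p.
(* [approx_exit] stands in for the exit time to make [H] measurable on path space; the clamps only
   matter at negative times. *)
pose H (tp : R * Path E) := expR (- (alpha * Num.max tp.1 0)) *
  pay (s + Num.max tp.1 0) (approx_exit O (tp.2 : rpath E)) tp.2.
have mm : measurable_fun setT (fun tp : R * Path E => Num.max tp.1 0).
  by apply: measurable_maxr => //.
have mae : measurable_fun setT (fun tp : R * Path E => approx_exit O (tp.2 : rpath E)).
  by apply: (measurableT_comp (measurable_approx_exit O)).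
have max0 t : 0 <= Num.max t 0 :> R by rewrite le_max lexx orbT.
have bH : bmeas H.
  apply: bmeasM.
    split; first exact: measurable_expR_discount.
    by exists 1 => tp; rewrite ger0_norm ?expR_ge0//; exact: discount_le1.
  apply: bmeasD.
    apply: bmeas_running => //; first exact: measurable_funD.
    by move=> y; rewrite addr_ge0.
  apply: bmeas_terminal => //; first exact: measurable_funD.
    by move=> y; rewrite addr_ge0.
  by move=> y; exact: approx_exit_ge0.
have HE t y : 0 <= t -> \int[P y]_w H (t, path w) = expR (- (alpha * t)) * v (s + t) y T.
  move=> t0; have st0 : 0 <= s + t by rewrite addr_ge0.
  have bW : bmeas (fun w => running_payoff X alpha g (s + t) (T w) w +
      terminal_payoff X alpha G (s + t) (T w) w).
    by apply: bmeasD; [exact: bmeas_running_sample|exact: bmeas_terminal_sample].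
  rewrite /v /expected_payoff -E_Z//.
{ apply: E_ae.
  - apply: (bmeas_comp bH); apply: measurable_fun_pair => //.
    exact: measurable_sample_path.
  - exact: bmeasZ.
  - exists (exit_null_set O hX); split.
    + exact: measurable_exit_null_set.
    + exact: exit_null.
    + move=> w /= h; apply: contrapT => nb; apply: h.
      by rewrite /H /= (max_l t0) (exit_approxE nb). }
have [mK idH] := strong_markov_path hX bH.
have bB : bmeas (fun w => \1_(before_exit sigma) w *
     (expR (- (alpha * sigma w)) * v (s + sigma w) (X (sigma w) w) T)).
  apply: bmeasM; first exact: bmeas_indic.
  have -> : (fun w => expR (- (alpha * sigma w)) * v (s + sigma w) (X (sigma w) w) T) =
      (fun w => \int[P (X (sigma w) w)]_w' H (sigma w, path w')).
    by apply/funext => w; rewrite HE//; exact: hs.1.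
  split.
    have := measurable_fun_pair msig (measurable_X_stop hX hs).
    exact: (measurableT_comp mK).
  have [M hM] := bH.2; exists M => w; apply: PE_bound => //.
  apply: (bmeas_comp bH); apply: measurable_fun_pair => //.
  exact: measurable_sample_path.
split; first exact: bB.
have bA : bmeas (fun w => running_payoff X alpha g s (mine (sigma w)%:E (T w)) w).
  apply: bmeas_running_sample => //; apply: measurable_mine => //.
  exact/measurable_EFinP.
have bC : bmeas (fun w => \1_(~` before_exit sigma) w * terminal_payoff X alpha G s (T w) w).
  apply: bmeasM; first by apply: bmeas_indic; exact: measurableC.
  exact: bmeas_terminal_sample.
have bS : bmeas (fun w => \1_(before_exit sigma) w * H (sigma w, shift_path (sigma w) (path w))).
  apply: bmeasM; first exact: bmeas_indic.
  apply: (bmeas_comp bH); apply: measurable_fun_pair => //.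
  by apply: measurable_shift_path => //; exact: measurable_sample_path.
transitivity (\int[P x]_w (running_payoff X alpha g s (mine (sigma w)%:E (T w)) w +
     \1_(before_exit sigma) w * H (sigma w, shift_path (sigma w) (path w)) +
     \1_(~` before_exit sigma) w * terminal_payoff X alpha G s (T w) w)).
{ apply: E_ae.
  - by apply: bmeasD; [exact: bmeas_running_sample|exact: bmeas_terminal_sample].
  - by apply: bmeasD => //; exact: bmeasD.
  - apply: filterS (exit_shift_ae hX oO x hs) => w h.
    rewrite indic_setC; have [[sT ->]|[Ts ->]] := before_exitP sigma w.
      rewrite subrr mul0r addr0 mul1r (min_l (ltW sT)).
      have sw0 := hs.1 w.
      have HE2 p : H (sigma w, p) = expR (- (alpha * sigma w)) *
          pay (s + sigma w) (approx_exit O (p : rpath E)) p by rewrite /H /= max_l.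
      rewrite HE2 (h sT) /pay.
      have [[mg [M gM]] [mG [N GN]]] := (hg, hG).
      rewrite -[X in X + _ = _]/(running_payoff eval_path alpha g s (T w) (path w)).
      rewrite -[X in _ + X = _]/(terminal_payoff eval_path alpha G s (T w) (path w)).
      rewrite (running_payoff_split alpha0 mg gM (path w) s0 sw0 (ltW sT)).
      rewrite (terminal_payoff_split _ _ _ (path w) sw0 (ltW sT)).
      by rewrite mulrDr addrA.
    by rewrite mul0r addr0 subr0 mul1r (min_r Ts). }
have bAS := bmeasD bA bS; have bAB := bmeasD bA bB.
rewrite !E_D//.
congr (_ + _ + _).
rewrite idH//; last exact: (before_exit_stopped hX oO hs).
by apply: eq_Rintegral => w _; rewrite HE//; exact: hs.1.
Qed.

End restart.

(** * The penalized equation as a stopping problem *)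

Section uniform_average.
Context {R : realType}.

Lemma integrable_itv_bmeas (a b : R) (h : R -> R) : bmeas h ->
  lebesgue_measure.-integrable (`[a, b] : set R) (EFin \o h).
Proof.
move=> [mh [M hM]]; apply: measurable_bounded_integrable => //.
- rewrite [X in (X < _)%E]lebesgue_measure_itv /=.
  by case: ifP => // _; rewrite -EFinB ltry.
- exact: measurable_funTS.
- exists M; split; first exact: num_real.
  by move=> u Mu t _ /=; rewrite (le_trans (hM t))// ltW.
Qed.

(** Rewriting a time integral as an expectation makes Fubini for finite measures and the bounds on
    means applicable. The shift by [M] reduces the claim to nonnegative integrands. *)
Lemma Rintegral_uniform (a b : R) (ab : a < b) (h : R -> R) : bmeas h ->
  \int[lebesgue_measure]_(u in `[a, b]) h u =
  (b - a) * \int[uniform_prob ab]_u h u.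
Proof.
move=> bh; have [mh [M hM]] := bh.
have pos (h' : R -> R) : bmeas h' -> (forall u, 0 <= h' u) ->
    \int[lebesgue_measure]_(u in `[a, b]) h' u =
    (b - a) * \int[uniform_prob ab]_u h' u.
  move=> bh' h0; rewrite /Rintegral integral_uniform//; last first.
    by apply/measurable_EFinP; exact: bh'.1.
  rewrite fineM//; last by exact: (integrable_fin_num _ (integrable_itv_bmeas a b bh')).
  by rewrite /= mulVKf// gt_eqF// subr_gt0.
have bM : bmeas (fun u => h u + M) by apply: bmeasD => //; exact: bmeas_cst.
have M0 : 0 <= M by exact: le_trans (hM 0).
have hM0 u : 0 <= h u + M.
  by rewrite -lerBlDr sub0r; move: (hM u); rewrite ler_norml => /andP[].
have -> : \int[lebesgue_measure]_(u in `[a, b]) h u =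
    (\int[lebesgue_measure]_(u in `[a, b]) (h u + M)) - \int[lebesgue_measure]_(u in `[a, b]) M.
{ rewrite -RintegralB//.
  - by apply: eq_Rintegral => u _; rewrite addrK.
  - exact: integrable_itv_bmeas.
  - by apply: (@integrable_itv_bmeas a b (fun=> M)); exact: bmeas_cst. }
have -> : \int[uniform_prob ab]_u h u =
    (\int[uniform_prob ab]_u (h u + M)) - \int[uniform_prob ab]_u M.
  rewrite -E_B//; last exact: bmeas_cst.
  by apply: eq_Rintegral => u _; rewrite addrK.
by rewrite mulrBr -!pos//; exact: bmeas_cst.
Qed.

End uniform_average.

(** * Payoff accumulated over a time slice *)

Section slices.
Context {R : realType} {E : pmetricType R} {d : measure_display}
  {Omega : measurableType d}.
Variables (P : E -> probability Omega R) (Ft : R -> set (set Omega))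
  (X : R -> Omega -> E) (O : set E) (alpha : R).
Hypothesis hX : standard_markov_process P Ft X.
Hypothesis oO : open O.
Hypothesis alpha0 : 0 < alpha.

Local Notation path := (sample_path hX).
Local Notation T := (exit_time X O).

Definition killed_payoff (g : R -> E -> R) (s : R) (sigma : Omega -> R) (w : Omega) : R :=
  \1_(before_exit X O sigma) w *
    (expR (- (alpha * sigma w)) * g (s + sigma w) (X (sigma w) w)).

Local Notation at_stop := killed_payoff.

Lemma bmeas_killed_payoff sigma g s : real_stopping_time Ft sigma ->
  admissible_payoff g -> 0 <= s -> bmeas (at_stop g s sigma).
Proof.
move=> hs hg s0; apply: bmeasM; first by apply: bmeas_indic; exact: (measurable_before_exit hX oO hs).
by apply: bmeasM; [exact: (bmeas_discount hX alpha0 hs)|exact: (bmeas_at_stop hX hs)].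
Qed.

Lemma killed_payoff_ge0 sigma g s w : 0 <= s -> 0 <= sigma w ->
  (forall s x, 0 <= s -> 0 <= g s x) -> 0 <= at_stop g s sigma w.
Proof.
move=> s0 sw g0; rewrite /killed_payoff !mulr_ge0 ?expR_ge0//.
by rewrite g0// addr_ge0.
Qed.

Lemma killed_payoff_bound sigma g s w M : 0 <= s -> 0 <= sigma w ->
  (forall s x, 0 <= s -> `|g s x| <= M) -> `|at_stop g s sigma w| <= M.
Proof.
move=> s0 sw gM; have M0 := M_ge0 gM.
rewrite /killed_payoff; case: (before_exitP X O sigma w) => -[_ ->]; rewrite ?mul0r ?normr0// mul1r.
rewrite normrM ger0_norm ?expR_ge0// -[leRHS]mul1r ler_pM ?expR_ge0//.
  exact: discount_le1.
by apply: gM; rewrite addr_ge0.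
Qed.

(** Before the exit the discounted rate at time [u] is the payoff for stopping at [u], and after it
    both vanish; this is what converts accumulated penalty into gains from stopping. *)
Lemma running_increment g s a b w : admissible_payoff g -> 0 <= s -> 0 <= a ->
  a <= b ->
  running_payoff X alpha g s (mine b%:E (T w)) w -
  running_payoff X alpha g s (mine a%:E (T w)) w =
  \int[lebesgue_measure]_(u in `[a, b]) at_stop g s (fun=> u) w.
Proof.
move=> [mg [M gM]] s0 a0 ab.
rewrite -[running_payoff X _ _ _ (mine b%:E _) _]/(running_payoff eval_path alpha g s (mine b%:E (T w)) (path w)).
rewrite -[running_payoff X _ _ _ (mine a%:E _) _]/(running_payoff eval_path alpha g s (mine a%:E (T w)) (path w)).
rewrite !running_payoffE; set W := time_window.
have mW := @measurable_time_window R.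
have WE : W (mine b%:E (T w)) =
    W (mine a%:E (T w)) `|` (W (mine b%:E (T w)) `\` W (mine a%:E (T w))).
  rewrite setDUK// => u [u0 uT]; split => //.
  rewrite (le_trans uT)//; have [h|h] := leP a%:E (T w).
    by rewrite le_min lee_fin ab h.
  by rewrite le_min lexx andbT (le_trans (ltW h))// lee_fin.
have -> : \int[lebesgue_measure]_(u in W (mine b%:E (T w))) payoff_rate alpha g s (path w) u =
    (\int[lebesgue_measure]_(u in W (mine a%:E (T w))) payoff_rate alpha g s (path w) u) +
    \int[lebesgue_measure]_(u in W (mine b%:E (T w)) `\` W (mine a%:E (T w)))
      payoff_rate alpha g s (path w) u.
{ rewrite {1}WE Rintegral_setU//=.
  - exact: measurable_time_window.
  - by apply: measurableD; exact: measurable_time_window.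
  - rewrite -WE; apply: (integrable_payoff_rate alpha0 mg gM) => //.
    exact: time_window_sub.
  - by apply/disj_setPS => u [/= ? []]. }
rewrite addrAC subrr add0r Rintegral_mkcond [RHS]Rintegral_mkcond.
rewrite /Rintegral; congr fine; apply: ae_eq_integral => //.
- apply/measurable_EFinP.
  apply/(measurable_restrictT _ _).1; first by apply: measurableD; exact: measurable_time_window.
  apply: measurable_funTS.
  by apply: (@measurable_payoff_rate _ _ alpha g mg _ R (cst s) (cst (path w)) id).
- apply/measurable_EFinP.
  have h : measurable_fun setT (fun u : R => \1_[set u : R | (u%:E < T w)%E] u * payoff_rate alpha g s (path w) u).
    apply: measurable_funM.
      apply: measurable_indic.
      have := @measurable_lte _ _ R setT measurableT (fun u : R => u%:E) (cst (T w)) (EFin_measurable (D := setT)) (measurable_cst _).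
      by rewrite setTI.
    by apply: (@measurable_payoff_rate _ _ alpha g mg _ R (cst s) (cst (path w)) id).
  rewrite (_ : _ \_ _ = (fun u : R => \1_[set u : R | (u%:E < T w)%E] u * payoff_rate alpha g s (path w) u) \_ `[a, b]).
    apply/(measurable_restrictT _ _).1; first exact: measurable_itv.
    exact: measurable_funTS.
  apply/funext => u; rewrite !patchE; case: ifPn => //; rewrite inE/= in_itv/= => /andP[au _].
  rewrite /killed_payoff /payoff_rate (max_l (le_trans a0 au)); congr (_ * _).
(* The two integrands can differ only at [a], excluded from the increment but not from the interval,
   and at the exit, included in the window but not in the strict [u < T]. *)
- exists ([set a] `|` [set fine (T w)]); split.
  + by apply: measurableU.
  + apply/eqP; rewrite eq_le measure_ge0 andbT.
    apply: le_trans (measureU2 _ _ _) _; [exact: measurable_set1..|].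
    by rewrite [X in (X + _)%E]lebesgue_measure_set1 [X in (_ + X)%E]lebesgue_measure_set1 adde0.
  + move=> u /= /not_implyP[_]; apply: contra_notP => /not_orP[ua uT].
    rewrite !patchE; congr EFin.
    have T0 : (0 <= T w)%E by exact: first_exit_ge0.
    have uTn : u%:E != T w by apply/eqP => h; apply: uT; rewrite -h.
    have [|] := boolP (u \in _ `\` _).
      rewrite inE/= => -[[u0 ub] /not_andP[//|/negP]]; rewrite -ltNge => ua'.
      move: ub; rewrite le_min lee_fin => /andP[ub uT'].
      have uT'' : (u%:E < T w)%E by rewrite lt_neqAle uTn.
      have au : a <= u.
        by move: ua'; rewrite gt_min lte_fin => /orP[/ltW//|]; rewrite ltNge uT'.
      rewrite mem_set/= ?in_itv/= ?au ?ub// /killed_payoff.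
      by rewrite indicE mem_set// mul1r /payoff_rate (max_l u0).
    rewrite notin_setE => h; case: ifPn => //; rewrite inE/= in_itv/= => /andP[au ub].
    rewrite /killed_payoff; case: (before_exitP X O (fun=> u) w) => -[uT' ->]; rewrite ?mul0r//.
    exfalso; apply: h; split.
      by split; [exact: le_trans au|rewrite le_min lee_fin ub ltW].
    move=> [_]; rewrite le_min lee_fin => /andP[ua' _].
    by apply: ua; apply/eqP; rewrite eq_le ua' au.
Qed.

(** Fubini in time and chance. Clamping [u] to the interval leaves the average unchanged and makes
    bounds known on the interval hold for every [u]. *)
Lemma mean_slice g s x (a b : R) (ab : a < b) (A : set Omega) : admissible_payoff g ->
  0 <= s -> 0 <= a -> measurable A ->
  \int[P x]_w (\1_A w * (running_payoff X alpha g s (mine b%:E (T w)) w -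
                         running_payoff X alpha g s (mine a%:E (T w)) w)) =
  (b - a) * \int[uniform_prob ab]_u
    \int[P x]_w (\1_A w * at_stop g s (fun=> Num.max a (Num.min u b)) w) /\
  bmeas (fun u : R => \int[P x]_w (\1_A w * at_stop g s (fun=> Num.max a (Num.min u b)) w)).
Proof.
move=> hg s0 a0 mA; have [mg [M gM]] := hg; pose c (u : R) := Num.max a (Num.min u b).
have c0 u : 0 <= c u by rewrite le_max a0.
have mc : measurable_fun setT (fun uw : R * Omega => c uw.1).
  by apply: measurable_maxr => //; apply: measurable_minr.
pose h0 (uw : R * Omega) := at_stop g s (fun=> c uw.1) uw.2.
have bh0 : bmeas h0.
{ split; last by exists M => uw; exact: killed_payoff_bound.
  apply: measurable_funM.
    rewrite (_ : (fun x : R * Omega => _) = \1_[set uw : R * Omega | ((c uw.1)%:E < T uw.2)%E])//.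
    apply: measurable_indic.
    have := @measurable_lte _ _ R setT measurableT (fun uw : R * Omega => (c uw.1)%:E)
      (fun uw => T uw.2).
    rewrite setTI; apply; first exact/measurable_EFinP.
    exact: (measurableT_comp (measurable_exit_time hX oO)).
  apply: measurable_funM; first exact: measurable_expR_discount.
  apply: (measurable_half_space_comp mg).
  - exact: measurable_funD.
  - apply: (@measurable_eval_comp _ _ _ _ (fun uw : R * Omega => c uw.1) (fun uw => path uw.2)) => //.
    exact: (measurableT_comp (measurable_sample_path hX)).
  - by move=> uw; rewrite addr_ge0. }
pose h (uw : R * Omega) := \1_A uw.2 * h0 uw.
have bh : bmeas h.
  by apply: bmeasM => //; exact: (bmeas_comp (bmeas_indic mA) (@measurable_snd _ _ R Omega)).
have bh2 : bmeas (fun u => \int[P x]_w h (u, w)).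
  split; first exact: (measurable_Rintegral_param (P x) h bh.1).
  have [N hN] := bh.2; exists N => u; apply: PE_bound => // ; split; last by exists N.
  exact: (measurableT_comp bh.1).
split; last exact: bh2.
rewrite -(E_fubini (P x) (uniform_prob ab) (h := fun wu => h (wu.2, wu.1))); last first.
  by apply: (bmeas_comp bh); exact: measurable_swap.
rewrite -E_Z; last first.
  split.
    by apply: (measurable_Rintegral_param (uniform_prob ab) (fun wu => h (wu.2, wu.1))); apply: (measurableT_comp bh.1); exact: measurable_swap.
  have [N hN] := bh.2; exists N => u; apply: PE_bound => // ; split; last by exists N.
  by move=> /=; exact: (measurableT_comp bh.1).
apply: eq_Rintegral => w _.
have bw : bmeas (fun u => h (u, w)).
  by split; [exact: (measurableT_comp bh.1)|have [N hN] := bh.2; exists N].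
rewrite -Rintegral_uniform// running_increment//; last exact: ltW.
rewrite /h /= RintegralZl//.
- congr (_ * _); apply: eq_Rintegral => u; rewrite inE/= in_itv/= => /andP[au ub].
  by rewrite /h0 /c /= (min_l ub) (max_r au).
- have bw2 : bmeas (fun u : R => h0 (u, w)).
    by split; [exact: (measurableT_comp bh0.1)|have [N hN] := bh0.2; exists N].
  exact: integrable_itv_bmeas bw2.
Qed.

Lemma mean_slice_le g s x (a b k : R) (A : set Omega) : admissible_payoff g ->
  0 <= s -> 0 <= a -> a < b -> measurable A ->
  (forall u, a <= u -> u <= b -> \int[P x]_w (\1_A w * at_stop g s (fun=> u) w) <= k) ->
  \int[P x]_w (\1_A w * (running_payoff X alpha g s (mine b%:E (T w)) w -
                         running_payoff X alpha g s (mine a%:E (T w)) w)) <= (b - a) * k.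
Proof.
move=> hg s0 a0 ab mA h; have [-> bm] := mean_slice x ab hg s0 a0 mA.
rewrite ler_wpM2l ?subr_ge0 ?(ltW ab)//; apply: PE_le => // u; apply: h.
  by rewrite le_max lexx.
by rewrite ge_max (ltW ab) ge_min lexx orbT.
Qed.

Lemma mean_slice_ge g s x (a b k : R) (A : set Omega) : admissible_payoff g ->
  0 <= s -> 0 <= a -> a < b -> measurable A ->
  (forall u, a <= u -> u <= b -> k <= \int[P x]_w (\1_A w * at_stop g s (fun=> u) w)) ->
  (b - a) * k <= \int[P x]_w (\1_A w * (running_payoff X alpha g s (mine b%:E (T w)) w -
                         running_payoff X alpha g s (mine a%:E (T w)) w)).
Proof.
move=> hg s0 a0 ab mA h; have [-> bm] := mean_slice x ab hg s0 a0 mA.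
rewrite ler_wpM2l ?subr_ge0 ?(ltW ab)//; apply: PE_ge => // u; apply: h.
  by rewrite le_max lexx.
by rewrite ge_max (ltW ab) ge_min lexx orbT.
Qed.

Lemma running_payoff_mono g s (a b : R) w : admissible_payoff g -> 0 <= s -> 0 <= a ->
  a <= b -> (forall s x, 0 <= s -> 0 <= g s x) ->
  running_payoff X alpha g s (mine a%:E (T w)) w <=
  running_payoff X alpha g s (mine b%:E (T w)) w.
Proof.
move=> hg s0 a0 ab g0; rewrite -subr_ge0 running_increment//.
apply: Rintegral_ge0 => u; rewrite /= in_itv/= => /andP[au _].
by apply: killed_payoff_ge0 => //; exact: le_trans au.
Qed.

Lemma running_payoff0 g s w : admissible_payoff g -> 0 <= s ->
  running_payoff X alpha g s (mine 0%:E (T w)) w = 0.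
Proof.
move=> [mg [M gM]] s0; apply/eqP; rewrite -normr_le0.
have := @running_payoff_short _ _ _ alpha0 g M mg gM s (mine 0%:E (T w)) 0 (path w) s0 (lexx 0).
by rewrite ge_min lexx mulr0; apply.
Qed.

End slices.

(** * The restart identity of a penalized solution and the discretised stopping rule *)

Section penalized.
Context {R : realType} {E : pmetricType R} {d : measure_display}
  {Omega : measurableType d}.
Variables (P : E -> probability Omega R) (Ft : R -> set (set Omega))
  (X : R -> Omega -> E) (O : set E) (alpha : R) (f F : R -> E -> R).
Hypothesis hX : standard_markov_process P Ft X.
Hypothesis oO : open O.
Hypothesis alpha0 : 0 < alpha.
Hypothesis hf : admissible_payoff f.
Hypothesis hF : admissible_payoff F.

Local Notation T := (exit_time X O).
Local Notation at_stop := (killed_payoff X O alpha).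
Local Notation bef := (before_exit X O).

Definition penalty (v : R -> E -> R) (s : R) (x : E) : R :=
  Num.max (F s x - v s x) 0.

Lemma penalty_ge0 v s x : 0 <= penalty v s x.
Proof. by rewrite le_max lexx orbT. Qed.

Lemma admissible_sub g h : admissible_payoff g -> admissible_payoff h ->
  admissible_payoff (fun (s : R) (x : E) => g s x - h s x).
Proof.
move=> [mg [M gM]] [mh [N hN]]; split; first exact: measurable_funB.
by exists (M + N) => s x s0; rewrite (le_trans (ler_normB _ _))// lerD ?gM ?hN.
Qed.

Lemma admissible_penalty v : admissible_payoff v -> admissible_payoff (penalty v).
Proof.
move=> hv; have [mg [M gM]] := admissible_sub hF hv; split.
  by apply: measurable_maxr => //; exact: measurable_cst.
exists M => s x s0; rewrite ger0_norm ?penalty_ge0// ge_max (M_ge0 gM) andbT.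
by rewrite (le_trans (ler_norm _))// gM.
Qed.

(** What is received whatever is paid at [sigma] itself: adding [at_stop F] gives the payoff of
    stopping there, adding [at_stop v] that of going on. *)
Definition stopped_reward s (sigma : Omega -> R) w : R :=
  running_payoff X alpha f s (mine (sigma w)%:E (T w)) w +
  \1_(~` bef sigma) w * terminal_payoff X alpha F s (T w) w.

Lemma bmeas_stopped_reward s sigma : 0 <= s -> real_stopping_time Ft sigma ->
  bmeas (stopped_reward s sigma).
Proof.
move=> s0 hs; have mT := measurable_exit_time hX oO; apply: bmeasD.
  apply: (bmeas_running_sample hX alpha0) => //; apply: measurable_mine => //.
  by apply/measurable_EFinP; exact: (measurable_real_stopping_time hX hs).
apply: bmeasM.
  by apply: bmeas_indic; apply: measurableC; exact: (measurable_before_exit hX oO hs).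
apply: (bmeas_terminal_sample hX alpha0) => //; move=> w; exact: first_exit_ge0.
Qed.

Lemma bmeas_running_stop g s sigma : admissible_payoff g -> 0 <= s ->
  real_stopping_time Ft sigma ->
  bmeas (fun w => running_payoff X alpha g s (mine (sigma w)%:E (T w)) w).
Proof.
move=> hg s0 hs; have mT := measurable_exit_time hX oO.
apply: (bmeas_running_sample hX alpha0) => //; apply: measurable_mine => //.
by apply/measurable_EFinP; exact: (measurable_real_stopping_time hX hs).
Qed.

Lemma J_stop s x sigma : 0 <= s -> real_stopping_time Ft sigma ->
  J P X alpha f F O s x (fun w => (sigma w)%:E) =
  \int[P x]_w (stopped_reward s sigma w + at_stop F s sigma w).
Proof.
move=> s0 hs; apply: eq_Rintegral => w _.
rewrite /stopped_reward /killed_payoff indic_setC.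
case: (before_exitP X O sigma w) => -[sT ->].
  by rewrite (min_l (ltW sT)) mul1r subrr mul0r addr0.
by rewrite (min_r sT) mul0r addr0 subr0 mul1r.
Qed.

Section solution.
Variables (beta : R) (v : R -> E -> R).
Hypothesis beta0 : 0 < beta.
Hypothesis hv : penalized_solution P X alpha f F O beta v.

Lemma admissible_solution : admissible_payoff v.
Proof. by have [mv bv _] := hv. Qed.
Local Notation phi := (penalty v).

(** [restart] for the rate [f + beta * phi], with the penalty split off by linearity; the equation
    for [v] recognises the restarted payoff as [v]. *)
Lemma penalized_restart s x sigma : 0 <= s -> real_stopping_time Ft sigma ->
  v s x = \int[P x]_w (stopped_reward s sigma w + at_stop v s sigma w) +
    beta * \int[P x]_w running_payoff X alpha phi s (mine (sigma w)%:E (T w)) w.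
Proof.
move=> s0 hs; have [mv bv vE] := hv; have av := admissible_solution.
have aphi := admissible_penalty av.
have [mphi [N phiN]] := aphi; have [mf [M fM]] := hf.
have mbphi : measurable_on_half_space (fun r y => beta * phi r y).
  by apply: measurable_funM => //; exact: measurable_cst.
have bphiN r y : 0 <= r -> `|beta * phi r y| <= beta * N.
  by move=> r0; rewrite normrM (gtr0_norm beta0) ler_wpM2l ?(ltW beta0)// phiN.
have ag : admissible_payoff (fun r y => f r y + beta * phi r y).
  split; first exact: measurable_funD.
  by exists (M + beta * N) => r y r0; rewrite (le_trans (ler_normD _ _))// lerD ?fM ?bphiN.
rewrite vE//; have [_ ->] := restart hX oO alpha0 x ag hF s0 hs.
have bs := bmeas_stopped_reward s0 hs.
have ba : bmeas (at_stop v s sigma) by exact: (bmeas_killed_payoff hX oO alpha0 hs av s0).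
have br := bmeas_running_stop aphi s0 hs.
rewrite -E_Z// -E_D//; last 2 first.
{ exact: bmeasD. }
{ exact: bmeasZ. }
apply: eq_Rintegral => w _; rewrite /stopped_reward /killed_payoff.
rewrite -vE; last by rewrite addr_ge0// hs.1.
rewrite -[running_payoff X _ _ _ _ _]/(running_payoff eval_path alpha (fun r y => f r y + beta * phi r y) s (mine (sigma w)%:E (T w)) (sample_path hX w)).
rewrite (running_payoffD alpha0 _ _ s0 mf mbphi fM bphiN).
rewrite (running_payoffZ alpha0 beta _ _ s0 mphi phiN).
by rewrite addrAC [RHS]addrAC; congr (_ + _); rewrite addrAC.
Qed.

Local Notation gap := (fun (s : R) (x : E) => F s x - v s x).

(* [sigma] stops at the first of finitely many deterministic times at which
   [F > v], and at time [a] on the event [A] that none was found. The last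
   clause says that stopping there and continuing with [v] on [A] is worth at
   least [v]. *)
Definition stop_invariant (s : R) (x : E) (a : R) (sigma : Omega -> R) (A : set Omega) :=
  [/\ real_stopping_time Ft sigma, Ft a A, (forall w, sigma w <= a),
      (forall w, A w -> sigma w = a) &
      beta * \int[P x]_w running_payoff X alpha phi s (mine (sigma w)%:E (T w)) w <=
      \int[P x]_w (\1_(~` A) w * at_stop gap s sigma w)].

(** On [A] one more date [u] of the next slice is tried: stop there if [F > v], otherwise wait until
    [a + h]. The gain at [u] pays for the penalty accumulated over the slice. *)
Lemma stop_invariant_step s x a h sigma A : 0 <= s -> 0 <= a -> 0 < h ->
  beta * h <= 2^-1 -> stop_invariant s x a sigma A ->
  exists sigma' A', stop_invariant s x (a + h) sigma' A'.
Proof.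
move=> s0 a0 h0 bh [hs FA sa sA inv]; pose b := a + h.
have ab : a < b by rewrite /b ltrDl.
have b0 : 0 <= b by rewrite (le_trans a0)// ltW.
have av := admissible_solution; have aphi := admissible_penalty av.
have agap := admissible_sub hF av.
have mA : measurable A by exact: (Ft_measurable hX a0 FA).
pose incr w := running_payoff X alpha phi s (mine b%:E (T w)) w -
               running_payoff X alpha phi s (mine a%:E (T w)) w.
pose D := \int[P x]_w (\1_A w * incr w).
have rstcst c : 0 <= c -> real_stopping_time Ft (fun=> c) by exact: (real_stopping_time_cst hX).
have bincr : bmeas incr.
  by apply: bmeasB; apply: bmeas_running_stop => //; exact: rstcst.
have D0 : 0 <= D.
  apply: E_ge0 => w; rewrite mulr_ge0// subr_ge0.
  by apply: (running_payoff_mono _ hX alpha0) => //; [exact: ltW|move=> *; exact: penalty_ge0].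
(* The accumulated penalty is an average over [a, b] of the gain from stopping
   at time u; since beta * (b - a) <= 1/2, some u gains at least the penalty. *)
have [u [au ub Du]] : exists u, [/\ a <= u, u <= b &
    beta * D <= \int[P x]_w (\1_A w * at_stop phi s (fun=> u) w)].
  have [DE|Dn0] := eqVneq D 0.
    exists a; split; rewrite ?(ltW ab)// DE mulr0; apply: E_ge0 => w.
    by rewrite mulr_ge0// killed_payoff_ge0//; move=> *; exact: penalty_ge0.
  apply: contrapT => /forallNP h1.
  (* If every date gained less, averaging would give [D <= beta * h * D <= D / 2] with [D > 0]. *)
  have : D <= (b - a) * (beta * D).
    apply: (mean_slice_le hX oO alpha0) => // u au ub.
    by rewrite leNgt; apply/negP => h2; apply: (h1 u); split => //; exact: ltW.
  rewrite /b addrAC subrr add0r mulrA (mulrC h).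
  have Dp : 0 < D by rewrite lt_neqAle eq_sym Dn0.
  move: Dp bh; rewrite -/b; move: (beta * h) (D) => p q *; nra.
have u0 : 0 <= u by exact: le_trans au.
(* Where stopping at [u] brings no gain, that is [F <= v]. *)
pose low := [set w | phi (s + u) (X u w) <= 0].
have Flow : Ft u low.
  apply: (smp_adapted hX (B := [set y : Borel E | phi (s + u) y <= 0])) => //.
  have m1 : measurable_fun setT (fun y : Borel E => phi (s + u) y).
    apply: (measurable_half_space_comp aphi.1 (a := cst (s + u)) (b := id)) => //.
    by move=> _ /=; rewrite addr_ge0.
  rewrite (_ : [set _ | _] = (fun y : Borel E => phi (s + u) y) @^-1` `]-oo, 0]).
    by rewrite -[X in measurable X]setTI; exact: m1.
  by apply/seteqP; split => y /=; rewrite in_itv.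
pose A' := A `&` low.
pose sigma' w := if w \in A then (if w \in low then b else u) else sigma w.
have sig1 w : A w -> low w -> sigma' w = b by move=> Aw lw; rewrite /sigma' !mem_set.
have sig2 w : A w -> ~ low w -> sigma' w = u.
  by move=> Aw lw; rewrite /sigma' mem_set// memNset.
have sig3 w : ~ A w -> sigma' w = sigma w by move=> Aw; rewrite /sigma' memNset.
have FAa t : a <= t -> Ft t A by move=> at_; exact: (Ft_sub hX a0 at_).
have hs' : real_stopping_time Ft sigma'.
{ split=> [w|t t0].
    have [Aw|nA] := pselect (A w); last by rewrite sig3// hs.1.
    by have [lw|nl] := pselect (low w); rewrite ?(sig1 _ Aw lw) ?(sig2 _ Aw nl).
  (* On [A] the new time is [u] or [b], off [A] it is at most [a]. So the event changes form only at
     [b], [u] and [a]. *)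
  have [bt|tb] := leP b t.
    rewrite (_ : [set w | _] = setT); first exact: (FtT hX).
    apply/seteqP; split => // w _ /=; apply: le_trans bt.
    have [Aw|nA] := pselect (A w); last by rewrite sig3// (le_trans (sa w))// ltW.
    by have [lw|nl] := pselect (low w); rewrite ?(sig1 _ Aw lw) ?(sig2 _ Aw nl).
  have [ut|tu] := leP u t.
    rewrite (_ : [set w | _] = ~` (A `&` low)).
      apply: (FtC hX) => //; apply: (FtI hX) => //; first by apply: FAa; exact: le_trans ut.
      exact: (Ft_sub hX u0 ut).
    apply/seteqP; split => w /=.
      by move=> h1 [Aw lw]; move: h1; rewrite (sig1 _ Aw lw) leNgt tb.
    move=> h1; have [Aw|nA] := pselect (A w).
      by rewrite sig2// => lw; exact: h1.
    by rewrite sig3// (le_trans (sa w))// (le_trans au).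
  have [at_|ta] := leP a t.
    rewrite (_ : [set w | _] = ~` A); first by apply: (FtC hX) => //; exact: FAa.
    apply/seteqP; split => w /=.
      move=> h1 Aw; move: h1; have [lw|nl] := pselect (low w).
        by rewrite (sig1 _ Aw lw) leNgt tb.
      by rewrite (sig2 _ Aw nl) leNgt tu.
    by move=> nA; rewrite sig3// (le_trans (sa w)).
  rewrite (_ : [set w | _] = [set w | sigma w <= t]); first exact: hs.2.
  apply/seteqP; split => w /=; have [Aw|nA] := pselect (A w).
  - move=> h1; have [lw|nl] := pselect (low w).
      by move: h1; rewrite (sig1 _ Aw lw) leNgt tb.
    by move: h1; rewrite (sig2 _ Aw nl) leNgt tu.
  - by rewrite sig3.
  - by rewrite (sA _ Aw) leNgt ta.
  - by rewrite sig3. }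
have sb w : sigma' w <= b.
  have [Aw|nA] := pselect (A w); last by rewrite sig3// (le_trans (sa w))// ltW.
  by have [lw|nl] := pselect (low w); rewrite ?(sig1 _ Aw lw) ?(sig2 _ Aw nl).
have FbA : Ft b A'.
  by apply: (FtI hX) => //; [apply: FAa; exact: ltW|exact: (Ft_sub hX u0 ub)].
exists sigma', A'; split => //.
{ by move=> w [Aw lw]; exact: sig1. }
have bA : bmeas (fun w => \1_A w : R) by exact: bmeas_indic.
have bAi := bmeasM bA bincr.
have brun tau : real_stopping_time Ft tau -> bmeas (fun w => running_payoff X alpha phi s (mine (tau w)%:E (T w)) w).
  by move=> ht; exact: bmeas_running_stop.
have bga tau : real_stopping_time Ft tau -> bmeas (at_stop gap s tau).
  by move=> ht; exact: (bmeas_killed_payoff hX oO alpha0 ht agap s0).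
have bph : bmeas (at_stop phi s (fun=> u)).
  by apply: (bmeas_killed_payoff hX oO alpha0 _ aphi s0); exact: rstcst.
have bnA : bmeas (fun w => \1_(~` A) w : R) by apply: bmeas_indic; exact: measurableC.
(* On [A] the old time is [a] and the new one is at most [b], so the extra penalty is at most
   [incr]; off [A] nothing changes. *)
apply: (@le_trans _ _ (beta * ((\int[P x]_w running_payoff X alpha phi s (mine (sigma w)%:E (T w)) w) + D))).
{ rewrite ler_pM2l// -E_D//; last exact: brun.
  apply: E_le; [exact: brun|by apply: bmeasD => //; exact: brun|] => w.
  have [Aw|nA] := pselect (A w); last first.
    by rewrite sig3// indicE memNset// mul0r addr0.
  rewrite indicE mem_set// mul1r (sA _ Aw) /incr addrC subrK.
  apply: (running_payoff_mono _ hX alpha0) => //; first exact: hs'.1.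
  by move=> *; exact: penalty_ge0. }
rewrite mulrDr (le_trans (lerD inv Du))// -E_D//; last 2 first.
{ by apply: bmeasM => //; exact: bga. }
{ exact: bmeasM. }
apply: E_le.
{ by apply: bmeasD; apply: bmeasM => //; exact: bga. }
{ apply: bmeasM; last exact: bga.
  apply: bmeas_indic; apply: measurableC; apply: (Ft_measurable hX b0).
  exact: FbA. }
move=> w; have [Aw|nA] := pselect (A w); last first.
  rewrite !indicE !(mem_set (A := ~` _))//= ?(memNset nA); last by case.
  rewrite mul0r addr0 !mul1r /killed_payoff sig3//.
  rewrite (_ : \1_(bef sigma) w = \1_(bef sigma') w :> R)//.
  by rewrite !indicE; congr (_%:R); congr nat_of_bool; apply/idP/idP; rewrite !inE /before_exit/= sig3.
rewrite [in leLHS]indicE memNset ?mul0r ?add0r//=.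
rewrite indicE (mem_set Aw) mul1r.
have [lw|nl] := pselect (low w).
  rewrite indicE memNset ?mul0r//=; last by move=> h1; apply: h1.
  rewrite /killed_payoff (_ : phi (s + u) (X u w) = 0) ?mulr0//.
  by apply/eqP; rewrite eq_le lw penalty_ge0.
rewrite indicE mem_set ?mul1r/=; last by move=> [].
rewrite /killed_payoff (sig2 _ Aw nl) (_ : \1_(bef sigma') w = \1_(bef (fun=> u)) w :> R).
  rewrite (_ : phi (s + u) (X u w) = F (s + u) (X u w) - v (s + u) (X u w))//.
  have : 0 < phi (s + u) (X u w) by rewrite ltNge; exact/negP.
  by rewrite /penalty lt_max ltxx orbF => /ltW gap0; rewrite max_l.
by rewrite !indicE; congr (_%:R); congr nat_of_bool; apply/idP/idP; rewrite !inE /before_exit/= (sig2 _ Aw nl).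
Qed.

Lemma exists_stop_invariant s x r : 0 <= s -> 0 < r ->
  exists sigma A, stop_invariant s x r sigma A.
Proof.
(* The number of slices exceeds [2 * beta * r], so slices of length [r / n] satisfy
   [beta * h <= 1/2]. *)
move=> s0 r0; pose n := (Num.truncn (2 * beta * r)).+1.
pose h := r / n%:R.
have n0 : 0 < n%:R :> R by rewrite ltr0n.
have h0 : 0 < h by rewrite divr_gt0.
have bh : beta * h <= 2^-1.
  rewrite /h mulrA ler_pdivrMr//.
  have := truncnS_gt (2 * beta * r); rewrite -/n; move: (n%:R : R) => m; nra.
have step m : exists sigma A, stop_invariant s x (m%:R * h) sigma A.
  elim: m => [|m [sigma [A inv]]]; last first.
    rewrite -natr1 mulrDl mul1r; apply: (stop_invariant_step _ _ h0 bh inv) => //.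
    by rewrite mulr_ge0// ltW.
  (* At time 0 nothing has been tried and no penalty has accumulated: both sides of the inequality
     vanish. *)
  exists (fun=> 0), setT; rewrite mul0r; split => //.
  { exact: (real_stopping_time_cst hX). }
  { exact: (FtT hX). }
  { rewrite (_ : (fun w => running_payoff X _ _ _ _ w) = fun=> 0); last first.
      apply/funext => w; apply: (running_payoff0 _ hX alpha0) => //.
      exact: admissible_penalty admissible_solution.
    rewrite PE_cst mulr0; apply: E_ge0 => w.
    by rewrite setCT indic0 mul0r. }
by have := step n; rewrite mulrC divfK ?gt_eqF//.
Qed.

End solution.
End penalized.

(** * Comparison of penalized solutions and the value *)

Ltac bmeas_auto := repeat first
  [assumption | apply: bmeasD | apply: bmeasB | apply: bmeasN | apply: bmeasM | apply: bmeas_cst].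

Lemma indic_split (R : realType) (T : Type) (A : set T) (x : T) :
  [/\ A x, \1_A x = 1 :> R & \1_(~` A) x = 0 :> R] \/
  [/\ ~ A x, \1_A x = 0 :> R & \1_(~` A) x = 1 :> R].
Proof.
have [Ax|nA] := pselect (A x); [left|right]; split=> //; rewrite indicE.
- by rewrite mem_set.
- by rewrite memNset//; apply.
- by rewrite memNset.
- by rewrite mem_set.
Qed.

Lemma discount_small {R : realType} (alpha N e : R) : 0 < alpha -> 0 <= N -> 0 < e ->
  exists2 r : R, 0 < r & N * expR (- (alpha * r)) <= e.
Proof.
(* This gives [alpha * r >= N / e], and the exponential dominates [1 + alpha * r]; the maximum with
   1 only keeps [r] positive. *)
move=> alpha0 N0 e0; pose r := Num.max 1 (alpha^-1 * (N / e)).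
have r0 : 0 < r by rewrite lt_max ltr01.
exists r => //; rewrite expRN ler_pdivrMr ?expR_gt0// -ler_pdivrMl//.
apply: le_trans (ltW (expR_gt1Dx _)); last by rewrite mulf_neq0// gt_eqF.
rewrite mulrC (le_trans (_ : _ <= alpha * r))//; last by rewrite lerDr.
by rewrite -ler_pdivrMl// le_max lexx orbT.
Qed.

Section comparison.
Context {R : realType} {E : pmetricType R} {d : measure_display}
  {Omega : measurableType d}.
Variables (P : E -> probability Omega R) (Ft : R -> set (set Omega))
  (X : R -> Omega -> E) (O : set E) (alpha : R) (f F : R -> E -> R) (Mf MF : R).
Hypothesis hX : standard_markov_process P Ft X.
Hypothesis oO : open O.
Hypothesis alpha0 : 0 < alpha.
Hypothesis mf : measurable_on_half_space f.
Hypothesis mF : measurable_on_half_space F.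
Hypothesis fM : forall s x, 0 <= s -> `|f s x| <= Mf.
Hypothesis FM : forall s x, 0 <= s -> `|F s x| <= MF.

Local Notation T := (exit_time X O).
Local Notation killed := (killed_payoff X O alpha).
Local Notation bef := (before_exit X O).
Local Notation reward := (stopped_reward X O alpha f F).
Local Notation phi := (penalty F).
Local Notation w := (value P Ft X alpha f F O).
Local Notation JJ := (J P X alpha f F O).
Local Notation path := (sample_path hX).

(** Bounds every payoff pathwise and, independently of [beta], every penalized solution. *)
Definition payoff_sup : R := Mf / alpha + MF.
Local Notation C := payoff_sup.

Let hf : admissible_payoff f. Proof. by split => //; exists Mf. Qed.
Let hF : admissible_payoff F. Proof. by split => //; exists MF. Qed.

Lemma payoff_bound s (tau : \bar R) om : 0 <= s -> (0 <= tau)%E ->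
  `|running_payoff X alpha f s tau om + terminal_payoff X alpha F s tau om| <= C.
Proof.
move=> s0 tau0; rewrite (le_trans (ler_normD _ _))// lerD//.
  exact: (running_payoff_bound alpha0 mf fM tau (path om) s0).
exact: (terminal_payoff_bound alpha0 FM (path om) s0 tau0).
Qed.

Lemma bmeas_payoff s (tau : Omega -> \bar R) : 0 <= s -> measurable_fun setT tau ->
  (forall om, (0 <= tau om)%E) ->
  bmeas (fun om => running_payoff X alpha f s (tau om) om + terminal_payoff X alpha F s (tau om) om).
Proof.
move=> s0 mtau tau0; apply: bmeasD; first exact: (bmeas_running_sample hX alpha0).
exact: (bmeas_terminal_sample hX alpha0).
Qed.

Lemma measurable_stop_exit tau : stopping_time Ft tau ->
  measurable_fun setT (fun om => mine (tau om) (T om)).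
Proof.
move=> ht; apply: measurable_mine; first exact: (measurable_stopping_time hX ht).
exact: (measurable_exit_time hX oO).
Qed.

Lemma J_bound s x tau : 0 <= s -> stopping_time Ft tau -> `|JJ s x tau| <= C.
Proof.
move=> s0 ht; have t0 om : (0 <= mine (tau om) (T om))%E.
  by rewrite le_min ht.1 first_exit_ge0.
apply: PE_bound; last by move=> om; apply: payoff_bound.
by apply: bmeas_payoff => //; exact: measurable_stop_exit.
Qed.

Lemma value_has_sup s x : 0 <= s -> has_sup [set JJ s x tau | tau in stopping_time Ft].
Proof.
move=> s0; split.
  exists (JJ s x (fun=> 0%:E)), (fun=> 0%:E) => //.
  exact: (real_stopping_timeE (real_stopping_time_cst hX (lexx 0))).
exists C => _ [tau ht <-]; apply: le_trans (ler_norm _) _; exact: J_bound.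
Qed.

Lemma J_le_value s x tau : 0 <= s -> stopping_time Ft tau -> JJ s x tau <= w s x.
Proof. by move=> s0 ht; apply: (ub_le_sup (value_has_sup x s0).2); exists tau. Qed.

Lemma value_bound s x : 0 <= s -> `|w s x| <= C.
Proof.
move=> s0; rewrite ler_norml; apply/andP; split.
  have h0 := real_stopping_timeE (real_stopping_time_cst hX (lexx 0)).
  apply: le_trans (J_le_value x s0 h0).
  by have := J_bound x s0 h0; rewrite ler_norml => /andP[].
apply: ge_sup; first exact: (value_has_sup x s0).1.
by move=> _ [tau ht <-]; apply: le_trans (ler_norm _) _; exact: J_bound.
Qed.

(** The payoffs differ only when the game is still on at [r]. There the difference is the discount
    at [r] times the remaining payoff minus the terminal one, each at most [C] in absolute value. *)
Lemma J_truncate s x tau r : 0 <= s -> 0 <= r -> stopping_time Ft tau ->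
  JJ s x tau <= JJ s x (fun om => (fine (mine (tau om) r%:E))%:E) +
    2 * C * expR (- (alpha * r)).
Proof.
move=> s0 r0 ht; have hs := stopping_time_truncate hX ht r0.
rewrite -lerBlDl; have C0 := le_trans (normr_ge0 _) (J_bound x s0 ht).
have t0 om : (0 <= mine (tau om) (T om))%E by rewrite le_min ht.1 first_exit_ge0.
have t1 om : (0 <= mine (fine (mine (tau om) r%:E))%:E (T om))%E.
  by rewrite le_min lee_fin hs.1 first_exit_ge0.
have b1 := bmeas_payoff s0 (measurable_stop_exit ht) t0.
have b2 := bmeas_payoff s0 (measurable_stop_exit (real_stopping_timeE hs)) t1.
rewrite -E_B//; apply: PE_le; first exact: bmeasB.
move=> om; set T1 := mine (tau om) (T om).
have fin : mine (tau om) r%:E \is a fin_num.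
  rewrite ge0_fin_numE; last by rewrite le_min ht.1 lee_fin.
  by rewrite gt_min ltry orbT.
have -> : mine (fine (mine (tau om) r%:E))%:E (T om) = mine T1 r%:E.
  by rewrite fineK// /T1 minAC.
have [Tr|rT] := leP T1 r%:E.
  by rewrite subrr !mulr_ge0// expR_ge0.
pose Z s T p := running_payoff eval_path alpha f s T p + terminal_payoff eval_path alpha F s T p.
rewrite -/(Z s T1 (path om)) -/(Z s r%:E (path om)).
have ZE : Z s T1 (path om) = running_payoff eval_path alpha f s r%:E (path om) +
  expR (- (alpha * r)) * Z (s + r) (T1 - r%:E)%E (shift_path r (path om)).
  rewrite /Z (running_payoff_split alpha0 mf fM _ s0 r0 (ltW rT)).
  by rewrite (terminal_payoff_split _ _ _ _ r0 (ltW rT)) -addrA -mulrDr.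
have sr0 : 0 <= s + r by rewrite addr_ge0.
have Tr0 : (0 <= T1 - r%:E)%E by rewrite sube_ge0 ?ltW.
have zb : Z (s + r) (T1 - r%:E)%E (shift_path r (path om)) <= C.
  apply: le_trans (ler_norm _) _; rewrite (le_trans (ler_normD _ _))// lerD//.
    exact: (running_payoff_bound alpha0 mf fM _ _ sr0).
  exact: (terminal_payoff_bound alpha0 FM _ sr0 Tr0).
have MC : MF <= C.
  by rewrite lerDr divr_ge0 ?(ltW alpha0)// (M_ge0 fM).
have fb : - MF <= F (s + r) (eval_path r (path om)).
  by have := FM (eval_path r (path om)) sr0; rewrite ler_norml => /andP[].
rewrite ZE {2}/Z /terminal_payoff.
have := expR_ge0 (- (alpha * r)); move: zb MC fb.
set e := expR _; set z := Z _ _ _; set y := F _ _ => zb MC fb e0.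
rewrite addrAC opprD addrA subrr sub0r addrC -mulrBr mulrC ler_wpM2r//.
by rewrite mulr_natl mulr2n lerD// lerNl (le_trans _ fb)// lerN2.
Qed.

Section penalized.
Variables (beta : R) (v : R -> E -> R).
Hypothesis beta0 : 0 < beta.
Hypothesis hv : penalized_solution P X alpha f F O beta v.

Let av : admissible_payoff v. Proof. exact: (admissible_solution hv). Qed.
Let aphi : admissible_payoff (phi v). Proof. exact: admissible_penalty. Qed.
Let agap : admissible_payoff (fun (s : R) (x : E) => F s x - v s x).
Proof. exact: admissible_sub. Qed.

Lemma penalized_ge s x sigma : 0 <= s -> real_stopping_time Ft sigma ->
  \int[P x]_om (reward s sigma om + killed v s sigma om) <= v s x.
Proof.
move=> s0 hs; rewrite (penalized_restart hX oO alpha0 hf hF beta0 hv x s0 hs).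
rewrite lerDl mulr_ge0 ?(ltW beta0)//; apply: E_ge0 => om.
exact: (@running_payoff_ge0 _ _ alpha (phi v) _ _ (path om) s0 (fun s x _ => penalty_ge0 F v s x)).
Qed.

Lemma J_penalized s x sigma : 0 <= s -> real_stopping_time Ft sigma ->
  JJ s x (fun om => (sigma om)%:E) <= v s x + \int[P x]_om killed (phi v) s sigma om.
Proof.
move=> s0 hs; rewrite (J_stop P X O alpha f F x s0 hs).
have br := bmeas_stopped_reward hX oO alpha0 hf hF s0 hs.
have bk g (hg : admissible_payoff g) : bmeas (killed g s sigma).
  exact: (bmeas_killed_payoff hX oO alpha0 hs hg s0).
apply: le_trans (lerD (penalized_ge x s0 hs) (lexx _)).
have bF := bk _ hF; have bv := bk _ av; have bp := bk _ aphi.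
rewrite -E_D; [|bmeas_auto..].
apply: E_le; [bmeas_auto..|].
move=> om; rewrite -(addrA (reward s sigma om)) lerD2l /killed_payoff -mulrDr -mulrDr.
rewrite ler_wpM2l ?indicE//  ler_wpM2l ?expR_ge0//.
by rewrite /penalty -lerBlDl le_max lexx.
Qed.

(** The invariant trades the accumulated penalty for the gains [F - v] off [A]: there [v] is
    replaced by [F], while on [A] it is kept at time [r]. *)
Lemma penalized_upper s x r : 0 <= s -> 0 < r ->
  exists sigma A, [/\ real_stopping_time Ft sigma, (forall om, sigma om <= r),
    measurable A, (forall om, A om -> sigma om = r) &
    v s x <= \int[P x]_om (reward s sigma om + \1_(~` A) om * killed F s sigma om +
                           \1_A om * killed v s sigma om)].
Proof.
move=> s0 r0; have [sigma [A [hs FA sr sA inv]]] :=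
  exists_stop_invariant hX oO alpha0 hF beta0 hv x s0 r0.
have mA : measurable A by exact: (Ft_measurable hX (ltW r0) FA).
exists sigma, A; split => //.
have br := bmeas_stopped_reward hX oO alpha0 hf hF s0 hs.
have bk g (hg : admissible_payoff g) : bmeas (killed g s sigma).
  exact: (bmeas_killed_payoff hX oO alpha0 hs hg s0).
have bA : bmeas (fun om => \1_A om : R) by exact: bmeas_indic.
have bnA : bmeas (fun om => \1_(~` A) om : R) by apply: bmeas_indic; exact: measurableC.
rewrite (penalized_restart hX oO alpha0 hf hF beta0 hv x s0 hs).
have bF := bk _ hF; have bv := bk _ av; have bg := bk _ agap.
apply: (le_trans (lerD (lexx _) inv)); rewrite -E_D; [|bmeas_auto..].
apply: E_le; [bmeas_auto..|].
move=> om; rewrite -!addrA lerD2l (indic_setC A) /killed_payoff.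
by move: (\1_A om) (\1_(bef sigma) om) (expR _) => a b e; rewrite le_eqVlt; apply/orP; left; apply/eqP; ring.
Qed.

(** Stopping on [A] too turns the bound of [penalized_upper] into a genuine payoff. Since
    [sigma = r] on [A], the cost carries the discount at [r] and disappears as [r] grows. *)
Lemma penalized_le_value s x : 0 <= s -> v s x <= w s x.
Proof.
move=> s0; have [mg [N gN]] := agap.
have N0 : 0 <= N by exact: (M_ge0 gN).
suff h r : 0 < r -> v s x <= w s x + N * expR (- (alpha * r)).
  apply/ler_addgt0Pr => e e0; have [r r0 re] := discount_small alpha0 N0 e0.
  by apply: le_trans (h r r0) _; rewrite lerD2l.
move=> r0; have [sigma [A [hs sr mA sA vle]]] := penalized_upper x s0 r0.
apply: le_trans vle _.
have br := bmeas_stopped_reward hX oO alpha0 hf hF s0 hs.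
have bk g (hg : admissible_payoff g) : bmeas (killed g s sigma).
  exact: (bmeas_killed_payoff hX oO alpha0 hs hg s0).
have bA : bmeas (fun om => \1_A om : R) by exact: bmeas_indic.
have bnA : bmeas (fun om => \1_(~` A) om : R) by apply: bmeas_indic; exact: measurableC.
apply: le_trans (lerD (J_le_value x s0 (real_stopping_timeE hs)) (lexx _)).
have bF := bk _ hF; have bv := bk _ av.
rewrite (J_stop P X O alpha f F x s0 hs) -[X in _ <= _ + X](PE_cst (P x)) -E_D; [|bmeas_auto..].
apply: E_le; [bmeas_auto..|].
move=> om; rewrite -!addrA lerD2l lerD2l.
have [[Aom -> ->]|[nA -> ->]] := indic_split R A om; last first.
  rewrite mul1r mul0r addr0 lerDl.
  by rewrite mulr_ge0// expR_ge0.
rewrite mul0r add0r mul1r -lerBlDl.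
rewrite /killed_payoff -mulrBr -mulrBr (sA _ Aom).
case: (before_exitP X O sigma om) => -[_ ->]; last by rewrite mul0r mulr_ge0// expR_ge0.
rewrite mul1r mulrC ler_wpM2r ?expR_ge0//.
have := gN (s + r) (X r om); rewrite ler_norml => /(_ (addr_ge0 s0 (ltW r0)))/andP[+ _].
by rewrite lerNl opprB.
Qed.

(** The equation itself bounds [v] from above only in terms of [beta]; the comparison with the value
    removes this dependence. From below, the penalty is nonnegative. *)
Lemma penalized_bound s x : 0 <= s -> `|v s x| <= C.
Proof.
move=> s0; rewrite ler_norml; apply/andP; split; last first.
  apply: le_trans (penalized_le_value x s0) _.
  by apply: le_trans (ler_norm _) _; exact: value_bound.
have h0 := real_stopping_time_cst hX (lexx 0).
have [mphi [N phiN]] := aphi.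
have [mv bv ->] := hv => //.
have mbphi : measurable_on_half_space (fun r y => beta * phi v r y).
  by apply: measurable_funM => //; exact: measurable_cst.
have bphiN r y : 0 <= r -> `|beta * phi v r y| <= beta * N.
  by move=> r0; rewrite normrM (gtr0_norm beta0) ler_wpM2l ?(ltW beta0)// phiN.
have mT := measurable_exit_time hX oO.
have T0 om : (0 <= T om)%E by exact: first_exit_ge0.
have ag : admissible_payoff (fun r y => f r y + beta * phi v r y).
  split; first exact: measurable_funD.
  by exists (Mf + beta * N) => r y r0; rewrite (le_trans (ler_normD _ _))// lerD ?fM ?bphiN.
apply: PE_ge.
  apply: bmeasD; first exact: (bmeas_running_sample hX alpha0).
  exact: (bmeas_terminal_sample hX alpha0).
move=> om.
have := payoff_bound om s0 (T0 om); rewrite ler_norml => /andP[h _].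
apply: le_trans h _; rewrite lerD2r.
rewrite -[leRHS]/(running_payoff eval_path alpha (fun r y => f r y + beta * phi v r y) s (T om) (path om)).
rewrite (running_payoffD alpha0 _ _ s0 mf mbphi fM bphiN) lerDl.
apply: running_payoff_ge0 => // r y r0; rewrite mulr_ge0 ?(ltW beta0)//; exact: penalty_ge0.
Qed.

Lemma penalty_bound s x : 0 <= s -> `|phi v s x| <= 2 * C.
Proof.
move=> s0; rewrite ger0_norm ?penalty_ge0// ge_max.
have := FM x s0; have := penalized_bound x s0; have := M_ge0 fM.
rewrite !ler_norml => Mf0 /andP[a b] /andP[c e].
have : 0 <= Mf / alpha by rewrite divr_ge0// ltW.
by move: a b; rewrite /payoff_sup; move: (v s x) (F s x) (Mf / alpha) c e => *; lra.
Qed.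

End penalized.

(** The stopping time built for [v] is used in the lower bound for [u]. Off [A] the two sides differ
    by [F - u], at most the penalty of [u]; on [A] they differ by [v - u] at the common time [r]. *)
Lemma penalized_comparison beta gamma u v s x r k : 0 < beta -> 0 < gamma ->
  penalized_solution P X alpha f F O beta u ->
  penalized_solution P X alpha f F O gamma v -> 0 <= s -> 0 < r ->
  (forall sigma, real_stopping_time Ft sigma -> (forall om, sigma om <= r) ->
    \int[P x]_om killed (phi u) s sigma om <= k) ->
  v s x - u s x <= k +
    \int[P x]_om killed (fun s y => `|v s y - u s y|) s (fun=> r) om.
Proof.
move=> beta0 gamma0 hu hv s0 r0 hk.
have au := admissible_solution hu; have av := admissible_solution hv.
have aphi := admissible_penalty hF au.
have adiff : admissible_payoff (fun (s : R) (y : E) => `|v s y - u s y|).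
  have [md [N dN]] := admissible_sub av au; split; first exact: measurableT_comp.
  by exists N => t y t0; rewrite normr_id; exact: dN.
have [sigma [A [hs sr mA sA vle]]] := penalized_upper gamma0 hv x s0 r0.
have ule := penalized_ge beta0 hu x s0 hs.
have br := bmeas_stopped_reward hX oO alpha0 hf hF s0 hs.
have bk g (hg : admissible_payoff g) : bmeas (killed g s sigma).
  exact: (bmeas_killed_payoff hX oO alpha0 hs hg s0).
have hr := real_stopping_time_cst hX (ltW r0).
have bkr g (hg : admissible_payoff g) : bmeas (killed g s (fun=> r)).
  exact: (bmeas_killed_payoff hX oO alpha0 hr hg s0).
have bA : bmeas (fun om => \1_A om : R) by exact: bmeas_indic.
have bnA : bmeas (fun om => \1_(~` A) om : R) by apply: bmeas_indic; exact: measurableC.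
have bF := bk _ hF; have bv := bk _ av; have bu := bk _ au; have bp := bk _ aphi.
have bd := bkr _ adiff.
apply: (le_trans (lerB vle ule)); rewrite -E_B; [|bmeas_auto..].
apply: le_trans (lerD (hk sigma hs sr) (lexx _)).
rewrite -E_D; [|bmeas_auto..]; apply: E_le; [bmeas_auto..|].
have p0 (g : R -> E -> R) tau om : (forall s y, 0 <= g s y) -> 0 <= killed g s tau om.
  by move=> g0; rewrite /killed_payoff !mulr_ge0 ?expR_ge0.
move=> om; have [[Aom -> ->]|[nA -> ->]] := indic_split R A om.
  rewrite mul0r addr0 mul1r opprD addrACA subrr add0r.
  rewrite (le_trans (_ : _ <= killed (fun s y => `|v s y - u s y|) s (fun=> r) om))//.
    rewrite /killed_payoff (sA _ Aom) -mulrBr -mulrBr.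
    rewrite (_ : \1_(bef sigma) om = \1_(bef (fun=> r)) om :> R).
      by rewrite ler_wpM2l ?indicE// ler_wpM2l ?expR_ge0// ler_norm.
    by rewrite !indicE; congr (_%:R); congr nat_of_bool; apply/idP/idP; rewrite !inE /before_exit/= (sA _ Aom).
  by rewrite lerDr p0// => *; exact: penalty_ge0.
rewrite mul1r mul0r addr0 opprD addrACA subrr add0r.
rewrite (le_trans (_ : _ <= killed (phi u) s sigma om))//; last by rewrite lerDl p0.
rewrite /killed_payoff -mulrBr -mulrBr ler_wpM2l ?indicE// ler_wpM2l ?expR_ge0//.
by rewrite /penalty le_max lexx.
Qed.

End comparison.

(** * Short-time exits *)

Section metric_neighbourhood.
Context {R : realType} {E : pmetricType R}.
Import metricType_numDomainType.

Lemma nbhs_metricP (x : E) (A : set E) :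
  nbhs x A <-> exists2 e : R, 0 < e & forall y, mdist x y < e -> A y.
Proof.
split=> [/nbhs_ballP[e e0]|[e e0 eA]].
  by rewrite ballEmdist => eA; exists e.
by apply/nbhs_ballP; exists e => //; rewrite ballEmdist.
Qed.

End metric_neighbourhood.

Section metric_facts.
Context {R : realType} {E : pmetricType R}.

Definition metric_ball (x : E) (e : R) : set E := [set y | mdist x y < e].

Lemma open_metric_ball (x : E) (e : R) : open (metric_ball x e).
Proof.
rewrite openE => y /= xy; apply/nbhs_metricP; exists (e - mdist x y).
  by rewrite subr_gt0.
rewrite /metric_ball /=; move=> z yz /=; have := metric_triangle x y z; move: xy yz => /=.
by move: (mdist x y) (mdist y z) (mdist x z) => *; lra.
Qed.

Lemma mdist_lip (x y z : E) : `|mdist x y - mdist x z| <= mdist y z.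
Proof.
rewrite ler_norml; apply/andP; split.
  have := metric_triangle x y z.
  by move: (mdist x y) (mdist y z) (mdist x z) => *; lra.
have := metric_triangle x z y; rewrite (metric_sym z y).
by move: (mdist x y) (mdist y z) (mdist x z) => *; lra.
Qed.

Lemma cvg_mdist (y : nat -> E) (x : E) :
  (forall n, mdist x (y n) < n.+1%:R^-1) -> y n @[n --> \oo] --> x.
Proof.
move=> yx A /nbhs_metricP[e e0 eA].
have [N Ne] := ltr_add_invr (y := 0) (x := e) e0.
exists N => // n /= Nn; apply: eA; rewrite (lt_le_trans (yx n))//.
rewrite add0r in Ne; rewrite (le_trans _ (ltW Ne))// lef_pV2 ?posrE ?ltr0n//.
by rewrite ler_nat ltnS.
Qed.

(** Reduces continuity to sequences, along which dominated convergence applies. *)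
Lemma seq_continuous_at (h : E -> R) x :
  (forall y : nat -> E, y n @[n --> \oo] --> x -> h (y n) @[n --> \oo] --> h x) ->
  {for x, continuous h}.
Proof.
move=> hs; apply/cvgrPdist_le => e e0; apply: contrapT => nh.
have : forall n : nat, exists y, mdist x y < n.+1%:R^-1 /\ ~ `|h x - h y| <= e.
  move=> n; apply: contrapT => /forallNP h1; apply: nh; apply/nbhs_metricP.
  exists n.+1%:R^-1; first by rewrite invr_gt0.
  by move=> y xy; apply: contrapT => h2; apply: (h1 y).
move=> /choice[y hy].
have := hs y (cvg_mdist (fun n => (hy n).1)) => /cvgrPdist_le/(_ e e0)[N _ /(_ N (leqnn N))].
exact: (hy N).2.
Qed.

Lemma compact_bounded_dist (K : set E) (x : E) : compact K ->
  exists n : nat, forall y, K y -> mdist x y < n%:R.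
Proof.
move=> /compact_near_coveringP cK.
have := cK nat \oo (fun n y => mdist x y < n%:R) _.
move=> [|N _ /(_ N (leqnn N)) h]; last by exists N => y /h.
move=> y _; pose N := (Num.truncn (mdist x y + 1)).+1.
exists ([set z | mdist y z < 1], [set n | (N <= n)%N]).
  split; last by exists N.
  by apply/nbhs_metricP; exists 1.
move=> [z n] /= [yz Nn]; rewrite (le_lt_trans (metric_triangle x y z))//.
have h1 : N%:R <= n%:R :> R by rewrite ler_nat.
have := truncnS_gt (mdist x y + 1); rewrite -/N; move: yz h1.
by move: (mdist x y) (mdist y z) (N%:R : R) (n%:R : R) => *; lra.
Qed.

Lemma C0_cvg0 (h : E -> R) (x : E) (y : nat -> E) : C0 h ->
  (forall n, n%:R <= mdist x (y n)) -> h (y n) @[n --> \oo] --> (0 : R).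
Proof.
move=> [_ h0] yn; apply/cvgrPdist_lt => e e0.
have [K cK hK] := h0 _ e0; have [N hN] := compact_bounded_dist x cK.
exists N => // n /= Nn; rewrite sub0r normrN; apply: hK => /hN.
by rewrite ltNge (le_trans _ (yn n))// ler_nat.
Qed.

Lemma measurable_fun_continuous (h : E -> R) : continuous h ->
  measurable_fun setT (h : Borel E -> R).
Proof.
move=> ch; apply: (@measurability _ _ (Borel E) R setT h _ (RGenOpens.measurableE R)) => //.
move=> _ [_ [a [b ->]] <-]; rewrite setTI; apply: measurable_open.
by apply: open_comp => //; move=> z _; exact: ch.
Qed.

End metric_facts.

(** * Short-time averages of the semigroup *)

Section resolvent_average.
Context {R : realType} {E : pmetricType R} {d : measure_display}
  {Omega : measurableType d}.
Variables (P : E -> probability Omega R) (Ft : R -> set (set Omega))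
  (X : R -> Omega -> E).
Hypothesis hX : standard_markov_process P Ft X.

Lemma exit_timeT w : exit_time X setT w = +oo%E.
Proof.
rewrite /exit_time (_ : [set _ | _ in _] = set0) ?ereal_inf0//.
by apply/seteqP; split => // t [u [_ h] _]; apply: h.
Qed.

(* The discount rate 1 is irrelevant; it only makes the payoff lemmas apply. *)
Definition short_average (t : R) (h : E -> R) (y : E) : R :=
  \int[P y]_w running_payoff X 1 (fun _ => h) 0 t%:E w.

Lemma admissible_time_indep (h : E -> R) : bmeas (h : Borel E -> R) ->
  admissible_payoff (fun _ : R => h).
Proof.
move=> [mh [M hM]]; split; last by exists M.
apply: measurable_funTS.
exact: (measurableT_comp mh (@measurable_snd _ _ R (Borel E))).
Qed.

Lemma bmeas_X t (h : E -> R) : 0 <= t -> bmeas (h : Borel E -> R) ->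
  bmeas (fun w => h (X t w)).
Proof. by move=> t0 bh; exact: (bmeas_comp bh (measurable_X hX t0)). Qed.

(** [mean_slice] for the open set [setT], from which there is no exit: no killing occurs and
    deterministic times give the semigroup. *)
Lemma short_averageE t h y (t0 : 0 < t) : bmeas (h : Borel E -> R) ->
  short_average t h y = t * \int[uniform_prob t0]_u
    (expR (- (Num.max 0 (Num.min u t))) * semigroup P X (Num.max 0 (Num.min u t)) h y) /\
  bmeas (fun u : R => expR (- (Num.max 0 (Num.min u t))) *
     semigroup P X (Num.max 0 (Num.min u t)) h y).
Proof.
move=> bh; have ah := admissible_time_indep bh.
have oT : open (setT : set E) by exact: openT.
have [h1 h2] := mean_slice hX oT ltr01 y t0 ah (lexx 0) (lexx 0) measurableT.
have kE u : \int[P y]_w (\1_setT w * killed_payoff X setT 1 (fun _ => h) 0 (fun=> Num.max 0 (Num.min u t)) w) =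
   expR (- (Num.max 0 (Num.min u t))) * semigroup P X (Num.max 0 (Num.min u t)) h y.
  rewrite /semigroup -E_Z; last by apply: bmeas_X => //; rewrite le_max lexx.
  apply: eq_Rintegral => w _; rewrite indicT mul1r /killed_payoff /before_exit.
  by rewrite indicE mem_set ?mul1r//= exit_timeT ltry.
under eq_fun do rewrite -kE; split; last exact: h2.
move: h1; rewrite subr0 => <-; apply: eq_Rintegral => w _.
rewrite indicT mul1r (running_payoff0 _ hX ltr01)// subr0 exit_timeT.
by rewrite min_l ?leey.
Qed.

Lemma semigroup_bound t h y M : 0 <= t -> bmeas (h : Borel E -> R) ->
  (forall y, `|h y| <= M) -> `|semigroup P X t h y| <= M.
Proof. by move=> t0 bh hM; apply: PE_bound => //; exact: bmeas_X. Qed.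

Lemma semigroup_ge0 t h y : (forall y, 0 <= h y) -> 0 <= semigroup P X t h y.
Proof. by move=> h0; exact: E_ge0. Qed.

Lemma semigroup_start (h : E -> R) y : bmeas (h : Borel E -> R) ->
  \int[P y]_w h (X 0 w) = h y.
Proof.
move=> bh; rewrite -[RHS](PE_cst (P y)); apply: E_ae.
{ exact: bmeas_X. }
{ exact: bmeas_cst. }
pose A := [set w | X 0 w = y].
have mA : measurable A.
  rewrite (_ : A = X 0 @^-1` [set y]); last by apply/seteqP; split.
  rewrite -[X in measurable X]setTI; apply: (measurable_X hX (lexx 0)) => //.
  apply: measurable_closed; apply: accessible_closed_set1.
  exact: hausdorff_accessible (@metric_hausdorff _ _).
exists (~` A); split; first exact: measurableC.
- by apply: etrans (probability_setC (P y) mA) _; rewrite (smp_start hX) subee.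
- by move=> w /= h1 Aw; apply: h1; rewrite Aw.
Qed.

Lemma semigroup_small_time (h : E -> R) y (e : R) : continuous h -> bmeas (h : Borel E -> R) ->
  0 < e -> exists2 r : R, 0 < r & forall u, 0 <= u -> u <= r -> `|semigroup P X u h y - h y| <= e.
Proof.
move=> ch bh e0; apply: contrapT => /forall2NP nh.
have : forall n : nat, exists u, [/\ 0 <= u, u <= n.+1%:R^-1 & ~ `|semigroup P X u h y - h y| <= e].
  move=> n; have [/negP|h1] := nh n.+1%:R^-1; first by rewrite invr_gt0 ltr0n.
  apply: contrapT => /forallNP h2; apply: h1 => u u0 un.
  by apply: contrapT => h3; apply: (h2 u).
move=> /choice[u hu].
have [mh [M hM]] := bh.
have : \int[P y]_w h (X (u n) w) @[n --> \oo] --> \int[P y]_w h (X 0 w).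
  apply: (E_cvg (M := M)) => //.
    by move=> n; have [u0 _ _] := hu n; exact: (bmeas_X u0 bh).1.
  move=> w; apply: (cvg_comp _ h _ (ch (X 0 w))) => A NA.
  have A0 : A (X 0 w) by exact: nbhs_singleton.
  move: A NA A0; have [rc _] := smp_cadlag hX w (lexx 0) => A /rc [r /= r0 rA] A0; have [N Nr] := ltr_add_invr (y := 0) (x := r) r0.
  exists N => // n /= Nn; have [u0 un _] := hu n.
  (* Right-continuity at 0 speaks of positive times, so [u n = 0] is treated apart. *)
  have [uE|un0] := eqVneq (u n) 0.
    by rewrite uE.
  apply: rA => /=; last by rewrite lt_neqAle eq_sym un0.
  rewrite sub0r normrN ger0_norm// (le_lt_trans un)//.
  rewrite add0r in Nr; rewrite (le_lt_trans _ Nr)// lef_pV2 ?posrE ?ltr0n//.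
  by rewrite ler_nat ltnS.
rewrite semigroup_start// => /cvgrPdist_le/(_ e e0)[N _ /(_ N (leqnn N))].
by rewrite distrC => h1; have [_ _] := hu N.
Qed.

(** The average is almost excessive: started at [sigma] it integrates over a window of length [t]
    after [sigma], which exceeds the window up to [t] by at most [r] in length, and [0 <= h <= 1].
    The factor [expR (- r)] absorbs the discount up to [sigma]. *)
Lemma short_average_restart t h y r sigma : 0 < t -> 0 <= r ->
  bmeas (h : Borel E -> R) -> (forall y, 0 <= h y <= 1) ->
  real_stopping_time Ft sigma -> (forall w, sigma w <= r) ->
  bmeas (short_average t h : Borel E -> R) /\
  expR (- r) * \int[P y]_w short_average t h (X (sigma w) w) <= short_average t h y + r.
Proof.
move=> t0 r0 bh h01 hs sr; have ah := admissible_time_indep bh.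
pose H (tp : R * Path E) := running_payoff eval_path 1 (fun _ => h) 0 t%:E tp.2.
have bH : bmeas H.
  apply: (@bmeas_running _ _ _ ltr01 _ (R * Path E)%type _ (cst 0) (cst t%:E) snd) => //.
have [mK idH0] := strong_markov_path hX bH.
have idH := idH0 sigma setT y hs (stopped_algebraT hs).
have bS : bmeas (short_average t h : Borel E -> R).
  have [M HM] := bH.2.
  split; last first.
    exists M => z; apply: PE_bound; last by move=> w; exact: (HM (0, sample_path hX w)).
    apply: (bmeas_running_sample hX ltr01) => //.
  rewrite (_ : short_average t h = (fun ty : R * Borel E =>
    \int[P ty.2]_w H (ty.1, sample_path hX w)) \o (fun z : Borel E => (0, z)))//.
  by apply: (measurableT_comp mK); exact: measurable_fun_pair.
split => //.
have h0 s z : 0 <= (fun _ : R => h) s z by have /andP[] := h01 z.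
have h1 s z : 0 <= s -> `|(fun _ : R => h) s z| <= 1.
  by move=> _; rewrite ger0_norm ?(h0 s)//; have /andP[] := h01 z.
have m1 := ah.1.
have -> : \int[P y]_w short_average t h (X (sigma w) w) =
    \int[P y]_w H (sigma w, shift_path (sigma w) (sample_path hX w)).
  transitivity (\int[P y]_w (\1_setT w * H (sigma w, shift_path (sigma w) (sample_path hX w)))).
    rewrite idH; apply: eq_Rintegral => w _; rewrite indicT mul1r//.
  by apply: eq_Rintegral => w _; rewrite indicT mul1r.
have bHs : bmeas (fun w => H (sigma w, shift_path (sigma w) (sample_path hX w))).
  apply: (bmeas_comp bH); apply: measurable_fun_pair.
    exact: (measurable_real_stopping_time hX hs).
  apply: measurable_shift_path; first exact: (measurable_real_stopping_time hX hs).
  exact: measurable_sample_path.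
have br : bmeas (fun w => running_payoff X 1 (fun _ => h) 0 t%:E w).
  exact: (bmeas_running_sample hX ltr01).
rewrite -E_Z// /short_average -[X in _ <= _ + X](PE_cst (P y)) -E_D//; last exact: bmeas_cst.
apply: E_le; [exact: bmeasZ|by apply: bmeasD => //; exact: bmeas_cst|].
move=> w; have s0 := hs.1 w; set p := sample_path hX w.
rewrite -[running_payoff X _ _ _ _ w]/(running_payoff eval_path 1 (fun _ => h) 0 t%:E p).
have tr : 0 <= t + r by rewrite addr_ge0// ltW.
have rp0 s T q : 0 <= s -> 0 <= running_payoff eval_path 1 (fun _ => h) s T q.
  by move=> s0'; apply: running_payoff_ge0 => // *; exact: h0.
have timeE s s' T q : running_payoff eval_path 1 (fun _ => h) s T q = running_payoff eval_path 1 (fun _ => h) s' T q.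
  by [].
apply: (@le_trans _ _ (running_payoff eval_path 1 (fun _ => h) 0 (t + sigma w)%:E p)).
  rewrite (running_payoff_split ltr01 m1 h1 p (lexx 0) s0 (T := (t + sigma w)%:E)); last first.
    by rewrite lee_fin lerDr ltW.
  apply: ler_wpDl; first exact: rp0.
  rewrite mul1r EFinD addeK//.
  rewrite /H /= (timeE (0 + sigma w) 0) ler_wpM2r ?rp0//.
  by rewrite ler_expR lerN2.
rewrite (running_payoff_split ltr01 m1 h1 p (lexx 0) (ltW t0) (T := (t + sigma w)%:E)); last first.
  by rewrite lee_fin lerDl.
rewrite lerD2l (_ : ((t + sigma w)%:E - t%:E)%E = (sigma w)%:E); last first.
  by rewrite -EFinB addrAC subrr add0r.
have := @running_payoff_short _ _ _ ltr01 _ _ m1 h1 (0 + t) (sigma w)%:E r (shift_path t p).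
rewrite add0r (ltW t0) lee_fin sr mul1r => /(_ isT r0 isT).
rewrite ger0_norm; last by apply: rp0; exact: ltW.
move=> h2; apply: le_trans h2; rewrite ler_piMl ?rp0 ?(ltW t0)//.
by apply: discount_le1 => //; exact: ltW.
Qed.

End resolvent_average.
Lemma bmeas_sum {R : realType} d (T : measurableType d) (f : nat -> T -> R) n :
  (forall k, bmeas (f k)) -> bmeas (fun x => \sum_(k < n) f k x).
Proof.
move=> bf; elim: n => [|n ih].
  by under eq_fun do rewrite big_ord0; exact: bmeas_cst.
by under eq_fun do rewrite big_ord_recr/=; exact: bmeasD.
Qed.

Lemma E_sum {R : realType} d (T : measurableType d) (mu : {finite_measure set T -> \bar R})
    (f : nat -> T -> R) n : (forall k, bmeas (f k)) ->
  \int[mu]_x (\sum_(k < n) f k x) = \sum_(k < n) \int[mu]_x f k x.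
Proof.
move=> bf; elim: n => [|n ih].
  under eq_Rintegral do rewrite big_ord0.
  by rewrite big_ord0 Rintegral_cst// mul0r.
under eq_Rintegral do rewrite big_ord_recr/=.
by rewrite big_ord_recr/= E_D ?ih//; exact: bmeas_sum.
Qed.

(** * Exit probabilities from a ball, uniformly in the starting point *)

Section small_exit.
Context {R : realType} {E : pmetricType R} {d : measure_display}
  {Omega : measurableType d}.
Variables (P : E -> probability Omega R) (Ft : R -> set (set Omega))
  (X : R -> Omega -> E).
Hypothesis hX : standard_markov_process P Ft X.
Hypothesis hE : admissible_state_space E.
Hypothesis hFeller : weakly_feller P X.
Variables (x : E) (rho : R).
Hypothesis rho0 : 0 < rho.

(** A tent supported in a closed ball, hence in a compact set, so the Feller property applies to it.
    [cobump] does not vanish at infinity and is reached through [1 - P_t bump]. *)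
Definition bump (y : E) : R := Num.max 0 (1 - mdist x y / rho).
Definition cobump (y : E) : R := 1 - bump y.

Lemma bump_itv y : 0 <= bump y <= 1.
Proof.
rewrite /bump le_max lexx/= ge_max ler01/= gerBl divr_ge0// ?(ltW rho0)//.
exact: mdist_ge0.
Qed.

Lemma cobump_itv y : 0 <= cobump y <= 1.
Proof. by have /andP[] := bump_itv y; rewrite /cobump; lra. Qed.

Lemma cobump_center : cobump x = 0.
Proof. by rewrite /cobump /bump mdistxx mul0r subr0 max_r ?ler01// subrr. Qed.

Lemma cobump_far y : rho <= mdist x y -> cobump y = 1.
Proof.
move=> h; rewrite /cobump /bump max_l ?subr0// subr_le0.
by rewrite ler_pdivlMr// mul1r.
Qed.

Lemma bump_continuous : continuous bump.
Proof.
move=> y; apply/cvgrPdist_le => e e0; apply/nbhs_metricP.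
exists (e * rho); first by rewrite mulr_gt0.
move=> z yz.
have h : `|mdist x y / rho - mdist x z / rho| <= e.
  rewrite -mulrBl normrM [X in _ * X]gtr0_norm ?invr_gt0// ler_pdivrMr//.
  exact: le_trans (mdist_lip x y z) (ltW yz).
have max_lip (a b : R) : `|Num.max 0 a - Num.max 0 b| <= `|a - b|.
{ have [a0|a0] := leP 0 a; have [b0|b0] := leP 0 b; rewrite ?subrr ?normr0//.
  - rewrite subr0 (ger0_norm a0) ger0_norm; last by rewrite subr_ge0 ltW// (lt_le_trans b0).
    by rewrite lerDl oppr_ge0 ltW.
  - rewrite sub0r normrN distrC (ger0_norm b0) ger0_norm; last by rewrite subr_ge0 ltW// (lt_le_trans a0).
    by rewrite lerDl oppr_ge0 ltW. }
rewrite /bump (le_trans (max_lip _ _))// distrC.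
by rewrite (_ : _ - _ = mdist x y / rho - mdist x z / rho)//; ring.
Qed.

Lemma C0_bump : C0 bump.
Proof.
split.
  split; last exact: bump_continuous.
  by exists 1 => y; have /andP[b0 b1] := bump_itv y; rewrite ger0_norm.
move=> e e0; have [_ _ cK] := hE; exists (metric_closed_ball x rho); first exact: cK.
move=> y /negP; rewrite -ltNge => /ltW/cobump_far; rewrite /cobump => h.
by rewrite (_ : bump y = 0) ?normr0//; lra.
Qed.

Lemma bmeas_bump : bmeas (bump : Borel E -> R).
Proof.
split; first exact: (measurable_fun_continuous bump_continuous).
by have [[]] := C0_bump.
Qed.

Lemma bmeas_cobump : bmeas (cobump : Borel E -> R).
Proof. by apply: bmeasB; [exact: bmeas_cst|exact: bmeas_bump]. Qed.

Lemma cobump_continuous : continuous cobump.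
Proof. by move=> y; apply: (@cvgB _ R^o); [exact: cvg_cst|exact: bump_continuous]. Qed.

Lemma semigroup_cobump t y : 0 <= t ->
  semigroup P X t cobump y = 1 - semigroup P X t bump y.
Proof.
move=> t0; rewrite /semigroup E_B.
- by rewrite PE_cst.
- exact: bmeas_cst.
- exact: (bmeas_X hX t0 bmeas_bump).
Qed.

Lemma semigroup_cobump_itv t y : 0 <= t -> 0 <= semigroup P X t cobump y <= 1.
Proof.
move=> t0; apply/andP; split.
  by apply: semigroup_ge0 => z; have /andP[] := cobump_itv z.
apply: PE_le; first exact: (bmeas_X hX t0 bmeas_cobump).
by move=> w; have /andP[] := cobump_itv (X t w).
Qed.

(* [escape t] averages P_u(1 - bump) over u in [0, t], so as t -> 0 it tends to
   [cobump] pointwise. The limit need not be locally uniform, but a sum of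
   functions [escape t_k] is at least 1/4 off the ball as soon as one of them
   is, and stays small at the centre when t_k decreases fast enough. *)
Definition escape (t : R) (y : E) : R := short_average P X t cobump y / t.

Let clamp (t u : R) : R := Num.max 0 (Num.min u t).
Let clamp_ge0 t u : 0 <= clamp t u. Proof. by rewrite /clamp le_max lexx. Qed.
Let clamp_le t u : 0 <= t -> clamp t u <= t.
Proof. by move=> t0; rewrite /clamp ge_max t0 ge_min lexx orbT. Qed.

Lemma escapeE t y (t0 : 0 < t) :
  escape t y = \int[uniform_prob t0]_u (expR (- clamp t u) * semigroup P X (clamp t u) cobump y) /\
  bmeas (fun u : R => expR (- clamp t u) * semigroup P X (clamp t u) cobump y).
Proof.
have [h1 h2] := short_averageE hX y t0 bmeas_cobump; split; last exact: h2.
by rewrite /escape h1 mulrC mulKf// gt_eqF.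
Qed.

Lemma expRN_half (u : R) : 0 <= u -> u <= 2^-1 -> 2^-1 <= expR (- u) <= 1.
Proof.
move=> u0 u1; rewrite -[X in _ && (_ <= X)]expR0 ler_expR oppr_le0 u0 andbT.
by apply: le_trans (expR_ge1Dx _); lra.
Qed.

Lemma escape_ge0 t y : 0 < t -> 0 <= escape t y.
Proof.
move=> t0; have [-> _] := escapeE y t0; apply: E_ge0 => u.
by rewrite mulr_ge0 ?expR_ge0//; have /andP[] := semigroup_cobump_itv y (clamp_ge0 t u).
Qed.

(** The limit [l] is left free to serve twice: for continuity of [escape], and along sequences going
    to infinity, where it is 1. *)
Lemma escape_cvg t (y : nat -> E) (l : R -> R) (t0 : 0 < t) :
  (forall u, 0 <= u -> semigroup P X u cobump (y n) @[n --> \oo] --> l u) ->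
  escape t (y n) @[n --> \oo] -->
    \int[uniform_prob t0]_u (expR (- clamp t u) * l (clamp t u)).
Proof.
move=> yl; rewrite (_ : (fun n => escape t (y n)) = (fun n => \int[uniform_prob t0]_u
  (expR (- clamp t u) * semigroup P X (clamp t u) cobump (y n)))); last first.
  by apply/funext => n; have [-> _] := escapeE (y n) t0.
apply: (E_cvg (M := 1)).
- by move=> n; have [_ []] := escapeE (y n) t0.
- move=> n u; rewrite normrM ger0_norm ?expR_ge0//.
  have /andP[s0 s1] := semigroup_cobump_itv (y n) (clamp_ge0 t u).
  rewrite (ger0_norm s0) -[leRHS]mul1r ler_pM ?expR_ge0//.
  by rewrite -expR0 ler_expR oppr_le0.
- move=> u; apply: (@cvgM _ _ _ _ (cst _) (fun n => semigroup P X _ cobump (y n))) => //.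
    exact: cvg_cst.
  exact: yl.
Qed.

Lemma escape_continuous t : 0 < t -> continuous (escape t).
Proof.
move=> t0 y; apply: seq_continuous_at => z zy.
have [-> _] := escapeE y t0; apply: (@escape_cvg t z (fun u => semigroup P X u cobump y)).
move=> u u0; under eq_fun do rewrite (semigroup_cobump _ u0).
rewrite semigroup_cobump//; apply: (@cvgB _ R^o); first exact: cvg_cst.
have [[_ cb] _] := hFeller u0 C0_bump.
exact: (cvg_comp z _ zy (cb y)).
Qed.

(** Far away [P_u bump] tends to 0, so [escape] tends to the mean discount, at least 1/2 for
    [t <= 1/2]. Only a compact ball is then left to be covered. *)
Lemma escape_far t : 0 < t -> t <= 2^-1 ->
  exists n : nat, forall y, n%:R <= mdist x y -> 4^-1 <= escape t y.
Proof.
move=> t0 t1; apply: contrapT => /forallNP nh.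
have : forall n : nat, exists y, n%:R <= mdist x y /\ ~ 4^-1 <= escape t y.
  move=> n; apply: contrapT => /forallNP h; apply: (nh n) => y ny.
  by apply: contrapT => h2; apply: (h y).
move=> /choice[y hy].
have : escape t (y n) @[n --> \oo] --> \int[uniform_prob t0]_u (expR (- clamp t u) * 1).
  apply: (@escape_cvg t y (fun=> 1)) => u u0.
  under eq_fun do rewrite (semigroup_cobump _ u0).
  suff : 1 - semigroup P X u bump (y n) @[n --> \oo] --> (1 - 0 : R) by rewrite subr0.
  apply: (@cvgB _ R^o); first exact: cvg_cst.
  apply: (C0_cvg0 (x := x) (hFeller u0 C0_bump)) => n.
  exact: (hy n).1.
have l1 : 2^-1 <= \int[uniform_prob t0]_u (expR (- clamp t u) * 1).
  apply: PE_ge.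
    split.
      apply: measurable_funM => //; apply: measurableT_comp => //.
      apply: measurableT_comp => //; apply: measurable_maxr => //.
      exact: measurable_minr.
    exists 1 => u; rewrite mulr1 ger0_norm ?expR_ge0//.
    by rewrite -expR0 ler_expR oppr_le0.
  move=> u; rewrite mulr1.
  by have /andP[] := expRN_half (clamp_ge0 t u) (le_trans (clamp_le u (ltW t0)) t1).
have q0 : 0 < 4^-1 :> R by rewrite invr_gt0.
move=> /cvgrPdist_le/(_ _ q0)[N _ /(_ N (leqnn N))].
rewrite ler_norml => /andP[_ h]; apply: (hy N).2.
by move: h l1; lra.
Qed.

(** Here 3/8 is the product of 1/2 for the discount and 3/4 for the semigroup, which is within 1/4
    of [cobump y = 1]. It leaves room above 1/4 for a continuity argument. *)
Lemma escape_small_time y : rho <= mdist x y ->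
  exists2 r, 0 < r & forall t, 0 < t -> t <= r -> 3 / 8 <= escape t y.
Proof.
move=> yfar; have q0 : 0 < 4^-1 :> R by rewrite invr_gt0.
have [r r0 hr] := semigroup_small_time hX y cobump_continuous bmeas_cobump q0.
exists (Num.min r 2^-1); first by rewrite lt_min r0/= invr_gt0 ltr0n.
move=> t t0; rewrite le_min => /andP[tr t1]; have [-> b] := escapeE y t0.
apply: PE_ge => // u.
have /andP[e1 _] := expRN_half (clamp_ge0 t u) (le_trans (clamp_le u (ltW t0)) t1).
have := hr _ (clamp_ge0 t u) (le_trans (clamp_le u (ltW t0)) tr).
rewrite cobump_far// ler_norml => /andP[s1 _].
move: e1 s1; set e := expR _; set s := semigroup _ _ _ _ _ => e1 s1.
by nra.
Qed.

Lemma escape_center t k : 0 < t ->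
  (forall u, 0 <= u -> u <= t -> semigroup P X u cobump x <= k) -> escape t x <= k.
Proof.
move=> t0 hk; have [-> b] := escapeE x t0; apply: PE_le => // u.
apply: le_trans (hk _ (clamp_ge0 t u) (clamp_le u (ltW t0))).
have /andP[s0 _] := semigroup_cobump_itv x (clamp_ge0 t u).
by rewrite ler_piMl// -expR0 ler_expR oppr_le0.
Qed.

(** The factor 2 undoes the discount, at least 1/2 for [r <= 1/2]; dividing by [t] turns the error
    [r] into [r / t]. *)
Lemma escape_restart t y r sigma : 0 < t -> 0 <= r -> r <= 2^-1 ->
  real_stopping_time Ft sigma -> (forall w, sigma w <= r) ->
  bmeas (escape t : Borel E -> R) /\
  \int[P y]_w escape t (X (sigma w) w) <= 2 * (escape t y + r / t).
Proof.
move=> t0 r0 r1 hs sr.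
have [bS h] := short_average_restart hX y t0 r0 bmeas_cobump cobump_itv hs sr.
have be : bmeas (escape t : Borel E -> R).
  by apply: bmeasM => //; exact: bmeas_cst.
split => //.
have bXs : bmeas (fun w => short_average P X t cobump (X (sigma w) w)).
  exact: (bmeas_comp bS (measurable_X_stop hX hs)).
have -> : \int[P y]_w escape t (X (sigma w) w) =
    t^-1 * \int[P y]_w short_average P X t cobump (X (sigma w) w).
  by rewrite -E_Z//; apply: eq_Rintegral => w _; rewrite /escape mulrC.
rewrite /escape -mulrDl mulrA mulrC ler_wpM2r ?invr_ge0 ?(ltW t0)//.
have /andP[e1 _] := expRN_half r0 r1.
have : 0 <= \int[P y]_w short_average P X t cobump (X (sigma w) w).
  apply: E_ge0 => w; have := escape_ge0 (X (sigma w) w) t0.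
  by rewrite /escape pmulr_lge0 ?invr_gt0.
move: h e1; set e := expR _; set I := \int[_]_w _; set s := short_average _ _ _ _ _.
by move=> h1 h2 h3; nra.
Qed.

(** The sum [S N] is continuous, small near the centre, at least 1/4 off the ball, and nearly a
    supermartingale over short times. At an early exit it is at least 1/4, so Markov's inequality
    bounds the exit probability. *)
Theorem small_time_exit (e : R) : 0 < e ->
  exists delta r : R, [/\ 0 < delta, 0 < r & forall y, mdist x y < delta ->
    \int[P y]_w \1_[set w | (exit_time X (metric_ball x rho) w <= r%:E)%E] w <= e].
Proof.
(* The final estimate is 4 * 2 * (2 eta + eta): Markov's inequality at level 1/4, the factor of
   [escape_restart], the value of [S N] near the centre, the time error. *)
move=> e0; pose eta := e / 24; have eta0 : 0 < eta by rewrite divr_gt0.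
(* The geometric bounds at the centre keep every partial sum below [eta], however many terms
   compactness will require. *)
have : forall k : nat, exists t : R, [/\ 0 < t, t <= 2^-1, t <= k.+1%:R^-1 &
    forall u, 0 <= u -> u <= t -> semigroup P X u cobump x <= eta / 2 ^+ k.+1].
  move=> k; have p0 : 0 < eta / 2 ^+ k.+1 by rewrite divr_gt0// exprn_gt0.
  have [r r0 hr] := semigroup_small_time hX x cobump_continuous bmeas_cobump p0.
  exists (Num.min r (Num.min 2^-1 k.+1%:R^-1)).
  have -> : 0 < Num.min r (Num.min 2^-1 k.+1%:R^-1) by rewrite !lt_min r0 !invr_gt0 !ltr0n.
  rewrite !ge_min !lexx !orbT; split => // u u0; rewrite le_min => /andP[ur _].
  have := hr u u0 ur.
  by rewrite cobump_center subr0; exact: le_trans (ler_norm _).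
move=> /choice[t ht].
have t0 k : 0 < t k by have [] := ht k.
pose S N y := \sum_(k < N) escape (t k) y.
have S_nd m n y : (m <= n)%N -> S m y <= S n y.
  move=> mn; rewrite -(subnKC mn); elim: (n - m)%N => [|i ih]; first by rewrite addn0.
  by rewrite addnS; apply: le_trans ih _; rewrite /S big_ord_recr/= lerDl; exact: escape_ge0.
have S_ge k N y : (k < N)%N -> escape (t k) y <= S N y.
  move=> kN; apply: le_trans (S_nd _ _ y kN); rewrite /S big_ord_recr/= lerDr.
  by rewrite sumr_ge0// => i _; exact: escape_ge0.
have Sx N : S N x <= eta.
  have h : S N x <= eta * (1 - (2 ^+ N)^-1).
    elim: N => [|N ih]; first by rewrite /S big_ord0 expr0 invr1 subrr mulr0.
    rewrite /S big_ord_recr/=; have [_ _ _ h] := ht N.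
    apply: le_trans (lerD ih (escape_center (t0 N) h)) _.
    rewrite exprS invfM; move: ((2 ^+ N)^-1 : R) => a.
    by rewrite (_ : eta * (1 - a) + eta * (2^-1 * a) = eta * (1 - 2^-1 * a))//; field.
  apply: le_trans h _; rewrite ler_piMr ?(ltW eta0)// gerBl invr_ge0.
have [n0 far] := escape_far (t0 0%N) (let: And4 _ h _ _ := ht 0%N in h).
have [_ _ cK] := hE.
have /compact_near_coveringP nK := cK x n0%:R.
(* Each point off the ball has some term at least 3/8, hence at least 1/4 on a neighbourhood;
   compactness makes one [N] work for all. *)
have [N1 _ hN1] : \forall N \near \oo, metric_closed_ball x n0%:R `<=`
    (fun y => rho <= mdist x y -> 4^-1 <= S N y).
  apply: nK => y _; have [yr|ry] := ltP (mdist x y) rho.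
    exists (metric_ball x rho, setT).
      by split; [apply: open_nbhs_nbhs; split => //; exact: open_metric_ball|exact: filterT].
    by move=> [z N] /= [zr _]; rewrite leNgt zr.
  have [r r0 hr] := escape_small_time ry.
  have [k kr] := ltr_add_invr (y := 0) (x := r) r0.
  have ek : 3 / 8 <= escape (t k) y.
    apply: hr => //; have [_ _ tk _] := ht k; rewrite (le_trans tk)//.
    by rewrite add0r in kr; exact: ltW.
  have q0 : 0 < 8^-1 :> R by rewrite invr_gt0.
  have /cvgrPdist_le/(_ _ q0) near_k := @escape_continuous _ (t0 k) y.
  exists ([set z | `|escape (t k) y - escape (t k) z| <= 8^-1], [set N | (k < N)%N]).
    by split => //; exists k.+1.
  move=> [z N] /= [hz kN] _; apply: le_trans (S_ge k N z kN).
  by move: hz; rewrite ler_norml => /andP[_ hz]; move: hz ek; lra.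
(* At least one term, since [escape (t 0)] takes care of the points beyond distance [n0]. *)
pose N := maxn 1 N1.
have SN y : rho <= mdist x y -> 4^-1 <= S N y.
  move=> ry; have [yn|ny] := leP (mdist x y) n0%:R.
    by apply: hN1 => //=; rewrite /N leq_maxr.
  by apply: le_trans (far y (ltW ny)) _; apply: S_ge; rewrite /N leq_maxl.
have cS m : continuous (S m).
  elim: m => [|m ih].
    rewrite (_ : S 0%N = cst 0); first by move=> y; exact: cvg_cst.
    by apply/funext => y; rewrite /S big_ord0.
  rewrite (_ : S m.+1 = fun y => S m y + escape (t m) y).
    by move=> y; apply: (@cvgD _ R^o); [exact: ih|exact: escape_continuous].
  by apply/funext => y; rewrite /S big_ord_recr.
have /cvgrPdist_le/(_ _ eta0)/nbhs_metricP[delta delta0 hdelta] := cS N x.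
(* Collects the restart errors [r / t k]; [r] is chosen after [N] to make their total at most
   [eta]. *)
pose L := \sum_(k < N) (t k)^-1.
have L0 : 0 <= L by rewrite sumr_ge0// => k _; rewrite invr_ge0 ltW.
pose r := Num.min 2^-1 (eta / (L + 1)).
have r0 : 0 < r by rewrite lt_min invr_gt0 ltr0n divr_gt0 ?ltr_wpDl.
have rL : r * L <= eta.
  apply: (@le_trans _ _ (eta / (L + 1) * (L + 1))); last by rewrite divfK ?gt_eqF ?ltr_wpDl.
  by rewrite ler_pM ?(ltW r0)// ?ge_min ?lexx ?orbT ?lerDl.
exists delta, r; split => // y yx.
have oU := open_metric_ball x rho.
pose tau := exit_time X (metric_ball x rho).
have htau : stopping_time Ft tau by exact: (exit_stopping_time hX oU).
pose sigma w := fine (mine (tau w) r%:E).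
have hs : real_stopping_time Ft sigma by exact: (stopping_time_truncate hX htau (ltW r0)).
have fin w : mine (tau w) r%:E \is a fin_num.
  rewrite ge0_fin_numE; last by rewrite le_min htau.1 lee_fin ltW.
  by rewrite gt_min ltry orbT.
have sr w : sigma w <= r by rewrite -lee_fin fineK// ge_min lexx orbT.
have r1 : r <= 2^-1 by rewrite ge_min lexx.
have bk k : bmeas (fun w => escape (t k) (X (sigma w) w)).
  have [be _] := escape_restart y (t0 k) (ltW r0) r1 hs sr.
  exact: (bmeas_comp be (measurable_X_stop hX hs)).
have bSX : bmeas (fun w => S N (X (sigma w) w)) by exact: (bmeas_sum N bk).
have ES : \int[P y]_w S N (X (sigma w) w) <= 2 * (S N y + r * L).
  rewrite (E_sum _ N bk) /S /L mulr_sumr -big_split mulr_sumr/=.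
  apply: ler_sum => k _; have [_] := escape_restart y (t0 k) (ltW r0) r1 hs sr.
  by [].
have Sy : S N y <= 2 * eta.
  have := hdelta y yx; rewrite ler_norml => /andP[h _].
  by have := Sx N; move: h; lra.
have mB : measurable [set w | (tau w <= r%:E)%E].
  exact: (Ft_measurable hX (ltW r0) (htau.2 _ (ltW r0))).
apply: (@le_trans _ _ (4 * \int[P y]_w S N (X (sigma w) w))).
  rewrite -E_Z//; apply: E_le; [exact: bmeas_indic|exact: bmeasZ|] => w.
  rewrite indicE; have [|] := boolP (w \in _); last first.
    move=> _; rewrite mulr_ge0// sumr_ge0// => k _; exact: escape_ge0.
  rewrite inE /= => tr; have tauE : tau w = (sigma w)%:E by rewrite /sigma fineK// min_l.
  rewrite -ler_pdivrMl// mulr1; apply: SN.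
  have := first_exit_openN oU (p := sample_path hX w) (t := sigma w) tauE.
  by move=> /negP; rewrite -leNgt.
by move: ES Sy rL; rewrite /eta; lra.
Qed.

End small_exit.

(** * Convergence *)

Section dini.
Context {R : realType} {E : pmetricType R}.

Lemma dini (K : set E) (q : nat -> E -> R) (e : R) : compact K ->
  (forall k, continuous (q k)) -> (forall k l y, (k <= l)%N -> q l y <= q k y) ->
  (forall y, K y -> q k y @[k --> \oo] --> (0 : R)) -> 0 < e ->
  exists k, forall y, K y -> q k y <= e.
Proof.
move=> /compact_near_coveringP cK cq nq q0 e0.
have [|k _ hk] := cK nat \oo (fun k y => q k y <= e) _; last first.
  by exists k => y Ky; apply: (hk k (leqnn k)).
move=> y Ky; have e2 : 0 < e / 2 by rewrite divr_gt0.
have /cvgrPdist_le/(_ _ e2)[k _ /(_ k (leqnn k)) hk] := q0 y Ky.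
have /cvgrPdist_le/(_ _ e2) near_k := cq k y.
exists ([set z | `|q k y - q k z| <= e / 2], [set l | (k <= l)%N]).
  by split => //; exists k.
move=> [z l] /= [hz kl]; apply: le_trans (nq _ _ z kl) _.
move: hz hk; rewrite sub0r normrN !ler_norml => /andP[h1 _] /andP[_ h2].
by move: h1 h2; move: (q k y) (q k z) => *; lra.
Qed.

End dini.

Section convergence.
Context {R : realType} {E : pmetricType R} {d : measure_display}
  {Omega : measurableType d}.
Variables (P : E -> probability Omega R) (Ft : R -> set (set Omega))
  (X : R -> Omega -> E) (O : set E) (alpha : R) (f F : R -> E -> R) (Mf MF : R).
Hypothesis hE : admissible_state_space E.
Hypothesis hX : standard_markov_process P Ft X.
Hypothesis hFeller : weakly_feller P X.
Hypothesis oO : open O.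
Hypothesis alpha0 : 0 < alpha.
Hypothesis mf : measurable_on_half_space f.
Hypothesis mF : measurable_on_half_space F.
Hypothesis fM : forall s x, 0 <= s -> `|f s x| <= Mf.
Hypothesis FM : forall s x, 0 <= s -> `|F s x| <= MF.
Hypothesis hFO : continuous_on_half_space O F.

Local Notation T := (exit_time X O).
Local Notation killed := (killed_payoff X O alpha).
Local Notation reward := (stopped_reward X O alpha f F).
Local Notation phi := (penalty F).
Local Notation w := (value P Ft X alpha f F O).
Local Notation JJ := (J P X alpha f F O).
Local Notation path := (sample_path hX).
Local Notation solution := (penalized_solution P X alpha f F O).
Local Notation C := (payoff_sup alpha Mf MF).

Let hf : admissible_payoff f. Proof. by split => //; exists Mf. Qed.
Let hF : admissible_payoff F. Proof. by split => //; exists MF. Qed.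
Let Mf0 : 0 <= Mf. Proof. exact: (M_ge0 fM). Qed.
Let MF0 : 0 <= MF. Proof. exact: (M_ge0 FM). Qed.
Let C0 : 0 <= C. Proof. by rewrite addr_ge0// divr_ge0// ltW. Qed.

Lemma payoff_continuous_near s x (e : R) : 0 <= s -> O x -> 0 < e ->
  exists2 eta : R, 0 < eta & forall s' y, 0 <= s' -> `|s' - s| < eta -> mdist x y < eta ->
    O y /\ `|F s x - F s' y| <= e.
Proof.
move=> s0 Ox e0; have Hsx : half_space O (s, x) by split=> //=; rewrite in_itv/= s0.
have /subspace_continuousP/(_ _ Hsx)/cvgrPdist_le/(_ _ e0) := hFO.
move=> [[A B] /= [nA nB] AB].
have /nbhs_metricP[e1 e10 h1] := nB.
have /nbhs_metricP[e2 e20 h2] : nbhs x O by exact: open_nbhs_nbhs.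
have /nbhs_ballP[e3 e30 h3] := nA.
exists (Num.min e1 (Num.min e2 e3)); first by rewrite !lt_min e10 e20.
move=> s' y s'0; rewrite !lt_min => /and3P[_ _ s3] /and3P[y1 y2 _].
have Oy : O y by exact: h2.
split => //; apply: (AB (s', y)) => /=; last by split => //=; rewrite in_itv/= s'0.
by split; [apply: h3; rewrite /ball/= distrC|exact: h1].
Qed.

(** Unless the ball is left by time [r], the terminal reward is at least [k - e1] whether the game
    ends by stopping or by exit; running reward and discount cost at most [(Mf + alpha * MF) * r].
    Leaving the ball early costs at most [2 * MF] more. *)
Lemma J_local_lower s x rho r t : 0 <= s -> 0 <= t -> t <= r -> 0 <= r ->
  forall (k e1 e2 : R) y, 
  (forall u z, 0 <= u -> u <= r -> mdist x z < rho -> k - e1 <= F (s + u) z) ->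
  `|k| <= MF -> 0 <= e1 ->
  \int[P y]_om \1_[set om | (exit_time X (metric_ball x rho) om <= r%:E)%E] om <= e2 ->
  k - e1 - (Mf + alpha * MF) * r - 2 * MF * e2 <= JJ s y (fun=> t%:E).
Proof.
move=> s0 t0 tr r0 k e1 e2 y hk kM e10 he2.
have oU := open_metric_ball x rho.
pose B := [set om | (exit_time X (metric_ball x rho) om <= r%:E)%E].
have mB : measurable B.
  exact: (Ft_measurable hX r0 ((exit_stopping_time hX oU).2 _ r0)).
have bB : bmeas (fun om => \1_B om : R) by exact: bmeas_indic.
have ht := real_stopping_timeE (real_stopping_time_cst hX t0).
have th0 om : (0 <= mine t%:E (T om))%E by rewrite le_min lee_fin t0 first_exit_ge0.
have bJ := bmeas_payoff hX alpha0 mf mF fM FM s0 (measurable_stop_exit hX oO ht) th0.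
apply: (@le_trans _ _ (\int[P y]_om (k - e1 - (Mf + alpha * MF) * r - 2 * MF * \1_B om))).
  have bc : bmeas (fun _ : Omega => k - e1 - (Mf + alpha * MF) * r) by exact: bmeas_cst.
  have b2 := bmeasZ (2 * MF) bB.
  rewrite E_B// PE_cst E_Z// lerD2l lerN2 ler_wpM2l// mulr_ge0//.
apply: E_le; [|exact: bJ|].
  by apply: bmeasB; [exact: bmeas_cst|exact: bmeasZ].
move=> om; set th := mine t%:E (T om).
have fin : th \is a fin_num.
  rewrite ge0_fin_numE; last exact: th0.
  by rewrite gt_min ltry.
have thr : (th <= r%:E)%E by rewrite ge_min lee_fin tr.
have [th1 th2] : 0 <= fine th /\ fine th <= r.
  by split; rewrite -lee_fin fineK// th0.
have h1 := running_payoff_short alpha0 mf fM (path om) s0 r0 thr.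
have h1' : - (Mf * r) <= running_payoff X alpha f s th om.
  by move: h1; rewrite ler_norml => /andP[].
have e_1 : expR (- (alpha * fine th)) <= 1 by exact: discount_le1.
have e_2 : 1 - alpha * r <= expR (- (alpha * fine th)).
  by apply: le_trans (expR_ge1Dx _); rewrite lerD2l lerN2 ler_wpM2l ?(ltW alpha0).
have kM' : - MF <= k <= MF by rewrite -ler_norml.
have sth : 0 <= s + fine th by rewrite addr_ge0.
have FM' : - MF <= F (s + fine th) (X (fine th) om) <= MF by rewrite -ler_norml FM.
have -> : terminal_payoff X alpha F s th om =
    expR (- (alpha * fine th)) * F (s + fine th) (X (fine th) om).
  by rewrite /terminal_payoff -(fineK fin).
have e_0 := expR_ge0 (- (alpha * fine th)).
have key : 0 <= r /\ 0 <= alpha by rewrite r0 ltW.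
have [[Bom -> _]|[nB -> _]] := indic_split R B om.
  move: h1' e_0 e_1 e_2 kM' FM' key; move: (running_payoff _ _ _ _ _ _) (expR _) (F _ _).
  move=> a e b h /= ? ? ? /andP[? ?] /andP[? ?] [? ?].
  have : - MF <= e * b by nra.
  have : 0 <= alpha * MF * r by rewrite !mulr_ge0// ltW.
  have : 0 <= Mf * r by rewrite mulr_ge0.
  by nra.
have Xb : mdist x (X (fine th) om) < rho.
  apply: (first_exit_in (O := metric_ball x rho) (p := path om)) => //.
  rewrite (le_lt_trans (_ : _ <= r%:E)%E)//.
  by move/negP: nB; rewrite -ltNge.
have hF1 := hk _ _ th1 th2 Xb.
move: h1' e_0 e_1 e_2 kM' FM' key hF1; move: (running_payoff _ _ _ _ _ _) (expR _) (F _ _).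
move=> a e b h /= ? ? ? /andP[? ?] /andP[? ?] [? ?] ?.
have : b - alpha * r * MF <= e * b by nra.
by nra.
Qed.

Lemma penalty_small s x (e : R) : 0 <= s -> O x -> 0 < e ->
  exists delta beta0 : R, [/\ 0 < delta, 0 < beta0 & forall beta v s' y,
    beta0 <= beta -> solution beta v -> 0 <= s' -> `|s' - s| < delta ->
    mdist x y < delta -> phi v s' y <= e].
Proof.
(* Each of the following costs at most [e1]: the oscillation of [F] on the ball, the same again at
   the starting point, running reward with discount, the penalty when stopping. An early exit costs
   [2 * MF * e1]. *)
move=> s0 Ox e0; pose e1 := e / (5 + 2 * MF).
have den : 0 < 5 + 2 * MF by rewrite ltr_pwDl// mulr_ge0.
have e10 : 0 < e1 by rewrite divr_gt0.
have [eta eta0 hF1] := payoff_continuous_near s0 Ox e10.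
have [delta1 [r1 [delta10 r10 hexit]]] := small_time_exit hX hE hFeller x eta0 e10.
pose c := Mf + alpha * MF.
have c0 : 0 <= c by rewrite addr_ge0// mulr_ge0// ltW.
pose r := Num.min (Num.min r1 (eta / 2)) (e1 / (c + 1)).
have r0 : 0 < r by rewrite !lt_min r10 !divr_gt0// ltr_wpDl.
have rr1 : r <= r1 by rewrite !ge_min lexx.
have reta : r <= eta / 2 by rewrite !ge_min lexx orbT.
have cr : c * r <= e1.
  apply: (@le_trans _ _ ((c + 1) * (e1 / (c + 1)))).
    by rewrite ler_pM// ?(ltW r0)// ?lerDl// !ge_min lexx !orbT.
  by rewrite mulrC divfK// gt_eqF// ltr_wpDl.
(* Makes an accumulated penalty of at least [beta * r * e1] worth [3 * C], against a remainder of at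
   least [- 2 * C]; the summand 1 keeps [beta0] positive. *)
pose beta0 := 3 * C / (r * e1) + 1.
have re1 : 0 < r * e1 by rewrite mulr_gt0.
have beta00 : 0 < beta0.
  have h : 0 <= 3 * C / (r * e1) by apply: divr_ge0; [exact: mulr_ge0|exact: ltW].
  by rewrite ltr_wpDl.
exists (Num.min delta1 (eta / 2)), beta0; split => //.
  by rewrite lt_min delta10 divr_gt0.
move=> beta v s' y bb hv s'0; rewrite !lt_min => /andP[_ s's] /andP[y1 ye].
have beta_gt0 : 0 < beta by exact: lt_le_trans bb.
have av := admissible_solution hv; have aphi := admissible_penalty hF av.
have ye' : mdist x y < eta by apply: lt_trans ye _; rewrite ltr_pdivrMr// mulr2n mulrDr mulr1 ltrDl.
have [_ Fy] : O y /\ `|F s x - F s' y| <= e1.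
  by apply: hF1 => //; apply: lt_trans s's _; rewrite ltr_pdivrMr// mulr2n mulrDr mulr1 ltrDl.
have Jlow t : 0 <= t -> t <= r -> F s x - e1 - c * r - 2 * MF * e1 <= JJ s' y (fun=> t%:E).
{ move=> t0 tr; apply: (J_local_lower (x := x) (rho := eta)) => //; first exact: ltW.
  - move=> u z u0 ur xz; have [] := hF1 (s' + u) z _ _ xz.
    + by rewrite addr_ge0.
    + rewrite addrAC (le_lt_trans (ler_normD _ _))// (ger0_norm u0).
      by move: s's ur reta; move: (`|s' - s|) => a *; lra.
    + by move=> _; rewrite ler_norml => /andP[_]; lra.
  - exact: FM.
  - exact: ltW.
  - apply: le_trans (hexit y y1); apply: E_le.
    + apply: bmeas_indic; apply: (Ft_measurable hX (ltW r0)).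
      by apply: (exit_stopping_time hX (open_metric_ball x eta)).2; exact: ltW.
    + apply: bmeas_indic; apply: (Ft_measurable hX (ltW r10)).
      by apply: (exit_stopping_time hX (open_metric_ball x eta)).2; exact: ltW.
    + move=> om; rewrite !indicE; have [h|] := boolP (om \in [set om' | (exit_time X (metric_ball x eta) om' <= r%:E)%E]) => //.
      rewrite mem_set//=; move: h; rewrite inE => /le_trans; apply.
      by rewrite lee_fin. }
(* In the second case [F <= v] at the point, and the penalty vanishes. *)
suff vlow : F s x - 3 * e1 - 2 * MF * e1 <= v s' y \/ MF <= v s' y.
{ rewrite /penalty ge_max (ltW e0) andbT lerBlDr.
  have eE : e = 5 * e1 + 2 * MF * e1 by rewrite -mulrDl /e1 mulrC divfK// gt_eqF.
  case: vlow => h.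
    by move: Fy; rewrite ler_norml => /andP[Fy _]; move: (2 * MF * e1) eE h => a eE h; lra.
  have : F s' y <= MF by apply: le_trans (ler_norm _) _; exact: FM.
  by move=> h2; move: h h2 (ltW e0); lra. }
(* Either the penalty is small at some time t <= r, where one may stop, or it
   accumulates to at least beta * r * e1, which forces v above C. *)
have [[t [t0 tr mt]]|nh] := pselect (exists t, [/\ 0 <= t, t <= r &
    \int[P y]_om killed (phi v) s' (fun=> t) om <= e1]).
  left; have ht := real_stopping_time_cst hX t0.
  have h1 := J_penalized hX oO alpha0 mf mF fM FM beta_gt0 hv y s'0 ht.
  have h2 := Jlow t t0 tr.
  by move: h1 h2 mt cr; move: (\int[_]_om _) (2 * MF * e1) (c * r) (JJ _ _ _) => *; lra.
right; have hr := real_stopping_time_cst hX (ltW r0).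
have big : (r - 0) * e1 <= \int[P y]_om (\1_setT om *
    (running_payoff X alpha (phi v) s' (mine r%:E (T om)) om -
     running_payoff X alpha (phi v) s' (mine 0%:E (T om)) om)).
  apply: (mean_slice_ge hX oO alpha0) => // u u0 ur.
  rewrite leNgt; apply/negP => h; apply: nh; exists u; split => //.
  apply/ltW; apply: le_lt_trans h; rewrite le_eqVlt; apply/orP; left; apply/eqP.
  by apply: eq_Rintegral => om _; rewrite indicT mul1r.
have -> : v s' y = \int[P y]_om (reward s' (fun=> r) om + killed v s' (fun=> r) om) +
    beta * \int[P y]_om running_payoff X alpha (phi v) s' (mine r%:E (T om)) om.
  exact: (penalized_restart hX oO alpha0 hf hF beta_gt0 hv y s'0 hr).
have low : - (2 * C) <= \int[P y]_om (reward s' (fun=> r) om + killed v s' (fun=> r) om).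
  apply: PE_ge.
    apply: bmeasD; first exact: (bmeas_stopped_reward hX oO alpha0 hf hF s'0 hr).
    exact: (bmeas_killed_payoff hX oO alpha0 hr av s'0).
  move=> om.
  have k1 : - C <= killed v s' (fun=> r) om.
    have vC (u : R) z : 0 <= u -> `|v u z| <= C.
      by move=> u0; exact: (penalized_bound hX oO alpha0 mf mF fM FM beta_gt0 hv).
    by have := killed_payoff_bound X O alpha0 (w := om) s'0 (ltW r0) vC; rewrite ler_norml => /andP[].
  have k2 : - (Mf / alpha) <= running_payoff X alpha f s' (mine r%:E (T om)) om.
    have := running_payoff_bound alpha0 mf fM (mine r%:E (T om)) (path om) s'0.
    by rewrite ler_norml => /andP[].
  have k3 : - MF <= terminal_payoff X alpha F s' (T om) om.
    have := terminal_payoff_bound alpha0 FM (path om) s'0 (first_exit_ge0 O (path om : rpath E)).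
    by rewrite ler_norml => /andP[].
  have k4 : - MF <= \1_(~` before_exit X O (fun=> r)) om * terminal_payoff X alpha F s' (T om) om.
    by rewrite indicE; case: (_ \in _); rewrite ?mul1r// mul0r oppr_le0.
  rewrite /stopped_reward; move: k1 k2 k4; rewrite /payoff_sup.
  by move: (running_payoff _ _ _ _ _ _) (_ * terminal_payoff _ _ _ _ _ _) (killed _ _ _ _) (Mf / alpha) => *; lra.
have hrun : r * e1 <= \int[P y]_om running_payoff X alpha (phi v) s' (mine r%:E (T om)) om.
  move: big; rewrite subr0 => /le_trans; apply; rewrite le_eqVlt; apply/orP; left; apply/eqP.
  by apply: eq_Rintegral => om _; rewrite indicT mul1r (running_payoff0 _ hX alpha0)// subr0.
have MFC : MF <= C by rewrite lerDr divr_ge0// ltW.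
apply: le_trans MFC _.
have : 3 * C <= beta * (r * e1).
  rewrite -ler_pdivrMr//; apply: le_trans bb; rewrite /beta0.
  by rewrite lerDl.
have : beta * (r * e1) <= beta * \int[P y]_om running_payoff X alpha (phi v) s' (mine r%:E (T om)) om.
  by rewrite ler_pM2l.
by move: low; move: (\int[_]_om (_ + _)) (beta * (r * e1)) (beta * _) => *; lra.
Qed.

(** * Pointwise convergence along sequences of parameters *)

Section sequences.
Variables (beta_ : nat -> R) (v_ : nat -> R -> E -> R).
Hypothesis beta_gt0 : forall n, 0 < beta_ n.
Hypothesis beta_cvg : beta_ n @[n --> \oo] --> +oo.
Hypothesis hv_ : forall n, solution (beta_ n) (v_ n).

(** Although [penalty_small] concerns points of [O], any [x] is allowed: before the exit the
    position at [sigma] lies in [O], and afterwards the killed penalty is 0. Dominated convergence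
    along paths does the rest. *)
Lemma penalized_cvg s x : 0 <= s -> v_ n s x @[n --> \oo] --> w s x.
Proof.
move=> s0; apply/cvgrPdist_le => e e0; have e3 : 0 < e / 3 by rewrite divr_gt0.
have [_ [tau ht <-] Jtau] := sup_adherent e3 (value_has_sup hX oO alpha0 mf mF fM FM x s0).
have C20 : 0 <= 2 * C by rewrite mulr_ge0.
have [r r0 hr] := discount_small alpha0 C20 e3.
have Jr := J_truncate hX oO alpha0 mf mF fM FM x s0 (ltW r0) ht.
pose sigma om := fine (mine (tau om) r%:E).
have hs : real_stopping_time Ft sigma by exact: (stopping_time_truncate hX ht (ltW r0)).
have : \int[P x]_om killed (phi (v_ n)) s sigma om @[n --> \oo] --> \int[P x]_om (0 : R).
{ apply: (E_cvg (M := 2 * C)).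
  - move=> n; have av := admissible_solution (hv_ n).
    exact: (bmeas_killed_payoff hX oO alpha0 hs (admissible_penalty hF av) s0).1.
  - move=> n om; apply: (killed_payoff_bound X O alpha0 s0 (hs.1 om)) => u z u0.
    exact: (penalty_bound hX oO alpha0 mf mF fM FM (beta_gt0 n) (hv_ n)).
  - move=> om; rewrite /killed_payoff.
    case: (before_exitP X O sigma om) => -[sT ->]; last first.
      by under eq_fun do rewrite mul0r; exact: cvg_cst.
    have OX : O (X (sigma om) om) by exact: (first_exit_in (hs.1 om) sT).
    have s1 : 0 <= s + sigma om by rewrite addr_ge0// hs.1.
    apply/cvgrPdist_le => e' e'0.
    have [delta [b0 [d0 b00 h]]] := penalty_small s1 OX e'0.
    have /cvgryPge/(_ b0)[N _ hN] := beta_cvg.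
    exists N => // n /= Nn; rewrite sub0r normrN mul1r normrM ger0_norm ?expR_ge0//.
    rewrite ger0_norm ?penalty_ge0//.
    have p1 : phi (v_ n) (s + sigma om) (X (sigma om) om) <= e'.
      by apply: (h (beta_ n)) => //; [exact: hN|rewrite subrr normr0|rewrite mdistxx].
    apply: le_trans p1; rewrite ler_piMl ?penalty_ge0//.
    by apply: discount_le1 => //; exact: hs.1. }
rewrite PE_cst => /cvgrPdist_le/(_ _ e3)[N _ hN].
exists N => // n /= Nn; have := hN n Nn; rewrite sub0r normrN => kn.
have vw := penalized_le_value hX oO alpha0 mf mF fM FM (beta_gt0 n) (hv_ n) x s0.
rewrite ger0_norm ?subr_ge0//.
have Jv := J_penalized hX oO alpha0 mf mF fM FM (beta_gt0 n) (hv_ n) x s0 hs.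
move: kn; rewrite ler_norml => /andP[_ kn].
move: Jtau Jr Jv hr kn; rewrite -/(w s x) -/(sigma).
move: (\int[_]_om _) (2 * C * _) (JJ s x tau) (JJ s x _) => a b c0 c1 h1 h2 h3 h4 h5.
by move: (w s x) (v_ n s x) h1 h2 h3 h4 h5 => *; lra.
Qed.

(** A supremum over uncountably many stopping times; its measurability comes from the pointwise
    convergence. *)
Lemma measurable_value_at t : 0 <= t -> bmeas (w t : Borel E -> R).
Proof.
move=> t0; split; last first.
  by exists C => y; exact: (value_bound hX oO alpha0 mf mF fM FM).
apply: (measurable_fun_cvg (h := fun n => v_ n t : Borel E -> R)).
  move=> n; have [mv _] := admissible_solution (hv_ n).
  exact: (measurable_half_space_comp mv (a := cst t) (b := id)).
by move=> y _; exact: penalized_cvg.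
Qed.

(** [penalized_comparison] passes to the limit along [v_ n], as its bound [k] involves only [u].
    Discount and killing are dropped from the last term, which leaves a semigroup. *)
Lemma value_comparison beta u s x r k : 0 < beta -> solution beta u -> 0 <= s -> 0 < r ->
  (forall sigma, real_stopping_time Ft sigma -> (forall om, sigma om <= r) ->
    \int[P x]_om killed (phi u) s sigma om <= k) ->
  w s x - u s x <= k + \int[P x]_om `|w (s + r) (X r om) - u (s + r) (X r om)|.
Proof.
move=> beta0 hu s0 r0 hk; have sr0 : 0 <= s + r by rewrite addr_ge0// ltW.
have au := admissible_solution hu.
pose D n om := `|v_ n (s + r) (X r om) - u (s + r) (X r om)|.
have mat v (av : admissible_payoff v) : measurable_fun setT (fun om => v (s + r) (X r om)).
  apply: (measurable_half_space_comp av.1 (a := cst (s + r)) (b := X r)) => //.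
  exact: (measurable_X hX (ltW r0)).
have mD n : measurable_fun setT (D n).
  apply: measurableT_comp => //; apply: measurable_funB; apply: mat => //.
  exact: (admissible_solution (hv_ n)).
have Db n om : `|D n om| <= 2 * C.
  rewrite normr_id (le_trans (ler_normB _ _))// mulr_natl mulr2n lerD//.
    exact: (penalized_bound hX oO alpha0 mf mF fM FM (beta_gt0 n) (hv_ n)).
  exact: (penalized_bound hX oO alpha0 mf mF fM FM beta0 hu).
have cD : \int[P x]_om D n om @[n --> \oo] -->
    \int[P x]_om `|w (s + r) (X r om) - u (s + r) (X r om)|.
  apply: (E_cvg (M := 2 * C)) => // om; apply: (@cvg_norm _ R^o).
  by apply: (@cvgB _ R^o); [exact: penalized_cvg|exact: cvg_cst].
have bnd n : v_ n s x - u s x <= k + \int[P x]_om D n om.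
{ have h := penalized_comparison hX oO alpha0 mf mF fM FM beta0 (beta_gt0 n) hu (hv_ n) s0 r0 hk.
  apply: le_trans h _; rewrite lerD2l; apply: E_le.
  - apply: (bmeas_killed_payoff hX oO alpha0) => //; first exact: (real_stopping_time_cst hX (ltW r0)).
    have [md [N dN]] := admissible_sub (admissible_solution (hv_ n)) au.
    split; first exact: measurableT_comp.
    by exists N => t y t0; rewrite normr_id; exact: dN.
  - by split => //; exists (2 * C) => om; exact: Db.
  - move=> om; rewrite /killed_payoff /D; set a := `|_|.
    have a0 : 0 <= a by exact: normr_ge0.
    have e1 : expR (- (alpha * r)) <= 1 by apply: discount_le1 => //; exact: ltW.
    rewrite indicE; case: (_ \in _); rewrite ?mul1r ?mul0r//.
    by rewrite ler_piMl. }
have c1 : v_ n s x - u s x @[n --> \oo] --> w s x - u s x.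
  by apply: (@cvgB _ R^o); [exact: penalized_cvg|exact: cvg_cst].
have c2 : k + \int[P x]_om D n om @[n --> \oo] --> k + \int[P x]_om `|w (s + r) (X r om) - u (s + r) (X r om)|.
  by apply: (@cvgD _ R^o); [exact: cvg_cst|exact: cD].
apply: (@ler_cvg_to _ _ _ _ _ _ _ _ c1 c2).
by apply: nearW => n; exact: bnd.
Qed.

End sequences.

(** * Locally uniform convergence *)

Section limit.
Variable wb : R -> R -> E -> R.
Hypothesis hwb : forall beta : R, 0 < beta -> solution beta (wb beta).
Hypothesis A3 : strongly_feller P X.

Let succ_gt0 n : 0 < n.+1%:R :> R. Proof. by rewrite ltr0n. Qed.
Let succ_cvg : n.+1%:R @[n --> \oo] --> (+oo : set_system R).
Proof.
apply/cvgryPge => A; exists (Num.truncn A) => // n /= An.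
by rewrite (le_trans (ltW (truncnS_gt A)))// ler_nat ltnS.
Qed.
Let hsucc n : solution n.+1%:R (wb n.+1%:R). Proof. exact: hwb. Qed.

Lemma local_uniform s x (e : R) : 0 <= s -> O x -> 0 < e ->
  exists delta beta0 : R, [/\ 0 < delta, 0 < beta0 & forall beta s' y,
    beta0 <= beta -> 0 <= s' -> `|s' - s| < delta -> mdist x y < delta ->
    `|w s' y - wb beta s' y| <= e].
Proof.
(* The penalty up to the common date and the discrepancy at that date each cost [e1 + 2 * C * e1],
   the second summand coming from early exits. *)
move=> s0 Ox e0; pose e1 := e / (2 * (1 + 2 * C)).
have den : 0 < 2 * (1 + 2 * C) by rewrite mulr_gt0// ltr_pwDl// mulr_ge0.
have e10 : 0 < e1 by rewrite divr_gt0.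
have [eta [b0 [eta0 b00 hphi]]] := penalty_small s0 Ox e10.
have [delta1 [r1 [delta10 r10 hexit]]] := small_time_exit hX hE hFeller x eta0 e10.
(* The common date is [t = s + rho]. From a start [s'] within [rho / 2] of [s] it is reached after
   [r] between [rho / 2] and [2 * rho], within the range of both the exit and the penalty
   estimates. *)
pose rho := Num.min r1 eta / 2.
have rho0 : 0 < rho by rewrite divr_gt0// lt_min r10.
have rho1 : 2 * rho <= r1 by rewrite /rho mulrC divfK// ge_min lexx.
have rho2 : 2 * rho <= eta by rewrite /rho mulrC divfK// ge_min lexx orbT.
(* The last [a] units before the date [t] are reserved for smoothing by [P_a]; [a < rho / 2 < r]
   leaves a nonnegative time before. *)
pose a := rho / 4; pose t := s + rho.
have a0 : 0 < a by rewrite divr_gt0.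
have t0 : 0 <= t by rewrite addr_ge0// ltW.
apply: contrapT => nh.
(* Arguing by contradiction produces a sequence of parameters tending to infinity; over a countable
   family the suprema below stay measurable. *)
have : forall n : nat, exists z : R * (R * E), [/\ b0 + n%:R <= z.1, 0 <= z.2.1,
    `|z.2.1 - s| < Num.min delta1 (rho / 2), mdist x z.2.2 < Num.min delta1 (rho / 2) &
    ~ `|w z.2.1 z.2.2 - wb z.1 z.2.1 z.2.2| <= e].
{ move=> n; apply: contrapT => /forallNP h; apply: nh.
  exists (Num.min delta1 (rho / 2)), (b0 + n%:R); split.
  - by rewrite lt_min delta10 divr_gt0.
  - by rewrite ltr_pwDl.
  - move=> beta s' y h1 h2 h3 h4; apply: contrapT => h5.
    by apply: (h (beta, (s', y))). }
move=> /choice[z hz]; pose b n := (z n).1; pose u n := wb (b n).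
have bge n : b0 + n%:R <= b n by have [] := hz n.
have bgt n : 0 < b n by apply: lt_le_trans (bge n); rewrite ltr_pwDl.
have bcvg : b n @[n --> \oo] --> +oo.
  apply/cvgryPge => A; exists (Num.truncn A).+1 => // n /= An.
  rewrite (le_trans (ltW (truncnS_gt A)))// (le_trans _ (bge n))//.
  by rewrite ler_wpDl ?(ltW b00)// ler_nat.
have hu n : solution (b n) (u n) by exact: hwb.
have bw : bmeas (w t : Borel E -> R).
  exact: (measurable_value_at succ_gt0 succ_cvg hsucc t0).
pose D m y := `|w t y - u m t y|.
have D2C m y : `|D m y| <= 2 * C.
  rewrite normr_id (le_trans (ler_normB _ _))// mulr_natl mulr2n lerD//.
    exact: (value_bound hX oO alpha0 mf mF fM FM).
  exact: (penalized_bound hX oO alpha0 mf mF fM FM (bgt m) (hu m)).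
have mD m : measurable_fun setT (D m : Borel E -> R).
  apply: measurableT_comp => //; apply: measurable_funB; first exact: bw.1.
  have [mv _] := admissible_solution (hu m).
  exact: (measurable_half_space_comp mv (a := cst t) (b := id)).
have D0 y : D m y @[m --> \oo] --> (0 : R).
  have : `|w t y - u m t y| @[m --> \oo] --> `|w t y - w t y|.
    apply: (@cvg_norm _ R^o); apply: (@cvgB _ R^o); first exact: cvg_cst.
    exact: (penalized_cvg bgt bcvg hu).
  by rewrite subrr normr0.
have ubD y : has_ubound (range (D ^~ y)).
  by exists (2 * C) => _ [m _ <-]; apply: le_trans (ler_norm _) (D2C m y).
(* The tail suprema dominate [D], decrease in [k] and still tend to 0, as Dini's theorem
   requires. *)
pose g k y := sups (D ^~ y) k.
have Dg k m y : (k <= m)%N -> D m y <= g k y.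
  move=> km; apply: ub_le_sup; last by exists m.
  by have [M hM] := ubD y; exists M => _ [i _ <-]; apply: hM; exists i.
have g0 k y : 0 <= g k y by apply: le_trans (Dg k k y (leqnn k)); exact: normr_ge0.
have g2C k y : `|g k y| <= 2 * C.
  rewrite ger0_norm//; apply: ge_sup.
    by exists (D k y), k => //=.
  by move=> _ [i _ <-]; apply: le_trans (ler_norm _) (D2C i y).
have gnd k l y : (k <= l)%N -> g l y <= g k y by apply: nonincreasing_sups.
have gcvg y : g k y @[k --> \oo] --> (0 : R) by apply: cvg_sups.
have bg k : bmeas (g k : Borel E -> R).
  split; last by exists (2 * C).
  apply: measurable_fun_sups => //; move=> y _; exact: ubD.
have bgX k c : 0 <= c -> bmeas (fun om => g k (X c om)) by move=> c0; exact: (bmeas_X hX c0 (bg k)).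
(* Strong Feller continuity of P_a g_k turns the pointwise convergence of the
   nonincreasing g_k into uniform convergence on a closed ball. *)
pose q k := semigroup P X a (g k).
have [_ _ cK] := hE.
have [k hk] : exists k, forall y, metric_closed_ball x eta y -> q k y <= e1.
{ apply: dini => //.
  - by move=> k; apply: A3 => //; [exact: (bg k).2|exact: (bg k).1].
  - move=> k l y kl; apply: E_le; [exact: bgX (ltW a0)|exact: bgX (ltW a0)|].
    by move=> om; exact: gnd.
  - move=> y _; have : \int[P y]_om g k (X a om) @[k --> \oo] --> \int[P y]_om (0 : R).
      apply: (E_cvg (M := 2 * C)) => //.
      by move=> k; exact: (bgX k a (ltW a0)).1.
    by rewrite PE_cst. }
(* The index found by Dini also selects the offending point, and [D k <= g k]. *)
have [h1 s'0 h3 h4 h5] := hz k; apply: h5.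
set s' := (z k).2.1 in s'0 h3 *; set y := (z k).2.2 in h4 *.
move: h3 h4; rewrite !lt_min => /andP[_ s's] /andP[yd1 yrho].
pose r := t - s'.
have [r_lo r_hi] : rho / 2 < r /\ r < 2 * rho.
  by move: s's; rewrite /r /t ltr_norml; lra.
have r0 : 0 < r by apply: le_lt_trans r_lo; rewrite divr_ge0// ltW.
have ar : 0 <= r - a by rewrite /a; move: r_lo; lra.
pose B := [set om | (exit_time X (metric_ball x eta) om <= r1%:E)%E].
have mB : measurable B.
  apply: (Ft_measurable hX (ltW r10)).
  by apply: (exit_stopping_time hX (open_metric_ball x eta)).2; exact: ltW.
have bB : bmeas (fun om => \1_B om : R) by exact: bmeas_indic.
have PB : \int[P y]_om \1_B om <= e1 by exact: hexit.
have inball om v : ~ B om -> 0 <= v -> v <= r1 -> mdist x (X v om) < eta.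
  move=> nB v0 vr; apply: (first_exit_in (O := metric_ball x eta) (p := path om)) => //.
  rewrite (le_lt_trans (_ : _ <= r1%:E)%E) ?lee_fin//.
  by move/negP: nB; rewrite -ltNge.
have hkill sigma : real_stopping_time Ft sigma -> (forall om, sigma om <= r) ->
    \int[P y]_om killed (phi (u k)) s' sigma om <= e1 + 2 * C * e1.
{ move=> hs sr.
  apply: (@le_trans _ _ (\int[P y]_om (e1 + 2 * C * \1_B om))).
    apply: E_le.
    { apply: (bmeas_killed_payoff hX oO alpha0 hs _ s'0).
      exact: (admissible_penalty hF (admissible_solution (hu k))). }
    { by apply: bmeasD; [exact: bmeas_cst|exact: bmeasZ]. }
    move=> om; have sb : 0 <= s' + sigma om by rewrite addr_ge0// hs.1.
    have kb : `|killed (phi (u k)) s' sigma om| <= 2 * C.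
      apply: (killed_payoff_bound X O alpha0 s'0 (hs.1 om)) => c c' c0.
      exact: (penalty_bound hX oO alpha0 mf mF fM FM (bgt k) (hu k)).
    have [[Bom -> _]|[nB -> _]] := indic_split R B om.
      by rewrite mulr1 (le_trans (ler_norm _))// (le_trans kb)// lerDr ltW.
    rewrite mulr0 addr0.
    have sr1 : sigma om <= r1 by rewrite (le_trans (sr om))// (le_trans (ltW r_hi)).
    have p1 : phi (u k) (s' + sigma om) (X (sigma om) om) <= e1.
      apply: (hphi (b k)) => //.
      { by rewrite (le_trans _ (bge k))// lerDl. }
      { have := sr om; have := hs.1 om; move: s's; rewrite /r /t !ltr_norml.
        by move: rho2 rho0; lra. }
      exact: (inball _ _ nB (hs.1 om) sr1).
    rewrite /killed_payoff; apply: le_trans p1.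
    have e_1 : expR (- (alpha * sigma om)) <= 1 by apply: discount_le1 => //; exact: hs.1.
    have p0 := penalty_ge0 F (u k) (s' + sigma om) (X (sigma om) om).
    rewrite indicE; case: (_ \in _); rewrite ?mul1r ?mul0r//.
    by rewrite ler_piMl.
  rewrite E_D ?PE_cst ?E_Z//; [|exact: bmeas_cst|exact: bmeasZ].
  by rewrite lerD2l ler_wpM2l// mulr_ge0. }
have cmp := value_comparison succ_gt0 succ_cvg hsucc (bgt k) (hu k) s'0 r0 hkill.
have vw := penalized_le_value hX oO alpha0 mf mF fM FM (bgt k) (hu k) y s'0.
rewrite ger0_norm ?subr_ge0//; apply: le_trans cmp _.
have tE : s' + r = t by rewrite /r addrC subrK.
rewrite tE.
suff tail : \int[P y]_om `|w t (X r om) - u k t (X r om)| <= e1 + 2 * C * e1.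
  apply: le_trans (lerD (lexx _) tail) _.
  rewrite (_ : e = e1 * (2 * (1 + 2 * C))); last by rewrite /e1 divfK ?gt_eqF.
  by move: (C) => c; lra.
apply: (@le_trans _ _ (\int[P y]_om g k (X r om))).
  apply: E_le; [|exact: bgX (ltW r0)|by move=> om; exact: (Dg k k)].
  by apply: (bmeas_X hX (ltW r0) (h := D k)); split => //; exists (2 * C).
(* The Markov property at [r - a]: without an early exit the position at that time is in the closed
   ball, where [q k <= e1]. *)
have -> : \int[P y]_om g k (X r om) = \int[P y]_om q k (X (r - a) om).
  have [_ /(_ (fun=> r - a) setT y (real_stopping_time_cst hX ar) (stopped_algebraT (real_stopping_time_cst hX ar)))] :=
    strong_markov_marginal hX (ltW a0) (bg k).
  under eq_Rintegral do rewrite indicT mul1r subrK.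
  under [X in _ = X -> _]eq_Rintegral do rewrite indicT mul1r.
  by [].
have [mq _] := strong_markov_marginal hX (ltW a0) (bg k).
have q2C c : `|q k c| <= 2 * C by apply: (semigroup_bound hX _ (ltW a0) (bg k)).
have bq : bmeas (q k : Borel E -> R) by split => //; exists (2 * C).
apply: (@le_trans _ _ (\int[P y]_om (e1 + 2 * C * \1_B om))); last first.
  rewrite E_D ?PE_cst ?E_Z//; [|exact: bmeas_cst|exact: bmeasZ].
  by rewrite lerD2l ler_wpM2l// mulr_ge0.
apply: E_le; [exact: (bmeas_X hX ar bq)|by apply: bmeasD; [exact: bmeas_cst|exact: bmeasZ]|].
move=> om; have [[Bom -> _]|[nB -> _]] := indic_split R B om.
  by rewrite mulr1 (le_trans (ler_norm _))// (le_trans (q2C _))// lerDr ltW.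
rewrite mulr0 addr0; apply: hk; rewrite /metric_closed_ball /=; apply/ltW.
apply: inball => //; rewrite (le_trans _ rho1)// (le_trans _ (ltW r_hi))//.
by rewrite gerBl ltW.
Qed.

Lemma penalized_cvg_uniform (K : set (R * E)) : compact K -> K `<=` half_space O ->
  {uniform K, (fun p : R * E => wb beta p.1 p.2) @[beta --> +oo] -->
     (fun p : R * E => w p.1 p.2)}.
Proof.
move=> cK KO U /uniform_nbhs[V [entV VU]].
have [e e0 eV] : exists2 e : R, 0 < e & forall c c' : R, `|c - c'| <= e -> V (c, c').
  have [e /= e0 h] := entV.
  exists (e / 2); first by rewrite divr_gt0.
  move=> c c' cc; apply: h; rewrite /= /ball/=.
  by rewrite (le_lt_trans cc)// ltr_pdivrMr// mulr2n mulrDr mulr1 ltrDl.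
have /compact_near_coveringP nK := cK.
have [A [Ar hA]] : \forall beta \near (+oo : set_system R), K `<=`
    (* The premise discards neighbouring points at negative times. *)
    (fun p => half_space O p -> `|w p.1 p.2 - wb beta p.1 p.2| <= e).
  apply: nK => p Kp; have [] := KO _ Kp; rewrite /= in_itv/= andbT => p0 Op.
  have [delta [b0 [d0 b00 h]]] := local_uniform p0 Op e0.
  exists ([set p' | `|p'.1 - p.1| < delta /\ mdist p.2 p'.2 < delta], [set beta | b0 < beta]).
    split; last by exists b0; split => //; exact: num_real.
    exists ([set c | `|c - p.1| < delta], metric_ball p.2 delta).
      split => /=; last by apply/nbhs_metricP; exists delta.
      by apply/nbhs_ballP; exists delta => // c; rewrite /ball/= distrC.
    by move=> [c c'] /= [].
  move=> [p' beta] /= [[p1 p2] bb] [p'0 _]; apply: h => //; first exact: ltW.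
  by move: p'0; rewrite /= in_itv/= andbT.
exists A; split => // beta Ab; apply: VU => p Kp; apply: eV.
exact: (hA beta Ab p Kp (KO p Kp)).
Qed.

End limit.

End convergence.

Theorem proposition4 (R : realType) (E : pmetricType R)
    (d : measure_display) (Omega : measurableType d)
    (P : E -> probability Omega R) (Ft : R -> set (set Omega))
    (X : R -> Omega -> E) (O : set E) (alpha : R) (f F : R -> E -> R)
    (wb : R -> R -> E -> R)
    (hE : admissible_state_space E)
    (hX : standard_markov_process P Ft X)
    (hFeller : weakly_feller P X)
    (hO : open O)
    (halpha : 0 < alpha)
    (hf : payoff_function f)
    (hF : payoff_function F)
    (hFO : continuous_on_half_space O F)
    (hwb : forall beta : R, 0 < beta ->
       penalized_solution P X alpha f F O beta (wb beta))
    (A1 : killed_feller P X O)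
    (A3 : strongly_feller P X) :
  (forall (s : R) (x : E), 0 <= s ->
     wb beta s x @[beta --> +oo] --> value P Ft X alpha f F O s x) /\
  (forall K : set (R * E), compact K -> K `<=` half_space O ->
     {uniform K, (fun p : R * E => wb beta p.1 p.2) @[beta --> +oo] -->
        (fun p : R * E => value P Ft X alpha f F O p.1 p.2)}).
Proof.
have [mf [Mf fM] _] := hf; have [mF [MF FM] _] := hF.
split=> [s x s0|K cK KO]; last first.
  exact: (penalized_cvg_uniform hE hX hFeller hO halpha mf mF fM FM hFO hwb A3 cK KO).
apply/cvg_pinftyP => u u_cvg.
(* The sequence lemma requires every parameter to be positive; the maximum with 1 agrees with [u n]
   from some index on. *)
have b_gt0 n : 0 < Num.max (u n) 1 by rewrite lt_max ltr01 orbT.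
have b_cvg : Num.max (u n) 1 @[n --> \oo] --> +oo.
  apply/cvgryPge => A; move/cvgryPge/(_ A) : u_cvg; apply: filterS => n An.
  by rewrite le_max An.
have := penalized_cvg hE hX hFeller hO halpha mf mF fM FM hFO b_gt0 b_cvg
  (fun n => hwb _ (b_gt0 n)) s0.
move=> /(_ x); apply: cvg_trans; apply: near_eq_cvg.
move/cvgryPge/(_ 1) : u_cvg; apply: filterS => n un.
by rewrite max_l.
Qed.
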